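(* Let $\Gamma_{0}\subseteq\mathrm{PSL}_{2}(\mathbb{R})$ be a fixed Fuchsian subgroup of the first kind. Then there is a constant $C>0$, depending solely on $\Gamma_{0}$, such that for every subgroup $\Gamma\subseteq\Gamma_{0}$ of finite index and every integer $k\geq 1$ one has $$\sup_{z\in M}S_{k}^{\Gamma}(z)\leq C\,k^{3/2},\qquad M=\Gamma\backslash\mathbb{H}.$$ Moreover, if $\Gamma_{0}$ is cocompact, then there is a constant $C'>0$, depending solely on $\Gamma_{0}$, such that for every subgroup $\Gamma\subseteq\Gamma_{0}$ of finite index and every integer $k\geq 1$ one has the improved bound $$\sup_{z\in M}S_{k}^{\Gamma}(z)\leq C'\,k.$$
   Context: $\mathbb{H}=\{z=x+iy\in\mathbb{C}: y>0\}$ is the upper half-plane, on which $\mathrm{PSL}_{2}(\mathbb{R})$ acts by fractional linear transformations. ''Fuchsian subgroup of the first kind'' means a discrete subgroup $\Gamma\subseteq\mathrm{PSL}_{2}(\mathbb{R})$ such that $M:=\Gamma\backslash\mathbb{H}$ has finite hyperbolic area (it has finite genus, finitely many cusps and finitely many elliptic fixed points); $\Gamma$ may contain elliptic and parabolic elements. $\Gamma$ is cocompact if $M$ is compact. $\mu_{\mathrm{hyp}}(z)=\frac{\mathrm{d}x\wedge\mathrm{d}y}{y^{2}}$ is the hyperbolic volume form. For an integer $k\geq 1$, $\mathcal{S}_{2k}^{\Gamma}$ is the finite-dimensional complex vector space of cusp forms of weight $2k$ for $\Gamma$, i.e. holomorphic $f:\mathbb{H}\to\mathbb{C}$ with $f(\gamma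 z)=(cz+d)^{2k}f(z)$ for all $\gamma=\begin{pmatrix}a&b\\c&d\end{pmatrix}\in\Gamma$ that vanish at all cusps of $M$. It carries the Petersson inner product $\langle f_{1},f_{2}\rangle=\int_{M}f_{1}(z)\overline{f_{2}(z)}\,y^{2k}\,\mu_{\mathrm{hyp}}(z)$. For an orthonormal basis $\{f_{1},\ldots,f_{d}\}$ of $\mathcal{S}_{2k}^{\Gamma}$, put $$S_{k}^{\Gamma}(z):=\sum_{j=1}^{d}|f_{j}(z)|^{2}\,\mathrm{Im}(z)^{2k}\qquad(z\in\mathbb{H}).$$ This is independent of the choice of orthonormal basis and is $\Gamma$-invariant, hence a function on $M$. *)

(* Defs.v *)
From HB Require Import structures.
From mathcomp Require Import all_boot all_order all_algebra.
From mathcomp Require Import all_classical all_reals all_analysis.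
From mathcomp Require Import generic_quotient complex ring lra.
Import Order.TTheory GRing.Theory Num.Theory.
Import numFieldNormedType.Exports.

Set Implicit Arguments.
Unset Strict Implicit.
Unset Printing Implicit Defensive.

Local Open Scope classical_set_scope.
Local Open Scope ring_scope.
Local Open Scope quotient_scope.

Section SpecialLinear.
Variable R : realType.

Definition SL2 : Type := [set A : 'M[R]_2 | \det A = 1].

HB.instance Definition _ := SubType.copy SL2 (set_type [set A : 'M[R]_2 | \det A = 1]).
HB.instance Definition _ := Choice.copy SL2 (set_type [set A : 'M[R]_2 | \det A = 1]).
HB.instance Definition _ :=
  Topological.copy SL2 (set_type [set A : 'M[R]_2 | \det A = 1]).

Lemma SL2_det (A : SL2) : \det (val A) = 1.
Proof. by case: A => A /= /set_mem. Qed.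

Lemma SL2_det2 (A : SL2) :
  val A 0 0 * val A 1 1 - val A 0 1 * val A 1 0 = 1.
Proof.
apply: etrans (SL2_det A).
rewrite (expand_det_row _ 0) !big_ord_recl big_ord0 addr0.
rewrite /cofactor !det_mx11 !mxE /= expr0 mul1r expr1 mulN1r mulrN.
by congr (_ * val A _ _ - val A _ _ * val A _ _); apply: val_inj.
Qed.

Lemma SL2_unitmx (A : SL2) : val A \in unitmx.
Proof. by rewrite unitmxE SL2_det unitr1. Qed.

Lemma SL2_one_subproof :
  (1%:M : 'M[R]_2) \in [set A : 'M[R]_2 | \det A = 1].
Proof. by apply/mem_set; rewrite /= det1. Qed.

Lemma SL2_mul_subproof (A B : SL2) :
  (val A *m val B) \in [set A : 'M[R]_2 | \det A = 1].
Proof. by apply/mem_set; rewrite /= det_mulmx !SL2_det mulr1. Qed.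

Lemma SL2_inv_subproof (A : SL2) :
  invmx (val A) \in [set A : 'M[R]_2 | \det A = 1].
Proof. by apply/mem_set; rewrite /= det_inv SL2_det invr1. Qed.

Definition SL2_one : SL2 := Sub 1%:M SL2_one_subproof.
Definition SL2_mul (A B : SL2) : SL2 :=
  Sub (val A *m val B) (SL2_mul_subproof A B).
Definition SL2_inv (A : SL2) : SL2 := Sub (invmx (val A)) (SL2_inv_subproof A).

Lemma SL2_mulA : associative SL2_mul.
Proof. by move=> A B C; apply: val_inj => /=; rewrite mulmxA. Qed.
Lemma SL2_mul1 : left_id SL2_one SL2_mul.
Proof. by move=> A; apply: val_inj => /=; rewrite mul1mx. Qed.
Lemma SL2_mulr1 : right_id SL2_one SL2_mul.
Proof. by move=> A; apply: val_inj => /=; rewrite mulmx1. Qed.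
Lemma SL2_mulV : left_inverse SL2_one SL2_inv SL2_mul.
Proof. by move=> A; apply: val_inj => /=; rewrite mulVmx ?SL2_unitmx. Qed.
Lemma SL2_mulrV : right_inverse SL2_one SL2_inv SL2_mul.
Proof. by move=> A; apply: val_inj => /=; rewrite mulmxV ?SL2_unitmx. Qed.

HB.instance Definition _ :=
  isGroup.Build SL2 SL2_mulA SL2_mul1 SL2_mulr1 SL2_mulV SL2_mulrV.

Lemma val_SL2M (A B : SL2) : val (A * B)%g = val A *m val B.
Proof. by []. Qed.
Lemma val_SL2V (A : SL2) : val (A^-1)%g = invmx (val A).
Proof. by []. Qed.
Lemma val_SL21 : val (1%g : SL2) = 1%:M.
Proof. by []. Qed.

End SpecialLinear.

Section ProjectiveSpecialLinear.
Variable R : realType.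

Definition eq_up_to_sign (A B : SL2 R) : bool :=
  (val A == val B) || (val A == - val B).

Lemma eq_up_to_sign_refl : reflexive eq_up_to_sign.
Proof. by move=> A; rewrite /eq_up_to_sign eqxx. Qed.

Lemma eq_up_to_sign_sym : symmetric eq_up_to_sign.
Proof.
move=> A B; rewrite /eq_up_to_sign [val B == val A]eq_sym; congr orb.
by rewrite -eqr_oppLR eq_sym.
Qed.

Lemma eq_up_to_sign_trans : transitive eq_up_to_sign.
Proof.
move=> B A C; rewrite /eq_up_to_sign.
by case/orP=> /eqP -> /orP[]/eqP ->; rewrite ?opprK eqxx ?orbT.
Qed.

Canonical eq_up_to_sign_equiv :=
  EquivRel eq_up_to_sign eq_up_to_sign_refl eq_up_to_sign_sym
           eq_up_to_sign_trans.

Definition PSL2 : Type := quotient_topology {eq_quot eq_up_to_sign_equiv}.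

HB.instance Definition _ :=
  Quotient.copy PSL2 (quotient_topology {eq_quot eq_up_to_sign_equiv}).
HB.instance Definition _ :=
  Choice.copy PSL2 (quotient_topology {eq_quot eq_up_to_sign_equiv}).
HB.instance Definition _ :=
  Topological.copy PSL2 (quotient_topology {eq_quot eq_up_to_sign_equiv}).

Lemma PSL2_piP (A B : SL2 R) :
  reflect (\pi_PSL2 A = \pi_PSL2 B) (eq_up_to_sign A B).
Proof.
exact: (@eqquotP _ eq_up_to_sign_equiv {eq_quot eq_up_to_sign_equiv}).
Qed.

Definition PSL2_one : PSL2 := \pi_PSL2 1%g.
Definition PSL2_mul (p q : PSL2) : PSL2 := \pi_PSL2 (repr p * repr q)%g.
Definition PSL2_inv (p : PSL2) : PSL2 := \pi_PSL2 (repr p)^-1%g.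

Lemma eq_up_to_sign_repr (A : SL2 R) : eq_up_to_sign (repr (\pi_PSL2 A)) A.
Proof. by apply/PSL2_piP; rewrite reprK. Qed.

Lemma PSL2_piM (A B : SL2 R) :
  PSL2_mul (\pi_PSL2 A) (\pi_PSL2 B) = \pi_PSL2 (A * B)%g.
Proof.
apply/PSL2_piP; rewrite /eq_up_to_sign !val_SL2M.
by case/orP: (eq_up_to_sign_repr A) => /eqP ->;
   case/orP: (eq_up_to_sign_repr B) => /eqP ->;
   rewrite ?mulNmx ?mulmxN ?opprK eqxx ?orbT.
Qed.

Lemma PSL2_piV (A : SL2 R) : PSL2_inv (\pi_PSL2 A) = \pi_PSL2 (A^-1)%g.
Proof.
apply/PSL2_piP; rewrite /eq_up_to_sign !val_SL2V.
case/orP: (eq_up_to_sign_repr A) => /eqP ->; first by rewrite eqxx.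
suff -> : invmx (- val A) = - invmx (val A) by rewrite eqxx orbT.
rewrite -scaleN1r invmxZ ?invrN1 ?scaleN1r //.
by rewrite -scaleN1r unitmxE detZ SL2_det mulr1 sqrrN expr1n unitr1.
Qed.

Lemma PSL2_mulA : associative PSL2_mul.
Proof.
elim/quotW => A; elim/quotW => B; elim/quotW => C.
by rewrite (PSL2_piM B C) (PSL2_piM A B) (PSL2_piM A) (PSL2_piM _ C) mulgA.
Qed.
Lemma PSL2_mul1 : left_id PSL2_one PSL2_mul.
Proof. by elim/quotW => A; rewrite PSL2_piM mul1g. Qed.
Lemma PSL2_mulr1 : right_id PSL2_one PSL2_mul.
Proof. by elim/quotW => A; rewrite PSL2_piM mulg1. Qed.
Lemma PSL2_mulV : left_inverse PSL2_one PSL2_inv PSL2_mul.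
Proof. by elim/quotW => A; rewrite PSL2_piV PSL2_piM mulVg. Qed.
Lemma PSL2_mulrV : right_inverse PSL2_one PSL2_inv PSL2_mul.
Proof. by elim/quotW => A; rewrite PSL2_piV PSL2_piM mulgV. Qed.

HB.instance Definition _ :=
  isGroup.Build PSL2 PSL2_mulA PSL2_mul1 PSL2_mulr1 PSL2_mulV PSL2_mulrV.

Lemma pi_PSL2M (A B : SL2 R) : \pi_PSL2 (A * B)%g = (\pi_PSL2 A * \pi_PSL2 B)%g.
Proof. exact/esym/PSL2_piM. Qed.
Lemma pi_PSL2V (A : SL2 R) : \pi_PSL2 (A^-1)%g = (\pi_PSL2 A)^-1%g.
Proof. exact/esym/PSL2_piV. Qed.
Lemma pi_PSL21 : \pi_PSL2 (1%g : SL2 R) = 1%g.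
Proof. by []. Qed.

Definition is_subgroup (G : set PSL2) : Prop := group_closed (mem G).

Definition finite_index (G G0 : set PSL2) : Prop :=
  finite_set [set [set (p * q)%g | q in G] | p in G0].

Definition is_discrete (G : set PSL2) : Prop := G `<=` isolated G.

End ProjectiveSpecialLinear.

Section UpperHalfPlane.
Variable R : realType.

Definition UHP : Type := [set z : (R[i])^o | 0 < complex.Im z].

HB.instance Definition _ :=
  SubType.copy UHP (set_type [set z : (R[i])^o | 0 < complex.Im z]).
HB.instance Definition _ :=
  Choice.copy UHP (set_type [set z : (R[i])^o | 0 < complex.Im z]).
HB.instance Definition _ :=
  Topological.copy UHP (set_type [set z : (R[i])^o | 0 < complex.Im z]).

Definition reH (z : UHP) : R := complex.Re (val z : R[i]).
Definition imH (z : UHP) : R := complex.Im (val z : R[i]).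

Lemma imH_gt0 (z : UHP) : 0 < imH z.
Proof. by have := valP z; rewrite inE. Qed.

Definition automorphy (A : SL2 R) (z : UHP) : R[i] :=
  (val A 1 0)%:C%C * val z + (val A 1 1)%:C%C.

Lemma automorphyE (A : SL2 R) (z : UHP) :
  automorphy A z
    = ((val A 1 0 * reH z + val A 1 1) +i* (val A 1 0 * imH z))%C.
Proof.
by rewrite /automorphy /reH /imH; case: (val z : R[i]) => x y; simpc.
Qed.

Lemma mobius_subproof (A : SL2 R) (z : UHP) :
  ((val A 0 0)%:C%C * val z + (val A 0 1)%:C%C) / automorphy A z
    \in [set z : (R[i])^o | 0 < complex.Im z].
Proof.
apply/mem_set => /=; have D := SL2_det2 A; rewrite automorphyE.
have := imH_gt0 z; rewrite /reH /imH; set w : R[i] := val z.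
rewrite -[sval z]/w; case: w => x y /= y0.
move: (val A 0 0) (val A 0 1) (val A 1 0) (val A 1 1) D => a b c d D.
rewrite /= !mul0r !addr0 !subr0 ?add0r.
have n0 : 0 < (c * x + d) ^+ 2 + (c * y) ^+ 2.
  rewrite lt_neqAle addr_ge0 ?sqr_ge0 // andbT eq_sym paddr_eq0 ?sqr_ge0 //.
  rewrite !sqrf_eq0 mulf_eq0 (gt_eqF y0) orbF.
  apply/negP => /andP[/eqP e /eqP c0]; move: e D.
  by rewrite c0 mul0r add0r => ->; rewrite !mulr0 subr0 => /esym/eqP; rewrite oner_eq0.
rewrite [ltRHS](_ : _ = y * (a * d - b * c) / ((c * x + d) ^+ 2 + (c * y) ^+ 2)).
  by rewrite D mulr1 divr_gt0.
by field; rewrite gt_eqF.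
Qed.

Definition mobius (A : SL2 R) (z : UHP) : UHP := SigSub (mobius_subproof A z).

(* The orbit of z under a subgroup G of PSL2(R); the Moebius transformation
   of a class does not depend on the matrix representing it. *)
Definition orbitH (G : set (PSL2 R)) (z : UHP) : set UHP :=
  [set mobius A z | A in \pi_(PSL2 R) @^-1` G].

Definition same_orbit (G : set (PSL2 R)) (z w : UHP) : bool :=
  orbitH G z == orbitH G w.

Lemma same_orbit_refl G : reflexive (same_orbit G).
Proof. by move=> z; exact: eqxx. Qed.
Lemma same_orbit_sym G : symmetric (same_orbit G).
Proof. by move=> z w; exact: eq_sym. Qed.
Lemma same_orbit_trans G : transitive (same_orbit G).
Proof. by move=> w z u; rewrite /same_orbit => /eqP -> /eqP ->. Qed.

Canonical same_orbit_equiv G :=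
  EquivRel (same_orbit G) (same_orbit_refl G) (same_orbit_sym G)
           (@same_orbit_trans G).

Definition quotientH (G : set (PSL2 R)) : Type :=
  quotient_topology {eq_quot same_orbit_equiv G}.

HB.instance Definition _ G :=
  Topological.copy (quotientH G)
    (quotient_topology {eq_quot same_orbit_equiv G}).

Definition cocompact (G : set (PSL2 R)) : Prop := compact [set: quotientH G].

Definition coordH (z : UHP) : R * R := (reH z, imH z).

Definition lebesgue2 := (@lebesgue_measure R \x @lebesgue_measure R)%E.

(* Integrals over F of functions on the upper half-plane against
   dx dy / y^2; the values of valL_ outside the half-plane are irrelevant. *)
Definition hyp_area (F : set UHP) : \bar R :=
  (\int[lebesgue2]_(p in coordH @` F)
     (p.2 ^- 2)%:E)%E.

Definition hyp_Rintegral (F : set UHP) (g : UHP -> R) : R :=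
  (\int[lebesgue2]_(p in coordH @` F)
     (valL_ 0 g (p.1 +i* p.2)%C * p.2 ^- 2))%R.

Definition fundamental_domain (G : set (PSL2 R)) (F : set UHP) : Prop :=
  [/\ measurable (coordH @` F),
      forall z, orbitH G z `&` F !=set0
    & forall A : SL2 R, G (\pi_(PSL2 R) A) -> \pi_(PSL2 R) A <> 1%g ->
        hyp_area (F `&` mobius A @` F) = 0%E].

Definition fuchsian_first_kind (G : set (PSL2 R)) : Prop :=
  [/\ is_subgroup G, is_discrete G
    & exists2 F, fundamental_domain G F & (hyp_area F < +oo)%E].

End UpperHalfPlane.

Section CuspForms.
Variables (R : realType) (G : set (PSL2 R)).
Implicit Types (f g : UHP R -> R[i]) (A s : SL2 R) (k : nat).

Definition holomorphicH f : Prop :=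
  forall z : UHP R,
    derivable (valL_ 0 f : (R[i])^o -> (R[i])^o) (val z) 1.

Definition parabolic A : Prop :=
  \pi_(PSL2 R) A <> 1%g /\ `|\tr (val A)| = 2.

(* s(oo) is a cusp of G, i.e. is fixed by a parabolic element of G *)
Definition cusp_at s : Prop :=
  exists A : SL2 R, [/\ G (\pi_(PSL2 R) A), parabolic A
    & val (s^-1 * A * s)%g 1 0 = 0].

(* The Fourier expansion of f at the cusp s(oo) is that of f|s, and f vanishes
   there when f|s tends to 0 at i oo. *)
Definition slash (w : nat) f s (z : UHP R) : R[i] :=
  f (mobius s z) / automorphy s z ^+ w.

Definition vanishes_at_cusp (w : nat) f s : Prop :=
  forall e : R, 0 < e -> exists Y : R, forall z : UHP R,
    Y < imH z -> Normc.normc (slash w f s z) < e.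

Definition cusp_form k f : Prop :=
  [/\ holomorphicH f,
      forall A, G (\pi_(PSL2 R) A) ->
        forall z, f (mobius A z) = automorphy A z ^+ (2 * k) * f z
    & forall s, cusp_at s -> vanishes_at_cusp (2 * k) f s].

(* F is a fundamental domain of G; the integrand is G-invariant, so that the
   value does not depend on the choice of F. *)
Definition petersson (F : set (UHP R)) k f g : R[i] :=
  let h z := f z * (g z)^*%C * ((imH z) ^+ (2 * k))%:C%C in
  (hyp_Rintegral F (fun z => complex.Re (h z)) +i*
   hyp_Rintegral F (fun z => complex.Im (h z)))%C.

Definition cusp_form_basis k (d : nat) (f : 'I_d -> UHP R -> R[i]) : Prop :=
  (forall j, cusp_form k (f j)) /\
  forall g, cusp_form k g ->
    exists! c : {ffun 'I_d -> R[i]}, g = (fun z => \sum_j c j * f j z).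

Definition orthonormal_basis (F : set (UHP R)) k (d : nat)
    (f : 'I_d -> UHP R -> R[i]) : Prop :=
  cusp_form_basis k f /\
  forall i j, petersson F k (f i) (f j) = (i == j)%:R.

End CuspForms.

Definition bergman (R : realType) (k d : nat) (f : 'I_d -> UHP R -> R[i])
    (z : UHP R) : R :=
  \sum_(j < d) Normc.normc (f j z) ^+ 2 * imH z ^+ (2 * k).

(* Main.v *)
(** Fix [z0] and let [f = sum_j conj (f_j z0) f_j], so that [f z0 = N = sum_j |f_j z0|^2] and
    [<f, f> = N]; it suffices to bound [|f z0|^2 y0^(2k) <= B <f, f>]. The mean value inequality on
    a Euclidean square [Q] of side [~ y0 / sqrt k], applied to [f^2 (z - conj z0)^(4k)], gives
    [|f z0|^2 y0^(2k) <= C k int_Q |f|^2 y^(2k) dmu], and unfolding bounds the integral by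
    [<f, f>] times the number of group elements that map a point of [Q] into [Q]. Nearly trivial
    elements of a discrete group commute, so up to a constant this number is controlled by the
    powers of one minimal element; for nonparabolic ones it is bounded because [G0] has finite
    area, and for parabolic ones it is [O(sqrt k)] unless [z0] lies above height [~ k] in a cusp.
    There [f] is compared with its values at height [~ k], using its exponential decay.
    If [G0] is cocompact, the number of nearly trivial elements is uniformly bounded. *)
Require Import Defs.
From HB Require Import structures.
From mathcomp Require Import all_boot all_order all_algebra.
From mathcomp Require Import all_classical all_reals all_analysis.
From mathcomp Require Import measurable_realfun.
From mathcomp Require Import generic_quotient complex ring lra.
Import Order.TTheory GRing.Theory Num.Theory.
Import numFieldNormedType.Exports.
Set Implicit Arguments.
Unset Strict Implicit.
Unset Printing Implicit Defensive.
Local Open Scope classical_set_scope.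
Local Open Scope ring_scope.

(** The exponent [3/2] is [1 + 1/2]. The factor [k] is the inverse area of a square of hyperbolic
    side about [1 / sqrt k], the scale on which [y^(2k)] is, up to bounded factors, the modulus of a
    holomorphic function. The factor [sqrt k] is the number of integer translations that return such
    a square at height about [k] to itself. The bounds must hold for every [G] below [G0], whose
    cusps may be arbitrarily wide. Hence only counts that pass to subgroups are taken from [G0];
    parabolic elements are normalized by the smallest one of [G] itself, and heights in the cusps
    are measured in that normalization ([low]). Hyperbolic geometry is done algebraically: after
    conjugation the displacement of a point by a matrix is read off from the squared Frobenius norm,
    which is polynomial and submultiplicative. For nonparabolic elements, compactness is replaced by
    a finite set of points that covers, up to [G0], all points at which every nontrivial matrix of
    [G0] is far from 1; a minimal element is followed to such a point by moving the base point
    horizontally. *)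

Local Notation nc := Normc.normc.
Local Notation Re := complex.Re.
Local Notation Im := complex.Im.

(** * Complex derivatives, Goursat's theorem and Cauchy's formula on squares *)

Section ComplexNorm.
Variable R : realType.
Implicit Types z w : R[i].

Lemma nc_ge0 z : 0 <= nc z.
Proof. by case: z => a b; exact: sqrtr_ge0. Qed.

Lemma nc_le_add z w : nc (z + w) <= nc z + nc w.
Proof. exact: (@le_normcD R). Qed.

Lemma ncN z : nc (- z) = nc z.
Proof. exact: (@normcN R). Qed.

Lemma nc_le_sub z w : nc (z - w) <= nc z + nc w.
Proof. by rewrite -(ncN w); exact: nc_le_add. Qed.

Lemma nc_subC z w : nc (z - w) = nc (w - z).
Proof. by rewrite -ncN opprB. Qed.

Lemma nc_dist_triangle u z w : nc (z - w) <= nc (z - u) + nc (u - w).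
Proof. by rewrite -[z - w](subrKA u); exact: nc_le_add. Qed.

Lemma nc_sqr z : nc z ^+ 2 = Re z ^+ 2 + Im z ^+ 2.
Proof. by case: z => a b /=; rewrite sqr_sqrtr // addr_ge0 ?sqr_ge0. Qed.

Lemma nc_leP z (r : R) : 0 <= r -> (nc z <= r) = (Re z ^+ 2 + Im z ^+ 2 <= r ^+ 2).
Proof. by move=> r0; rewrite -nc_sqr ler_pXn2r // nnegrE nc_ge0. Qed.

Lemma Re_le_nc z : `|Re z| <= nc z.
Proof.
rewrite -ler_sqr ?nnegrE ?nc_ge0 ?normr_ge0 // real_normK ?num_real // nc_sqr.
by rewrite lerDl sqr_ge0.
Qed.

Lemma Im_le_nc z : `|Im z| <= nc z.
Proof.
rewrite -ler_sqr ?nnegrE ?nc_ge0 ?normr_ge0 // real_normK ?num_real // nc_sqr.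
by rewrite lerDr sqr_ge0.
Qed.

Lemma nc_le_ReIm z : nc z <= `|Re z| + `|Im z|.
Proof.
rewrite nc_leP ?addr_ge0 // sqrrD !real_normK ?num_real // lerD2r.
by rewrite lerDl mulrn_wge0 // mulr_ge0.
Qed.

Lemma nc_real (r : R) : nc (r%:C)%C = `|r|.
Proof. by rewrite /= expr0n /= addr0 sqrtr_sqr. Qed.

Lemma nc_eq0 z : (nc z == 0) = (z == 0).
Proof.
apply/eqP/eqP => [/Normc.eq0_normc //|->]; exact: Normc.normc0.
Qed.

Lemma nc_gt0 z : (0 < nc z) = (z != 0).
Proof. by rewrite lt_neqAle nc_ge0 andbT eq_sym nc_eq0. Qed.

Lemma ncX z n : nc (z ^+ n) = nc z ^+ n.
Proof.
elim: n => [|n IH]; first by rewrite !expr0 Normc.normc1.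
by rewrite !exprS Normc.normcM IH.
Qed.

Lemma complex_split z : z = (Re z +i* Im z)%C. Proof. by case: z. Qed.

Lemma ReD z w : Re (z + w) = Re z + Re w.
Proof. by case: z; case: w. Qed.
Lemma ImD z w : Im (z + w) = Im z + Im w.
Proof. by case: z; case: w. Qed.
Lemma ReN z : Re (- z) = - Re z. Proof. by case: z. Qed.
Lemma ImN z : Im (- z) = - Im z. Proof. by case: z. Qed.
Lemma ReM z w : Re (z * w) = Re z * Re w - Im z * Im w.
Proof. by case: z; case: w. Qed.
Lemma ImM z w : Im (z * w) = Re z * Im w + Im z * Re w.
Proof. by case: z; case: w. Qed.

End ComplexNorm.

Section ComplexDerivative.
Variable R : realType.
Implicit Types (f g : R[i] -> R[i]) (z w d : R[i]).

(** Stated without difference quotients, so that the rules for products, inverses and compositions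
    need no separate case [w = z]. *)
Definition cdiff f z d := forall e : R, 0 < e -> exists2 r : R, 0 < r &
  forall w, nc (w - z) < r -> nc (f w - f z - d * (w - z)) <= e * nc (w - z).

Definition cdifferentiable f z := exists d, cdiff f z d.

Definition ccont f z := forall e : R, 0 < e -> exists2 r : R, 0 < r &
  forall w, nc (w - z) < r -> nc (f w - f z) < e.

Lemma cdiff_lip f z d : cdiff f z d -> exists2 r : R, 0 < r &
  forall w, nc (w - z) < r -> nc (f w - f z) <= (nc d + 1) * nc (w - z).
Proof.
move=> /(_ 1 ltr01)[r r0 H]; exists r => // w /H.
set u := f w - f z => h.
rewrite -(subrK (d * (w - z)) u) mulrDl addrC.
apply: le_trans (nc_le_add _ _) _.
by rewrite Normc.normcM lerD2l.
Qed.

Lemma cdiff_ccont f z : cdifferentiable f z -> ccont f z.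
Proof.
move=> [d /cdiff_lip[r r0 H]] e e0.
have D0 : 0 < nc d + 1 by rewrite ltr_wpDl ?nc_ge0.
exists (Num.min r (e / (nc d + 1))); first by rewrite lt_min r0 divr_gt0.
move=> w; rewrite lt_min => /andP[wr we]; apply: le_lt_trans (H _ wr) _.
by rewrite mulrC -ltr_pdivlMr.
Qed.

Lemma cdiff_near f g z d (r : R) : 0 < r ->
  (forall w, nc (w - z) < r -> f w = g w) -> cdiff f z d -> cdiff g z d.
Proof.
move=> r0 fg H e /H[s s0 Hs]; exists (Num.min r s); first by rewrite lt_min r0.
move=> w; rewrite lt_min => /andP[wr ws]; rewrite -!fg ?Hs //.
by rewrite subrr Normc.normc0.
Qed.

Lemma cdiff_cst c z : cdiff (fun=> c) z 0.
Proof.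
move=> e e0; exists 1 => // w _.
by rewrite mul0r !subrr Normc.normc0 mulr_ge0 ?nc_ge0 ?ltW.
Qed.

Lemma cdiff_id z : cdiff id z 1.
Proof.
move=> e e0; exists 1 => // w _.
by rewrite mul1r subrr Normc.normc0 mulr_ge0 ?nc_ge0 ?ltW.
Qed.

Lemma cdiffD f g z d d' : cdiff f z d -> cdiff g z d' ->
  cdiff (fun w => f w + g w) z (d + d').
Proof.
move=> Hf Hg e e0; have e2 : 0 < e / 2 by rewrite divr_gt0.
have [r r0 hf] := Hf _ e2; have [s s0 hg] := Hg _ e2.
exists (Num.min r s); first by rewrite lt_min r0.
move=> w; rewrite lt_min => /andP[/hf h1 /hg h2].
have -> : f w + g w - (f z + g z) - (d + d') * (w - z) =
  (f w - f z - d * (w - z)) + (g w - g z - d' * (w - z)) by ring.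
apply: le_trans (nc_le_add _ _) _; apply: le_trans (lerD h1 h2) _.
by rewrite -mulrDl -splitr.
Qed.

Lemma cdiffM f g z d d' : cdiff f z d -> cdiff g z d' ->
  cdiff (fun w => f w * g w) z (d * g z + f z * d').
Proof.
move=> Hf Hg e e0.
(* [K] adds up the factors of the three error terms of the product; its last summand is for the
   product of the two increments, where one factor [nc (w - z)] is at most [e / K]. *)
set K := nc (f z) + nc (g z) + 1 + (nc d + 1) * (nc d' + 1).
have Fn := nc_ge0 (f z); have Gn := nc_ge0 (g z).
have Dn := nc_ge0 d; have Dn' := nc_ge0 d'.
have P : 0 <= (nc d + 1) * (nc d' + 1) by rewrite mulr_ge0 // addr_ge0.
have K0 : 0 < K by rewrite /K; lra.
have eK : 0 < e / K by rewrite divr_gt0.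
have [r r0 hf] := Hf _ eK; have [s s0 hg] := Hg _ eK.
have [r' r'0 lf] := cdiff_lip Hf; have [s' s'0 lg] := cdiff_lip Hg.
exists (Num.min (Num.min r s) (Num.min (Num.min r' s') (e / K))).
  by rewrite !lt_min r0 s0 r'0 s'0 eK.
move=> w; rewrite !lt_min => /andP[/andP[/hf h1 /hg h2] /andP[/andP[/lf l1 /lg l2] we]].
have -> : f w * g w - f z * g z - (d * g z + f z * d') * (w - z) =
   (f w - f z - d * (w - z)) * g z + f z * (g w - g z - d' * (w - z))
   + (f w - f z) * (g w - g z) by ring.
have W := nc_ge0 (w - z).
apply: le_trans (nc_le_add _ _) _.
apply: le_trans (lerD (nc_le_add _ _) (lexx _)) _; rewrite !Normc.normcM.
have H1 := ler_wpM2r Gn h1; have H2 := ler_wpM2l Fn h2.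
have H3 := ler_pM (nc_ge0 _) (nc_ge0 _) l1 l2.
have H4 : (nc d + 1) * nc (w - z) * ((nc d' + 1) * nc (w - z)) <=
   (nc d + 1) * (nc d' + 1) * (e / K * nc (w - z)).
  have -> : (nc d + 1) * nc (w - z) * ((nc d' + 1) * nc (w - z)) =
     (nc d + 1) * (nc d' + 1) * (nc (w - z) * nc (w - z)) by ring.
  by apply: ler_wpM2l => //; apply: ler_wpM2r => //; exact: ltW.
have E : e * nc (w - z) = e / K * nc (w - z) * K by field; rewrite gt_eqF.
have Q : 0 <= e / K * nc (w - z) by rewrite mulr_ge0 // ltW.
rewrite E; move: H1 H2 (le_trans H3 H4) Q.
set q := e / K * nc (w - z); set a := _ * nc (g z); set b := nc (f z) * _.
set c := _ * nc (g w - g z); move=> H1 H2 H34 Q.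
rewrite /K; move: H1 H2 H34 Q P.
set F := nc (f z); set G := nc (g z); set PP := (_ + 1) * (_ + 1).
nra.
Qed.

Lemma cdiffV f z d : f z != 0 -> cdiff f z d ->
  cdiff (fun w => (f w)^-1) z (- d / f z ^+ 2).
Proof.
move=> fz0 Hf e e0.
have F0 : 0 < nc (f z) by rewrite nc_gt0.
have Dn := nc_ge0 d.
set F := nc (f z) in F0 *.
have eF : 0 < e * F ^+ 2 / 4 by rewrite !(divr_gt0, mulr_gt0, exprn_gt0).
have [r r0 hf] := Hf _ eF; have [s s0 lf] := cdiff_lip Hf.
have F2 : 0 < F / 2 by rewrite divr_gt0.
have [t t0 cf] := cdiff_ccont (ex_intro _ _ Hf) F2.
(* For [nc (w - z) < m] the squared increment takes at most half of the allowed error, given that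
   [nc (f w)] is at least [F / 2]. *)
set m := e * F ^+ 3 / (4 * (nc d + 1) ^+ 2).
have m0 : 0 < m by rewrite /m divr_gt0 ?mulr_gt0 ?exprn_gt0 // ltr_wpDl.
exists (Num.min (Num.min r s) (Num.min t m)).
  by rewrite !lt_min r0 s0 t0 m0.
move=> w; rewrite !lt_min => /andP[/andP[/hf h1 /lf l1] /andP[/cf c1 wm]].
have W := nc_ge0 (w - z).
have Fw : F / 2 <= nc (f w).
  have := nc_le_sub (f w) (f w - f z); rewrite opprB addrC subrK -/F; lra.
have fw0 : f w != 0 by rewrite -nc_gt0; lra.
have -> : (f w)^-1 - (f z)^-1 - - d / f z ^+ 2 * (w - z) =
   ((f w - f z) ^+ 2 - f w * (f w - f z - d * (w - z)))
   / (f w * f z ^+ 2) by field; rewrite fw0 fz0.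
rewrite Normc.normcM Normc.normcV ler_pdivrMr; last first.
  by rewrite nc_gt0 mulf_neq0 // expf_neq0.
apply: le_trans (nc_le_sub _ _) _.
rewrite (Normc.normcM (f w) (_ - _)) (Normc.normcM (f w) (_ ^+ 2)) !ncX -/F.
have E1 : nc (f w - f z) ^+ 2 <= e * nc (w - z) * (nc (f w) * F ^+ 2) / 2.
  apply: (@le_trans _ _ (((nc d + 1) * nc (w - z)) ^+ 2)).
    by rewrite ler_pXn2r // nnegrE ?nc_ge0 // mulr_ge0 // addr_ge0.
  have M : m * (4 * (nc d + 1) ^+ 2) = e * F ^+ 3.
    by rewrite /m; field; rewrite gt_eqF // ltr_wpDl.
  have : ((nc d + 1) * nc (w - z)) ^+ 2 <= (e * F ^+ 3 / 4) * nc (w - z).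
    rewrite -M exprMn.
    have -> : m * (4 * (nc d + 1) ^+ 2) / 4 * nc (w - z) =
       (nc d + 1) ^+ 2 * (m * nc (w - z)) by field.
    apply: ler_wpM2l; first exact: sqr_ge0.
    by rewrite expr2; apply: ler_wpM2r => //; exact: ltW.
  move/le_trans; apply.
  have -> : e * nc (w - z) * (nc (f w) * F ^+ 2) / 2 =
    (e * F ^+ 2 / 2 * nc (w - z)) * nc (f w) by field.
  have -> : e * F ^+ 3 / 4 * nc (w - z) =
    (e * F ^+ 2 / 2 * nc (w - z)) * (F / 2) by field.
  by apply: ler_wpM2l => //; rewrite !mulr_ge0 ?sqr_ge0 // ltW.
have E2 : nc (f w) * nc (f w - f z - d * (w - z)) <=
    e * nc (w - z) * (nc (f w) * F ^+ 2) / 2.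
  apply: le_trans (ler_wpM2l (nc_ge0 _) h1) _.
  have -> : nc (f w) * (e * F ^+ 2 / 4 * nc (w - z)) =
     e * nc (w - z) * (nc (f w) * F ^+ 2) / 4 by field.
  have : 0 <= e * nc (w - z) * (nc (f w) * F ^+ 2).
    by rewrite !mulr_ge0 ?nc_ge0 ?sqr_ge0 // ltW.
  lra.
lra.
Qed.

Lemma cdiff_comp f g z d d' : cdiff g z d -> cdiff f (g z) d' ->
  cdiff (f \o g) z (d' * d).
Proof.
move=> Hg Hf e e0.
have Dn := nc_ge0 d; have Dn' := nc_ge0 d'.
have e1 : 0 < e / (2 * (nc d + 1)) by rewrite divr_gt0 // mulr_gt0 // ltr_wpDl.
have e2 : 0 < e / (2 * (nc d' + 1)) by rewrite divr_gt0 // mulr_gt0 // ltr_wpDl.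
have [r r0 hf] := Hf _ e1.
have [s s0 hg] := Hg _ e2.
have [t t0 lg] := cdiff_lip Hg.
have [q q0 cg] := cdiff_ccont (ex_intro _ _ Hg) r0.
exists (Num.min q (Num.min s t)); first by rewrite !lt_min q0 s0 t0.
move=> w; rewrite !lt_min => /and3P[/cg /hf h1 /hg h2 /lg l1] /=.
have -> : f (g w) - f (g z) - d' * d * (w - z) =
  (f (g w) - f (g z) - d' * (g w - g z)) + d' * (g w - g z - d * (w - z)).
  by ring.
apply: le_trans (nc_le_add _ _) _; rewrite Normc.normcM.
have W := nc_ge0 (w - z).
have E1 : nc (f (g w) - f (g z) - d' * (g w - g z)) <= e / 2 * nc (w - z).
  apply: le_trans h1 _.
  apply: le_trans (ler_wpM2l (ltW e1) l1) _.
  by rewrite le_eqVlt; apply/orP; left; apply/eqP; field; rewrite gt_eqF // ltr_wpDl.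
have E2 : nc d' * nc (g w - g z - d * (w - z)) <= e / 2 * nc (w - z).
  apply: le_trans (ler_wpM2l Dn' h2) _.
  apply: (@le_trans _ _ ((nc d' + 1) * (e / (2 * (nc d' + 1)) * nc (w - z)))).
    by apply: ler_wpM2r; [rewrite mulr_ge0 // ltW | rewrite lerDl].
  by rewrite le_eqVlt; apply/orP; left; apply/eqP; field; rewrite gt_eqF // ltr_wpDl.
lra.
Qed.

Lemma cdifferentiableX f z n : cdifferentiable f z ->
  cdifferentiable (fun w => f w ^+ n) z.
Proof.
move=> Hf; elim: n => [|n [d IH]].
  by exists 0; under eq_fun do rewrite expr0; exact: cdiff_cst.
case: Hf => d' Hf; eexists; under eq_fun do rewrite exprS; exact: cdiffM Hf IH.
Qed.

End ComplexDerivative.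

Section ContinuousComplex.
Variable R : realType.
Implicit Types (f g : R[i] -> R[i]) (z w d : R[i]).

Lemma derivable_cdifferentiable (f : R[i] -> R[i]) z :
  derivable (f : (R[i])^o -> (R[i])^o) z 1 -> cdifferentiable f z.
Proof.
move=> /cvg_ex[/= d Hd]; exists d => e e0.
have eC : 0 < (e%:C)%C :> R[i] by rewrite ltcR.
move/cvgrPdist_le/(_ _ eC): Hd.
rewrite /= /dnbhs /within /=; move=> [rC /= rC0 H].
(* A positive element of [R[i]] is real, so [Re rC] is the radius of the ball. *)
have rI : Im rC = 0 by apply/eqP; move: rC0; rewrite ltcE => /andP[/eqP->].
have rR : (0 : R) < Re rC by move: rC0; rewrite ltcE => /andP[].
have nE u : `|u| = ((nc u)%:C)%C :> R[i] by [].
exists (Re rC) => // w wz.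
have [->|wz0] := eqVneq w z.
  by rewrite !subrr mulr0 subrr Normc.normc0 mulr0.
have h0 : w - z != 0 by rewrite subr_eq0.
have /H/(_ h0) : ball (0 : (R[i])^o) rC (w - z).
  rewrite -ball_normE /= sub0r normrN nE ltcE /= rI eqxx /=; exact: wz.
rewrite nE lecR [_ *: 1]mulr1 subrK [_ *: _]mulrC.
move=> h1; rewrite nc_subC in h1.
have -> : f w - f z - d * (w - z) = ((f w - f z) / (w - z) - d) * (w - z).
  by field.
by rewrite Normc.normcM; apply: ler_wpM2r => //; exact: nc_ge0.
Qed.

Lemma ccont_cvg (h : R -> R[i]) f (x : R) :
  (forall t s : R, nc (h t - h s) <= `|t - s|) -> ccont f (h x) ->
  {for x, continuous (fun t => Re (f (h t)))} /\
  {for x, continuous (fun t => Im (f (h t)))}.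
Proof.
move=> Hh Hf; split; apply/cvgrPdist_lt => e /Hf[r r0 H];
  near=> t; (have tr : `|x - t| < r by near: t; exact: cvgr_dist_lt);
  (have /H : nc (h t - h x) < r by apply: le_lt_trans (Hh _ _) _; rewrite distrC);
  apply: le_lt_trans; rewrite distrC.
  by rewrite -ReN -ReD Re_le_nc.
by rewrite -ImN -ImD Im_le_nc.
Unshelve. all: by end_near. Qed.

End ContinuousComplex.

(** * Integrals of complex functions over real intervals *)

Section ComplexIntegral.
Variable R : realType.
Notation mu := (@lebesgue_measure R).
Implicit Types (f g : R -> R[i]) (a b c : R).

Definition rint a b (f : R -> R) : R := (\int[mu]_(x in `[a, b]) f x)%R.

Definition cint a b f : R[i] :=
  (rint a b (fun x => Re (f x)) +i* rint a b (fun x => Im (f x)))%C.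

Definition cintegrable a b f :=
  mu.-integrable `[a, b] (EFin \o (fun x => Re (f x))) /\
  mu.-integrable `[a, b] (EFin \o (fun x => Im (f x))).

Definition cont_on a b f := forall x, a <= x <= b ->
  {for x, continuous (fun t => Re (f t))} /\
  {for x, continuous (fun t => Im (f t))}.

Lemma continuous_integrable a b (f : R -> R) :
  (forall x, a <= x <= b -> {for x, continuous f}) ->
  mu.-integrable `[a, b] (EFin \o f).
Proof.
move=> H; apply: continuous_compact_integrable; first exact: segment_compact.
apply: continuous_in_subspaceT => x; rewrite inE /= in_itv /=; exact: H.
Qed.

Lemma cont_on_integrable a b f : cont_on a b f -> cintegrable a b f.
Proof. by move=> H; split; apply: continuous_integrable => x /H[]. Qed.

Lemma cintegrableD a b f g : cintegrable a b f -> cintegrable a b g ->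
  cintegrable a b (fun x => f x + g x).
Proof.
move=> [f1 f2] [g1 g2]; split.
  have -> : (EFin \o (fun x => Re (f x + g x))) =
    ((EFin \o (fun x => Re (f x))) \+ (EFin \o (fun x => Re (g x))))%E.
    by apply/funext => x /=; rewrite ReD.
  exact: integrableD.
have -> : (EFin \o (fun x => Im (f x + g x))) =
    ((EFin \o (fun x => Im (f x))) \+ (EFin \o (fun x => Im (g x))))%E.
  by apply/funext => x /=; rewrite ImD.
exact: integrableD.
Qed.

Lemma cintegrableZ a b f (k : R[i]) : cintegrable a b f ->
  cintegrable a b (fun x => k * f x).
Proof.
move=> [f1 f2].
have L (r : R) (u : R -> R) : mu.-integrable `[a, b] (EFin \o u) ->
   mu.-integrable `[a, b] (EFin \o (fun x => r * u x)).
  move=> H; have -> : (EFin \o (fun x => r * u x)) =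
    (fun x => (r%:E * (EFin \o u) x)%E) by apply/funext => x /=; rewrite EFinM.
  exact: integrableZl.
split.
  have -> : (EFin \o (fun x => Re (k * f x))) =
    ((EFin \o (fun x => Re k * Re (f x))%R) \+ (EFin \o (fun x => (- Im k) * Im (f x))%R))%E.
    by apply/funext => x /=; rewrite ReM -mulNr.
  by apply: integrableD => //; apply: L.
have -> : (EFin \o (fun x => Im (k * f x))) =
    ((EFin \o (fun x => Re k * Im (f x))%R) \+ (EFin \o (fun x => Im k * Re (f x))%R))%E.
  by apply/funext => x /=; rewrite ImM.
by apply: integrableD => //; apply: L.
Qed.

Lemma cintegrableB a b f g : cintegrable a b f -> cintegrable a b g ->
  cintegrable a b (fun x => f x - g x).
Proof.
move=> Hf Hg; under eq_fun do rewrite -[- g _]mulN1r.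
by apply: cintegrableD => //; exact: cintegrableZ.
Qed.

Lemma cintegrable_cst a b (k : R[i]) : cintegrable a b (fun=> k).
Proof. by apply: cont_on_integrable => x _; split; exact: cvg_cst. Qed.

Lemma eq_cint a b f g : (forall x, a <= x <= b -> f x = g x) ->
  cint a b f = cint a b g.
Proof.
move=> fg; rewrite /cint /rint; congr (_ +i* _)%C; apply: eq_Rintegral => x;
  by rewrite inE /= in_itv /= => /fg ->.
Qed.

Lemma cintD a b f g : cintegrable a b f -> cintegrable a b g ->
  cint a b (fun x => f x + g x) = cint a b f + cint a b g.
Proof.
move=> [f1 f2] [g1 g2]; rewrite /cint /rint /=.
under eq_Rintegral do rewrite ReD.
under [X in (_ +i* X)%C]eq_Rintegral do rewrite ImD.
by rewrite !RintegralD.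
Qed.

Lemma cintZ a b f (k : R[i]) : cintegrable a b f ->
  cint a b (fun x => k * f x) = k * cint a b f.
Proof.
move=> [f1 f2]; rewrite /cint /rint /=.
have L (r : R) (u : R -> R) : mu.-integrable `[a, b] (EFin \o u) ->
   mu.-integrable `[a, b] (EFin \o (fun x => r * u x)).
  move=> H; have -> : (EFin \o (fun x => r * u x)) =
    (fun x => (r%:E * (EFin \o u) x)%E) by apply/funext => x /=; rewrite EFinM.
  exact: integrableZl.
under eq_Rintegral do rewrite ReM.
under [X in (_ +i* X)%C]eq_Rintegral do rewrite ImM.
rewrite RintegralB ?RintegralD //; try exact: L.
by rewrite !RintegralZl // [in RHS](complex_split k) /=; simpc.
Qed.

Lemma cintB a b f g : cintegrable a b f -> cintegrable a b g ->
  cint a b (fun x => f x - g x) = cint a b f - cint a b g.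
Proof.
move=> Hf Hg; rewrite -[- cint _ _ _]mulN1r -cintZ // -cintD //.
  by apply: eq_cint => x _; rewrite mulN1r.
exact: cintegrableZ.
Qed.

Lemma cint_split c a b f : a <= c <= b -> cintegrable a b f ->
  cint a b f = cint a c f + cint c b f.
Proof.
move=> /andP[ac cb].
have L (u : R -> R) : mu.-integrable `[a, b] (EFin \o u) ->
   rint a b u = rint a c u + rint c b u.
  move=> H; have := @Rintegral_itvB R u (BLeft a) (BRight b) c H.
  rewrite !bnd_simp => /(_ ac cb) E.
  rewrite /rint -(Rintegral_itv_obnd_cbnd (r := c)).
    by rewrite -E addrC subrK.
  apply: integrableS H => //; apply: subset_itv; by rewrite bnd_simp.
by case=> /L h1 /L h2; rewrite /cint h1 h2; simpc.
Qed.

Lemma rint_cst a b (k : R) : a <= b -> rint a b (fun=> k) = k * (b - a).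
Proof.
move=> ab; rewrite /rint Rintegral_cst //= lebesgue_measure_itv /= lte_fin.
case: ltP => // ba; rewrite ?mulr0.
by have -> : b = a by [apply/eqP; rewrite eq_le ab ba]; rewrite subrr mulr0.
Qed.

Lemma cint_cst a b (k : R[i]) : a <= b -> cint a b (fun=> k) = k * ((b - a)%:C)%C.
Proof.
by move=> ab; rewrite /cint !rint_cst // [in RHS](complex_split k); simpc.
Qed.

(** The factor [2] comes from estimating the real and imaginary parts separately. *)
Lemma cint_norm_le a b f (h : R -> R) : a <= b -> cintegrable a b f ->
  mu.-integrable `[a, b] (EFin \o h) ->
  (forall x, a <= x <= b -> nc (f x) <= h x) ->
  nc (cint a b f) <= 2 * rint a b h.
Proof.
move=> ab [f1 f2] ih fh; apply: le_trans (nc_le_ReIm _) _ => /=.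
have L (u : R -> R) : mu.-integrable `[a, b] (EFin \o u) ->
    (forall x, a <= x <= b -> `|u x| <= h x) -> `|rint a b u| <= rint a b h.
  move=> iu uh; apply: le_trans (le_normr_Rintegral _ iu) _ => //.
  apply: le_Rintegral => //.
    exact: (integrable_norm iu).
rewrite mulrDl !mul1r; apply: lerD.
  by apply: L => // x /fh; apply: le_trans; exact: Re_le_nc.
by apply: L => // x /fh; apply: le_trans; exact: Im_le_nc.
Qed.

Lemma cint_norm_leM a b f (M : R) : a <= b -> cintegrable a b f ->
  (forall x, a <= x <= b -> nc (f x) <= M) ->
  nc (cint a b f) <= 2 * (M * (b - a)).
Proof.
move=> ab Hf H; rewrite -rint_cst //; apply: cint_norm_le => //.
by apply: continuous_integrable => x _; exact: cvg_cst.
Qed.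

End ComplexIntegral.

(** * Boundary integrals over rectangles *)

Section Goursat.
Variable R : realType.
Implicit Types (f g : R[i] -> R[i]) (z w p : R[i]) (a b c d : R).

(* The integral of [f] along the boundary of [[a, b] x [c, d]]. *)
Definition bd f a b c d : R[i] :=
  cint a b (fun x => f (x +i* c)%C - f (x +i* d)%C)
  + (0 +i* 1)%C * cint c d (fun y => f (b +i* y)%C - f (a +i* y)%C).

Lemma hline_cont f a b y : (forall x, a <= x <= b -> ccont f (x +i* y)%C) ->
  cont_on a b (fun x => f (x +i* y)%C).
Proof.
move=> H x /H.
apply: (@ccont_cvg _ (fun x => (x +i* y)%C)) => t s.
rewrite (_ : (t +i* y)%C - (s +i* y)%C = ((t - s)%:C)%C) ?nc_real //.
by apply/eqP; rewrite eq_complex /=; apply/andP; split; apply/eqP; ring.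
Qed.

Lemma vline_cont f c d x : (forall y, c <= y <= d -> ccont f (x +i* y)%C) ->
  cont_on c d (fun y => f (x +i* y)%C).
Proof.
move=> H y /H.
apply: (@ccont_cvg _ (fun y => (x +i* y)%C)) => t s.
rewrite (_ : (x +i* t)%C - (x +i* s)%C = (0 +i* 1)%C * ((t - s)%:C)%C).
  by rewrite Normc.normcM nc_real /= expr0n expr1n add0r sqrtr1 mul1r.
by apply/eqP; rewrite eq_complex /=; apply/andP; split; apply/eqP; ring.
Qed.

Lemma cintegrable_hline f a b y : (forall x, a <= x <= b -> ccont f (x +i* y)%C) ->
  cintegrable a b (fun x => f (x +i* y)%C).
Proof. by move=> H; apply/cont_on_integrable/hline_cont. Qed.

Lemma cintegrable_vline f c d x : (forall y, c <= y <= d -> ccont f (x +i* y)%C) ->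
  cintegrable c d (fun y => f (x +i* y)%C).
Proof. by move=> H; apply/cont_on_integrable/vline_cont. Qed.

Definition rect_ccont f a b c d :=
  forall x y, a <= x <= b -> c <= y <= d -> ccont f (x +i* y)%C.

Lemma rect_ccontS f a b c d a' b' c' d' : a <= a' -> b' <= b -> c <= c' -> d' <= d ->
  rect_ccont f a b c d -> rect_ccont f a' b' c' d'.
Proof.
move=> aa bb cc dd H x y /andP[x1 x2] /andP[y1 y2]; apply: H; apply/andP; split; lra.
Qed.

Lemma rect_hline f a b c d y : rect_ccont f a b c d -> c <= y <= d -> cintegrable a b (fun x => f (x +i* y)%C).
Proof. by move=> Hf y0; apply: cintegrable_hline => x x0; apply: Hf. Qed.

Lemma rect_vline f a b c d x : rect_ccont f a b c d -> a <= x <= b -> cintegrable c d (fun y => f (x +i* y)%C).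
Proof. by move=> Hf y0; apply: cintegrable_vline => y z0; apply: Hf. Qed.

(** Integrability is required only along the five segments involved, so that the rule also applies
    when [f] has a singularity inside the rectangle. *)
Lemma bd_splitx_lines f a b c d m : a <= m <= b ->
  cintegrable a b (fun x => f (x +i* c)%C) -> cintegrable a b (fun x => f (x +i* d)%C) ->
  cintegrable c d (fun y => f (a +i* y)%C) -> cintegrable c d (fun y => f (m +i* y)%C) ->
  cintegrable c d (fun y => f (b +i* y)%C) ->
  bd f a b c d = bd f a m c d + bd f m b c d.
Proof.
move=> am hc hd va vm vb.
rewrite /bd (@cint_split _ m a b) //; last exact: cintegrableB.
rewrite addrACA -mulrDr -cintD; [|exact: cintegrableB..].
by congr (_ + _ * _); apply: eq_cint => y _; ring.
Qed.

Lemma bd_splity_lines f a b c d m : c <= m <= d ->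
  cintegrable a b (fun x => f (x +i* c)%C) -> cintegrable a b (fun x => f (x +i* m)%C) ->
  cintegrable a b (fun x => f (x +i* d)%C) ->
  cintegrable c d (fun y => f (a +i* y)%C) -> cintegrable c d (fun y => f (b +i* y)%C) ->
  bd f a b c d = bd f a b c m + bd f a b m d.
Proof.
move=> am hc hm hd va vb.
rewrite /bd (@cint_split _ m c d) //; last exact: cintegrableB.
rewrite mulrDr addrACA -cintD; [|exact: cintegrableB..].
by congr (_ + _); apply: eq_cint => y _; ring.
Qed.

Lemma bd_splitx f a b c d m : a <= b -> c <= d -> rect_ccont f a b c d ->
  a <= m <= b -> bd f a b c d = bd f a m c d + bd f m b c d.
Proof.
move=> ab cd Hf am; apply: bd_splitx_lines => //;
  by [apply: (rect_hline Hf); rewrite ?lexx ?ab ?cd | apply: (rect_vline Hf); rewrite ?lexx ?ab ?cd].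
Qed.

Lemma bd_splity f a b c d m : a <= b -> c <= d -> rect_ccont f a b c d ->
  c <= m <= d -> bd f a b c d = bd f a b c m + bd f a b m d.
Proof.
move=> ab cd Hf am; apply: bd_splity_lines => //;
  by [apply: (rect_hline Hf); rewrite ?lexx ?ab ?cd | apply: (rect_vline Hf); rewrite ?lexx ?ab ?cd].
Qed.

Lemma bd_norm_le_lines f a b c d (M : R) : a <= b -> c <= d ->
  cintegrable a b (fun x => f (x +i* c)%C) -> cintegrable a b (fun x => f (x +i* d)%C) ->
  cintegrable c d (fun y => f (a +i* y)%C) -> cintegrable c d (fun y => f (b +i* y)%C) ->
  (forall x, a <= x <= b -> nc (f (x +i* c)%C) <= M /\ nc (f (x +i* d)%C) <= M) ->
  (forall y, c <= y <= d -> nc (f (a +i* y)%C) <= M /\ nc (f (b +i* y)%C) <= M) ->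
  nc (bd f a b c d) <= 4 * M * ((b - a) + (d - c)).
Proof.
move=> ab cd hc hd va vb Hh Hv; apply: le_trans (nc_le_add _ _) _.
rewrite Normc.normcM [nc (0 +i* 1)%C](_ : _ = 1) ?mul1r; last first.
  by rewrite /= expr0n expr1n add0r sqrtr1.
have -> : 4 * M * ((b - a) + (d - c)) = 2 * (2 * M * (b - a)) + 2 * (2 * M * (d - c)).
  by ring.
apply: lerD; apply: cint_norm_leM => //; try exact: cintegrableB.
- move=> x /Hh[h1 h2]; apply: le_trans (nc_le_sub _ _) _; rewrite mulrDl !mul1r.
  exact: lerD.
- move=> y /Hv[h1 h2]; apply: le_trans (nc_le_sub _ _) _; rewrite mulrDl !mul1r.
  exact: lerD.
Qed.

Lemma bd_norm_le f a b c d (M : R) : a <= b -> c <= d -> rect_ccont f a b c d ->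
  (forall x y, a <= x <= b -> c <= y <= d -> nc (f (x +i* y)%C) <= M) ->
  nc (bd f a b c d) <= 4 * M * ((b - a) + (d - c)).
Proof.
move=> ab cd Hf H; apply: bd_norm_le_lines => //;
  try by [apply: (rect_hline Hf); rewrite ?lexx ?ab ?cd | apply: (rect_vline Hf); rewrite ?lexx ?ab ?cd].
- by move=> x xab; split; apply: H; rewrite ?lexx ?cd.
- by move=> y ycd; split; apply: H; rewrite ?lexx ?ab.
Qed.

(* An affine function contributes nothing: its differences along opposite
   sides of the rectangle are constant. *)
Lemma bd_affine f a b c d (k l : R[i]) : a <= b -> c <= d -> rect_ccont f a b c d ->
  bd (fun z => f z - (k + l * z)) a b c d = bd f a b c d.
Proof.
move=> ab cd Hf; rewrite /bd.
rewrite [cint a b _](_ : _ = cint a b (fun x => f (x +i* c)%C - f (x +i* d)%C)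
   + l * (0 +i* 1)%C * ((d - c)%:C)%C * ((b - a)%:C)%C); last first.
  rewrite -(cint_cst _ ab) -cintD; last 2 first.
  - by apply: cintegrableB; apply: (rect_hline Hf); lra.
  - exact: cintegrable_cst.
  apply: eq_cint => x _.
  rewrite (_ : ((d - c)%:C)%C = ((x +i* d) - (x +i* c))%C * - (0 +i* 1)%C); last first.
    by apply/eqP; rewrite eq_complex /=; apply/andP; split; apply/eqP; ring.
  have -> : l * (0 +i* 1)%C * (((x +i* d) - (x +i* c))%C * - (0 +i* 1)%C) =
     - (0 +i* 1)%C ^+ 2 * l * ((x +i* d) - (x +i* c))%C by ring.
  by rewrite sqr_i; ring.
rewrite [cint c d _](_ : _ = cint c d (fun y => f (b +i* y)%C - f (a +i* y)%C)
   - l * ((b - a)%:C)%C * ((d - c)%:C)%C); last first.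
  rewrite -!mulNr -(cint_cst _ cd) -cintD; last 2 first.
  - by apply: cintegrableB; apply: (rect_vline Hf); lra.
  - exact: cintegrable_cst.
  apply: eq_cint => y _.
  rewrite (_ : ((b - a)%:C)%C = ((b +i* y) - (a +i* y))%C); last first.
    by apply/eqP; rewrite eq_complex /=; apply/andP; split; apply/eqP; ring.
  by ring.
by ring.
Qed.

Lemma rect_dist (x y x' y' w h : R) : 0 <= w -> 0 <= h ->
  `|x - x'| <= w -> `|y - y'| <= h -> nc ((x +i* y)%C - (x' +i* y')%C) <= w + h.
Proof.
move=> w0 h0 xw yh; apply: le_trans (nc_le_ReIm _) _.
by rewrite ReD ImD ReN ImN /=; apply: lerD.
Qed.

Lemma bd_quarter f a c (w h : R) : 0 <= w -> 0 <= h ->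
  rect_ccont f a (a + w + w) c (c + h + h) ->
  exists q : R * R, [/\ a <= q.1 <= a + w, c <= q.2 <= c + h &
   nc (bd f a (a + w + w) c (c + h + h)) <=
     4 * nc (bd f q.1 (q.1 + w) q.2 (q.2 + h))].
Proof.
move=> w0 h0 Hf.
have a1 : a <= a <= a + w by lra.
have a2 : a <= a + w <= a + w by lra.
have c1 : c <= c <= c + h by lra.
have c2 : c <= c + h <= c + h by lra.
have a3 : a <= a + w <= a + w + w by lra.
have c3 : c <= c + h <= c + h + h by lra.
have /andP[a4 a5] := a3; have /andP[c4 c5] := c3.
have a6 := le_trans a4 a5; have c6 := le_trans c4 c5.
have E : bd f a (a + w + w) c (c + h + h) =
   bd f a (a + w) c (c + h) + bd f a (a + w) (c + h) (c + h + h)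
   + (bd f (a + w) (a + w + w) c (c + h) + bd f (a + w) (a + w + w) (c + h) (c + h + h)).
  rewrite (bd_splitx a6 c6 Hf a3).
  rewrite (bd_splity a4 c6 (rect_ccontS (lexx _) a5 (lexx _) (lexx _) Hf) c3).
  by rewrite (bd_splity a5 c6 (rect_ccontS a4 (lexx _) (lexx _) (lexx _) Hf) c3).
rewrite E; clear - a1 a2 c1 c2.
set A := bd f a (a + w) c (c + h); set B := bd f a (a + w) (c + h) (c + h + h).
set C := bd f (a + w) _ c (c + h); set D := bd f (a + w) _ (c + h) _.
have T : nc (A + B + (C + D)) <= nc A + nc B + (nc C + nc D).
  apply: le_trans (nc_le_add _ _) _; apply: lerD; exact: nc_le_add.
have [hA|hA] := leP (nc (A + B + (C + D))) (4 * nc A); first by exists (a, c).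
have [hB|hB] := leP (nc (A + B + (C + D))) (4 * nc B); first by exists (a, c + h).
have [hC|hC] := leP (nc (A + B + (C + D))) (4 * nc C); first by exists (a + w, c).
have [hD|hD] := leP (nc (A + B + (C + D))) (4 * nc D); first by exists (a + w, c + h).
exfalso; move: T hA hB hC hD; move: (nc _) (nc A) (nc B) (nc C) (nc D); clear=> *; lra.
Qed.

(** Goursat's bisection: some quarter keeps at least a fourth of the boundary integral. After [n]
    steps the perimeter and the deviation of [f] from an affine function are both of order [2^-n],
    the latter with a factor [e], so the original integral is [O(e)]. *)
Theorem goursat f a b c d : a <= b -> c <= d ->
  (forall x y, a <= x <= b -> c <= y <= d -> cdifferentiable f (x +i* y)%C) ->
  bd f a b c d = 0.
Proof.
move=> ab cd Hd.
have Hc : rect_ccont f a b c d by move=> x y x0 y0; exact/cdiff_ccont/Hd.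
set w := b - a; set h := d - c.
have w0 : 0 <= w by rewrite /w; lra.
have h0 : 0 <= h by rewrite /h; lra.
have bE : b = a + w by rewrite /w; lra.
have dE : d = c + h by rewrite /h; lra.
pose good (n : nat) (q : R * R) :=
  [/\ a <= q.1, q.1 + w / 2 ^+ n <= b, c <= q.2 & q.2 + h / 2 ^+ n <= d].
pose D n (q : R * R) := nc (bd f q.1 (q.1 + w / 2 ^+ n) q.2 (q.2 + h / 2 ^+ n)).
have pos n : 0 <= w / 2 ^+ n /\ 0 <= h / 2 ^+ n.
  by split; apply: divr_ge0 => //; apply: exprn_ge0.
have step n q : good n q -> exists q', [/\ good n.+1 q',
    q.1 <= q'.1, q'.1 + w / 2 ^+ n.+1 <= q.1 + w / 2 ^+ n,
    q.2 <= q'.2 & q'.2 + h / 2 ^+ n.+1 <= q.2 + h / 2 ^+ n] /\ D n q <= 4 * D n.+1 q'.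
  move=> [g1 g2 g3 g4]; have [wn hn] := pos n.
  have [wn' hn'] := pos n.+1.
  have wS : w / 2 ^+ n = w / 2 ^+ n.+1 + w / 2 ^+ n.+1.
    by rewrite exprS; field; exact: expf_neq0.
  have hS : h / 2 ^+ n = h / 2 ^+ n.+1 + h / 2 ^+ n.+1.
    by rewrite exprS; field; exact: expf_neq0.
  have Hq : rect_ccont f q.1 (q.1 + w / 2 ^+ n.+1 + w / 2 ^+ n.+1) q.2 (q.2 + h / 2 ^+ n.+1 + h / 2 ^+ n.+1).
    by rewrite -!addrA -wS -hS; apply: rect_ccontS Hc.
  have [q' [l1 l2 l3]] := bd_quarter wn' hn' Hq.
  exists q'; split; last by rewrite /D wS hS !addrA.
  rewrite /good; rewrite wS in g2 *; rewrite hS in g4 *.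
  move: g1 g2 g3 g4 l1 l2 wn' hn'; clear.
  set u := w / _; set v := h / _ => *; split; [split| | | |]; lra.
(* The default value [q] is never reached, since [gQ] shows that every [Q n] is good. *)
pose next n q := match pselect (good n q) with
   | left g => projT1 (cid (step n q g)) | right _ => q end.
pose fix Q n : R * R := if n is m.+1 then next m (Q m) else (a, c).
have gQ n : good n (Q n).
  elim: n => [|n IH]; first by rewrite /good /= !expr0 !divr1; split; lra.
  rewrite /= /next; case: pselect => // g; case: cid => q' [[? ? ? ?]] //=.
have sQ n : [/\ (Q n).1 <= (Q n.+1).1,
    (Q n.+1).1 + w / 2 ^+ n.+1 <= (Q n).1 + w / 2 ^+ n,
    (Q n).2 <= (Q n.+1).2 & (Q n.+1).2 + h / 2 ^+ n.+1 <= (Q n).2 + h / 2 ^+ n]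
    /\ D n (Q n) <= 4 * D n.+1 (Q n.+1).
  have := gQ n; rewrite [Q n.+1]/= /next; case: pselect => // g _.
  by case: cid => q' [[? ? ? ? ?] ?] /=.
have mono n m : (n <= m)%N -> [/\ (Q n).1 <= (Q m).1,
    (Q m).1 + w / 2 ^+ m <= (Q n).1 + w / 2 ^+ n,
    (Q n).2 <= (Q m).2 & (Q m).2 + h / 2 ^+ m <= (Q n).2 + h / 2 ^+ n].
  move=> /subnKC <-; elim: (m - n)%N => [|k [i1 i2 i3 i4]]; first by rewrite addn0.
  by rewrite addnS; have [[j1 j2 j3 j4] _] := sQ (n + k)%N; split; lra.
have DQ n : D 0%N (Q 0%N) <= 4 ^+ n * D n (Q n).
  elim: n => [|n IH]; first by rewrite expr0 mul1r.
  apply: le_trans IH _; rewrite exprSr -mulrA; apply: ler_wpM2l.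
    exact: exprn_ge0.
  by have [_] := sQ n.
have cross n m : (Q n).1 <= (Q m).1 + w / 2 ^+ m /\ (Q n).2 <= (Q m).2 + h / 2 ^+ m.
  have [p1 p2] := pos m; have [p3 p4] := pos n.
  have [nm|mn] := leP n m.
    by have [? ? ? ?] := mono _ _ nm; split; lra.
  by have [? ? ? ?] := mono _ _ (ltnW mn); split; lra.
(* The lower left corners increase and stay below all upper right corners, so their suprema give the
   point common to all the rectangles. *)
pose px := sup [set (Q n).1 | n in setT]; pose py := sup [set (Q n).2 | n in setT].
have pxP n : (Q n).1 <= px <= (Q n).1 + w / 2 ^+ n.
  apply/andP; split.
    apply: ub_le_sup; last by exists n.
    by exists ((Q n).1 + w / 2 ^+ n) => _ [m _ <-]; have [] := cross m n.
  apply: ge_sup; first by exists (Q 0%N).1; exists 0%N.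
  by move=> _ [m _ <-]; have [] := cross m n.
have pyP n : (Q n).2 <= py <= (Q n).2 + h / 2 ^+ n.
  apply/andP; split.
    apply: ub_le_sup; last by exists n.
    by exists ((Q n).2 + h / 2 ^+ n) => _ [m _ <-]; have [] := cross m n.
  apply: ge_sup; first by exists (Q 0%N).2; exists 0%N.
  by move=> _ [m _ <-]; have [] := cross m n.
have [g1 g2 g3 g4] := gQ 0%N.
have [|d0 Hd0] := Hd px py _ ltac:(have := pyP 0%N; lra).
  by have := pxP 0%N; lra.
suff small e : 0 < e -> nc (bd f a b c d) <= e * (4 * (w + h) ^+ 2).
  apply/eqP; rewrite -nc_eq0 eq_le nc_ge0 andbT; apply/ler_addgt0Pl => e e0.
  rewrite addr0.
  have P : 0 < 4 * (w + h) ^+ 2 + 1 by rewrite ltr_wpDl // mulr_ge0 ?sqr_ge0.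
  apply: le_trans (small (e / (4 * (w + h) ^+ 2 + 1)) _) _; first exact: divr_gt0.
  rewrite mulrAC ler_pdivrMr //; apply: ler_wpM2l; first exact: ltW.
  by rewrite lerDl.
move=> e0; have [r r0 Hr] := Hd0 _ e0.
have [n wn] : exists n : nat, (w + h) / 2 ^+ n < r.
  have [n Hn] : exists n : nat, (w + h) / r < 2 ^+ n.
    exists (Num.trunc ((w + h) / r)).+1.
    apply: lt_le_trans (truncnS_gt _) _.
    by rewrite -natrX ler_nat ltnW // ltn_expl.
  by exists n; rewrite ltr_pdivrMr ?exprn_gt0 // mulrC -ltr_pdivrMr.
have [wn0 hn0] := pos n; have Pn : 0 < 2 ^+ n :> R by exact: exprn_gt0.
have := DQ n; rewrite {1}/D /= !expr0 !divr1 -bE -dE => /le_trans; apply.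
have {}pxP := pxP n; have {}pyP := pyP n; have {g1 g2 g3 g4}[g1 g2 g3 g4] := gQ n.
have Hn : rect_ccont f (Q n).1 ((Q n).1 + w / 2 ^+ n) (Q n).2 ((Q n).2 + h / 2 ^+ n).
  by apply: rect_ccontS Hc.
have E : 4 ^+ n = 2 ^+ n * 2 ^+ n :> R by rewrite -exprMn; congr (_ ^+ n); ring.
(* [l + d0 * z] is the first-order expansion at the common point; by [bd_affine] subtracting it
   leaves the boundary integral unchanged. *)
pose l := f (px +i* py)%C - d0 * (px +i* py)%C.
have P1 : (Q n).1 <= (Q n).1 + w / 2 ^+ n by lra.
have P2 : (Q n).2 <= (Q n).2 + h / 2 ^+ n by lra.
rewrite /D -(bd_affine l d0 P1 P2 Hn).
have := @bd_norm_le (fun z => f z - (l + d0 * z)) _ _ _ _ (e * ((w + h) / 2 ^+ n)) P1 P2.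
set B := nc (bd _ _ _ _ _) => HB.
apply: le_trans (_ : 4 ^+ n * (4 * (e * ((w + h) / 2 ^+ n)) * (w / 2 ^+ n + h / 2 ^+ n)) <= _); last first.
  rewrite E -mulrDl.
  rewrite le_eqVlt; apply/orP; left; apply/eqP; field; exact: lt0r_neq0.
apply: ler_wpM2l; first exact: exprn_ge0.
have -> : w / 2 ^+ n + h / 2 ^+ n = ((Q n).1 + w / 2 ^+ n - (Q n).1) + ((Q n).2 + h / 2 ^+ n - (Q n).2) by ring.
apply: HB => [x y x0 y0|x y x0 y0].
  apply/cdiff_ccont.
  have [|d1 H1] := Hd x y _ ltac:(lra); first by lra.
  eexists; under eq_fun do rewrite -[- _]mulN1r.
  apply: cdiffD H1 _; apply: cdiffM; first exact: cdiff_cst.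
  apply: cdiffD; first exact: cdiff_cst.
  apply: cdiffM; [exact: cdiff_cst|exact: cdiff_id].
have xy : nc ((x +i* y)%C - (px +i* py)%C) <= (w + h) / 2 ^+ n.
  by rewrite mulrDl; apply: rect_dist => //; rewrite ler_norml; lra.
have -> : f (x +i* y)%C - (l + d0 * (x +i* y)%C) =
   f (x +i* y)%C - f (px +i* py)%C - d0 * ((x +i* y)%C - (px +i* py)%C).
  by rewrite /l; ring.
apply: le_trans (Hr _ _) _; first by apply: le_lt_trans wn.
by apply: ler_wpM2l => //; exact: ltW.
Qed.

(* The point is cut out by a square of side [2 s] whose boundary integral is [O(s)]. *)
Theorem goursat_punctured f a b c d (p q M r : R) : a < p < b -> c < q < d ->
  (forall x y, a <= x <= b -> c <= y <= d -> (x +i* y)%C != (p +i* q)%C ->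
     cdifferentiable f (x +i* y)%C) ->
  0 < r ->
  (forall z, z != (p +i* q)%C -> nc (z - (p +i* q)%C) < r -> nc (f z) <= M) ->
  bd f a b c d = 0.
Proof.
move=> /andP[ap pb] /andP[cq qd] Hd r0 HM.
have neq1 x y : x != p -> (x +i* y)%C != (p +i* q)%C.
  by apply: contraNneq => -[-> _].
have neq2 x y : y != q -> (x +i* y)%C != (p +i* q)%C.
  by apply: contraNneq => -[_ ->].
have hl u v y : a <= u -> v <= b -> c <= y <= d -> y != q ->
    cintegrable u v (fun x => f (x +i* y)%C).
  move=> au vb ycd yq; apply: cintegrable_hline => x /andP[x1 x2].
  by apply/cdiff_ccont/Hd; rewrite ?neq2 ?ycd ?(le_trans au) ?(le_trans x2).
have vl u v x : c <= u -> v <= d -> a <= x <= b -> x != p ->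
    cintegrable u v (fun y => f (x +i* y)%C).
  move=> au vb ycd yq; apply: cintegrable_vline => y /andP[x1 x2].
  by apply/cdiff_ccont/Hd; rewrite ?neq1 ?ycd ?(le_trans au) ?(le_trans x2).
(* The bound [r / 4] keeps the small square where [f] is bounded by [M], the other terms keep it
   inside the rectangle. *)
pose S0 := Num.min (r / 4) (Num.min (Num.min (p - a) (b - p)) (Num.min (q - c) (d - q))).
have S00 : 0 < S0 by rewrite !lt_min !subr_gt0 ap pb cq qd divr_gt0.
have key s : 0 < s -> s < S0 -> nc (bd f a b c d) <= 16 * `|M| * s.
  move=> s0; rewrite !lt_min => /and3P[sr /andP[sa sb] /andP[sc sd]].
  have [p1 p2 p3 p4] : [/\ a <= p - s, p - s < p, p < p + s & p + s <= b] by split; lra.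
  have [q1 q2 q3 q4] : [/\ c <= q - s, q - s < q, q < q + s & q + s <= d] by split; lra.
  have cd : c <= d by lra.
  have [a1 a2 a3] : [/\ a <= p - s <= b, p - s <= p + s <= b & a <= p + s <= b].
    by split; apply/andP; split; lra.
  have [c1 c2 c3] : [/\ c <= q - s <= d, q - s <= q + s <= d & c <= q + s <= d].
    by split; apply/andP; split; lra.
  have [n1 n2 n3 n4] : [/\ p - s != p, p + s != p, q - s != q & q + s != q].
    by split; rewrite ?(lt_eqF p2) ?(gt_eqF p3) ?(lt_eqF q2) ?(gt_eqF q3).
  have [n5 n6 n7 n8] : [/\ a != p, b != p, c != q & d != q].
    by split; rewrite ?(lt_eqF ap) ?(gt_eqF pb) ?(lt_eqF cq) ?(gt_eqF qd).
  have pp : p - s <= p + s by lra.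
  have qq : q - s <= q + s by lra.
  have ab : a <= b by lra.
  have aa : a <= a <= b by rewrite lexx.
  have bb : a <= b <= b by rewrite lexx ab.
  have cc : c <= c <= d by rewrite lexx.
  have dd : c <= d <= d by rewrite lexx cd.
  have [p5 p6] := conj (le_trans p1 (ltW p2)) (le_trans (ltW p3) p4).
  (* Two vertical cuts and two cuts of the middle strip isolate the central square; the other four
     rectangles avoid the point and contribute 0 by [goursat]. *)
  rewrite (bd_splitx_lines a1); try (by apply: hl); try (by apply: vl).
  rewrite (bd_splitx_lines a2); try (by apply: hl); try (by apply: vl).
  rewrite (bd_splity_lines (m := q - s) (c := c) (a := p - s)) //; try (by apply: hl); try (by apply: vl).
  rewrite (bd_splity_lines (m := q + s) (c := q - s) (a := p - s)) //; try (by apply: hl); try (by apply: vl).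
  rewrite (goursat (a := a)) //; last first.
    move=> x y /andP[x1 x2] y0; apply: Hd => //; first by rewrite x1 (le_trans x2) //; case/andP: a1.
    by apply: neq1; rewrite lt_eqF // (le_lt_trans x2).
  rewrite (goursat (a := p + s)) //; last first.
    move=> x y /andP[x1 x2] y0; apply: Hd => //; first by rewrite x2 andbT (le_trans _ x1) //; case/andP: a3.
    by apply: neq1; rewrite gt_eqF // (lt_le_trans _ x1).
  rewrite (goursat (c := c)) //; last first.
    move=> x y /andP[x1 x2] /andP[y1 y2]; apply: Hd => //.
    - by rewrite (le_trans p1 x1) (le_trans x2 p4).
    - by rewrite y1 (le_trans y2) //; case/andP: c1.
    - by apply: neq2; rewrite lt_eqF // (le_lt_trans y2).
  rewrite (goursat (c := q + s)) //; last first.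
    move=> x y /andP[x1 x2] /andP[y1 y2]; apply: Hd => //.
    - by rewrite (le_trans p1 x1) (le_trans x2 p4).
    - by rewrite y2 andbT (le_trans _ y1) //; case/andP: c3.
    - by apply: neq2; rewrite gt_eqF // (lt_le_trans _ y1).
  rewrite !add0r !addr0.
  have near x y : p - s <= x <= p + s -> q - s <= y <= q + s ->
     nc ((x +i* y)%C - (p +i* q)%C) < r.
    move=> x0 y0; apply: (@le_lt_trans _ _ (s + s)); last by lra.
    by apply: rect_dist; [exact: ltW|exact: ltW|rewrite ler_norml; lra..].
  have -> : 16 * `|M| * s = 4 * `|M| * ((p + s - (p - s)) + (q + s - (q - s))) by ring.
  have HM' z : z != (p +i* q)%C -> nc (z - (p +i* q)%C) < r -> nc (f z) <= `|M|.
    by move=> z1 z2; apply: le_trans (HM _ z1 z2) (ler_norm _).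
  apply: bd_norm_le_lines => //; try (by apply: hl); try (by apply: vl).
  - by move=> x x0; split; apply: HM'; rewrite ?neq2 ?near ?lexx ?qq.
  - by move=> y y0; split; apply: HM'; rewrite ?neq1 ?near ?lexx ?pp.
apply/eqP; rewrite -nc_eq0 eq_le nc_ge0 andbT; apply/ler_addgt0Pl => e e0.
rewrite addr0.
have P : 0 < 16 * `|M| + 1 by rewrite ltr_wpDl // mulr_ge0.
pose s := Num.min (S0 / 2) (e / (16 * `|M| + 1)).
have s0 : 0 < s by rewrite lt_min !divr_gt0.
apply: le_trans (key s s0 _) _.
  by rewrite /s gt_min; apply/orP; left; rewrite ltr_pdivrMr // ltr_pMr // ltr1n.
have : s <= e / (16 * `|M| + 1) by rewrite /s ge_min lexx orbT.
rewrite ler_pdivlMr // mulrC; apply: le_trans.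
by apply: ler_wpM2r; [exact: ltW | rewrite lerDl].
Qed.

End Goursat.

(** * Cauchy's formula for a kernel with a simple pole *)

Section CauchyKernel.
Variable R : realType.
Implicit Types (F k : R[i] -> R[i]) (z : R[i]) (a b c d p q x y : R).
Notation mu := (@lebesgue_measure R).

Lemma ccontM F k z : ccont F z -> ccont k z -> ccont (fun w => F w * k w) z.
Proof.
move=> HF Hk e e0; have Fz := nc_ge0 (F z); have kz := nc_ge0 (k z).
pose K := nc (F z) + nc (k z) + 1.
have K0 : 0 < K by rewrite /K; lra.
pose t := Num.min 1 (e / (2 * K)).
have t0 : 0 < t by rewrite lt_min ltr01 divr_gt0 // mulr_gt0.
have t1 : t <= 1 by rewrite ge_min lexx.
have tK : t * (2 * K) <= e by rewrite -ler_pdivlMr ?mulr_gt0 // ge_min lexx orbT.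
clearbody t; have [r r0 hF] := HF _ t0; have [s s0 hk] := Hk _ t0.
exists (Num.min r s); first by rewrite lt_min r0.
move=> w; rewrite lt_min => /andP[/hF h1 /hk h2].
have -> : F w * k w - F z * k z = (F w - F z) * (k w - k z) + ((F w - F z) * k z + F z * (k w - k z)) by ring.
apply: le_lt_trans (nc_le_add _ _) _.
apply: le_lt_trans (lerD (lexx _) (nc_le_add _ _)) _; rewrite !Normc.normcM.
have e1 : nc (F w - F z) * nc (k w - k z) <= t * 1.
  by apply: ler_pM; rewrite ?nc_ge0 ?ltW // (lt_le_trans h2).
have e2 : nc (F w - F z) * nc (k z) <= t * nc (k z) by apply: ler_wpM2r => //; exact: ltW.
have e3 : nc (F z) * nc (k w - k z) <= nc (F z) * t by apply: ler_wpM2l => //; exact: ltW.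
have tK' : 2 * (t + t * nc (k z) + nc (F z) * t) <= e by move: tK; rewrite /K; move: (nc (F z)) (nc (k z)) => u v; clear; lra.
have : 0 < t + t * nc (k z) + nc (F z) * t.
  by rewrite -addrA ltr_wpDr // addr_ge0 // mulr_ge0 // ltW.
rewrite mulr1 in e1; move: e1 e2 e3 tK'; move: (nc _ * nc _) (nc _ * nc _) (nc _ * nc _) => u v w'.
by move: (t * _) (_ * t) => u1 u2; clear; lra.
Qed.

Definition off_lines k a b c d :=
  (forall x, a <= x <= b -> ccont k (x +i* c)%C /\ ccont k (x +i* d)%C) /\
  (forall y, c <= y <= d -> ccont k (a +i* y)%C /\ ccont k (b +i* y)%C).

Lemma off_lines_cintegrable k a b c d : off_lines k a b c d ->
  [/\ cintegrable a b (fun x => k (x +i* c)%C), cintegrable a b (fun x => k (x +i* d)%C),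
      cintegrable c d (fun y => k (a +i* y)%C) & cintegrable c d (fun y => k (b +i* y)%C)].
Proof.
by case=> h v; split; [apply: cintegrable_hline => x /h[]|apply: cintegrable_hline => x /h[]
  |apply: cintegrable_vline => x /v[]|apply: cintegrable_vline => x /v[]].
Qed.

Lemma bd_combination F k w a b c d : off_lines F a b c d -> off_lines k a b c d ->
  bd (fun z => F z + w * k z) a b c d = bd F a b c d + w * bd k a b c d.
Proof.
move=> /off_lines_cintegrable[f1 f2 f3 f4] /off_lines_cintegrable[k1 k2 k3 k4].
rewrite /bd.
have E u v g1 g2 h1 h2 : cintegrable u v g1 -> cintegrable u v g2 ->
    cintegrable u v h1 -> cintegrable u v h2 ->
  cint u v (fun t => (g1 t + w * h1 t) - (g2 t + w * h2 t)) =
  cint u v (fun t => g1 t - g2 t) + w * cint u v (fun t => h1 t - h2 t).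
  move=> G1 G2 H1 H2; rewrite -cintZ; last exact: cintegrableB.
  rewrite -cintD; [|exact: cintegrableB|by apply/cintegrableZ/cintegrableB].
  by apply: eq_cint => t _; ring.
rewrite (E a b (fun x => F (x +i* c)%C) (fun x => F (x +i* d)%C)
  (fun x => k (x +i* c)%C) (fun x => k (x +i* d)%C)) //.
rewrite (E c d (fun x => F (b +i* x)%C) (fun x => F (a +i* x)%C)
  (fun x => k (b +i* x)%C) (fun x => k (a +i* x)%C)) //.
by ring.
Qed.

Lemma off_center_lines k a b c d p q : a < p < b -> c < q < d ->
  (forall x y, a <= x <= b -> c <= y <= d -> (x +i* y)%C != (p +i* q)%C -> ccont k (x +i* y)%C) ->
  off_lines k a b c d.
Proof.
move=> /andP[ap pb] /andP[cq qd] H.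
have ab : a <= b by lra. have cd : c <= d by lra.
have neq x y : (x != p) || (y != q) -> (x +i* y)%C != (p +i* q)%C.
  by rewrite eq_complex /= negb_and.
by split=> t tab; split; apply: H; rewrite ?tab ?lexx ?ab ?cd //; apply: neq;
   rewrite ?(lt_eqF ap) ?(gt_eqF pb) ?(lt_eqF cq) ?(gt_eqF qd) ?orbT.
Qed.

(** The function [(F z - F z0) * k z] stays bounded at the pole of [k], so [goursat_punctured]
    applies to it. The kernel is left general because two are used: [1 / (w - z0)] for mean values
    and a periodic one for the decay in the cusps. *)
Lemma cauchy_kernel F k a b c d p q M r : a < p < b -> c < q < d ->
  (forall x y, a <= x <= b -> c <= y <= d -> cdifferentiable F (x +i* y)%C) ->
  (forall x y, a <= x <= b -> c <= y <= d -> (x +i* y)%C != (p +i* q)%C ->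
     cdifferentiable k (x +i* y)%C) ->
  0 < r ->
  (forall z, z != (p +i* q)%C -> nc (z - (p +i* q)%C) < r -> nc (k z) * nc (z - (p +i* q)%C) <= M) ->
  bd (fun z => F z * k z) a b c d = F (p +i* q)%C * bd k a b c d.
Proof.
move=> ap cq HF Hk r0 kM; set z0 := (p +i* q)%C.
have /andP[a1 a2] := ap; have /andP[c1 c2] := cq.
have Hz : cdifferentiable F z0 by apply: HF; apply/andP; split; exact: ltW.
have [D /cdiff_lip[s s0 Hs]] := Hz.
have diffK x y : a <= x <= b -> c <= y <= d -> (x +i* y)%C != (p +i* q)%C ->
    cdifferentiable (fun z => (F z + - F z0) * k z) (x +i* y)%C.
  move=> hx hy hz; have [u Hu] := HF x y hx hy; have [v Hv] := Hk x y hx hy hz.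
  eexists; apply: cdiffM Hv; apply: cdiffD Hu _; exact: cdiff_cst.
have bK : bd (fun z => (F z + - F z0) * k z) a b c d = 0.
  apply: (@goursat_punctured R _ a b c d p q ((nc D + 1) * M) (Num.min r s)) => //.
    by rewrite lt_min r0.
  move=> z zn; rewrite lt_min => /andP[zr zs]; rewrite Normc.normcM.
  apply: le_trans (ler_wpM2r (nc_ge0 _) (Hs z zs)) _.
  rewrite -mulrA; apply: ler_wpM2l; first by rewrite addr_ge0 ?nc_ge0.
  by rewrite mulrC; exact: kM.
have kL : off_lines k a b c d.
  by apply: off_center_lines ap cq _ => x y hx hy hz; exact/cdiff_ccont/Hk.
have KL : off_lines (fun z => (F z + - F z0) * k z) a b c d.
  by apply: off_center_lines ap cq _ => x y hx hy hz; exact/cdiff_ccont/diffK.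
transitivity (bd (fun z => (F z + - F z0) * k z + F z0 * k z) a b c d).
  by congr (bd _ a b c d); apply/funext => z; ring.
by rewrite bd_combination // bK add0r.
Qed.

Lemma cdifferentiable_inv z0 z : z != z0 -> cdifferentiable (fun w => (w - z0)^-1) z.
Proof.
move=> h; eexists; apply: cdiffV; first by rewrite subr_eq0.
apply: cdiffD; [exact: cdiff_id|exact: cdiff_cst].
Qed.

Lemma rint_ge a b (u : R -> R) m : a <= b -> mu.-integrable `[a, b] (EFin \o u) ->
  (forall x, a <= x <= b -> m <= u x) -> m * (b - a) <= rint a b u.
Proof.
move=> ab iu um; rewrite -rint_cst //; apply: le_Rintegral => //.
by apply: continuous_integrable => x _; exact: cvg_cst.
Qed.

(** The integral is [2 pi i], but a lower bound suffices: each of the two pairs of opposite sides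
    contributes at least [2] to the imaginary part, because the integrand there is at least [s^-1]
    over a length [2 s]. *)
Lemma bd_inv_ge x0 y0 s : 0 < s ->
  4 <= nc (bd (fun w => (w - (x0 +i* y0)%C)^-1) (x0 - s) (x0 + s) (y0 - s) (y0 + s)).
Proof.
move=> s0; set k := fun w => _; apply: le_trans (le_trans (ler_norm _) (Im_le_nc _)).
have kL : off_lines k (x0 - s) (x0 + s) (y0 - s) (y0 + s).
  apply: (@off_center_lines _ _ _ _ _ x0 y0); try by (apply/andP; split; lra).
  by move=> x y _ _ h; apply/cdiff_ccont/cdifferentiable_inv.
have [k1 k2 k3 k4] := off_lines_cintegrable kL.
have [_ i1] := cintegrableB k1 k2; have [i2 _] := cintegrableB k4 k3.
rewrite /bd ImD ImM /= mul0r mul1r add0r.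
have V (t u : R) : (t +i* u)%C^-1 = ((t / (t ^+ 2 + u ^+ 2)) +i* (- u / (t ^+ 2 + u ^+ 2)))%C.
  by rewrite mulNr.
have sub (u v : R) : (u +i* v)%C - (x0 +i* y0)%C = ((u - x0) +i* (v - y0))%C by [].
have L (t : R) : - s <= t <= s -> s^-1 <= 2 * s / (t ^+ 2 + s ^+ 2).
  move=> ts; have t2 : t ^+ 2 <= s ^+ 2.
    by rewrite -[t ^+ 2]real_normK ?num_real // ler_pXn2r ?nnegrE ?normr_ge0 ?(ltW s0) // ler_norml.
  have p0 : 0 < t ^+ 2 + s ^+ 2 by rewrite ltr_wpDl ?sqr_ge0 // exprn_gt0.
  rewrite ler_pdivlMr // ler_pdivrMl //.
  have -> : s * (2 * s) = s ^+ 2 + s ^+ 2 by ring.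
  by rewrite lerD2r.
have e1 : s^-1 * (x0 + s - (x0 - s)) <= rint (x0 - s) (x0 + s)
    (fun x => Im (k (x +i* (y0 - s))%C - k (x +i* (y0 + s))%C)).
  apply: rint_ge => //; first lra.
  move=> x hx; apply: le_trans (L (x - x0) _) _; first by apply/andP; move: hx => /andP[]; split; lra.
  rewrite /k ImD ImN !sub !V /=.
  have -> : y0 - s - y0 = - s by ring. have -> : y0 + s - y0 = s by ring.
  by rewrite sqrrN le_eqVlt; apply/orP; left; apply/eqP; move: (_^-1) => D; ring.
have e2 : s^-1 * (y0 + s - (y0 - s)) <= rint (y0 - s) (y0 + s)
    (fun y => Re (k ((x0 + s) +i* y)%C - k ((x0 - s) +i* y)%C)).
  apply: rint_ge => //; first lra.
  move=> y hy; apply: le_trans (L (y - y0) _) _; first by apply/andP; move: hy => /andP[]; split; lra.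
  rewrite /k ReD ReN !sub !V /=.
  have -> : x0 - s - x0 = - s by ring. have -> : x0 + s - x0 = s by ring.
  by rewrite sqrrN le_eqVlt; apply/orP; left; apply/eqP; rewrite ?[s ^+ 2 + _]addrC; move: (_^-1) => D; ring.
apply: le_trans (lerD e1 e2).
by rewrite le_eqVlt; apply/orP; left; apply/eqP; field; rewrite gt_eqF.
Qed.

Lemma inv_dist_bound z0 z : z != z0 -> nc (z - z0)^-1 * nc (z - z0) <= 1.
Proof. by move=> h; rewrite Normc.normcV mulVf // gt_eqF // nc_gt0 subr_eq0. Qed.

End CauchyKernel.

(** * Mean value inequality over the sides of a square *)

Section SquareMean.
Variable R : realType.
Implicit Types (F : R[i] -> R[i]) (z : R[i]) (a b c d x y : R).
Notation mu := (@lebesgue_measure R).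

Lemma nc_continuous (g : R -> R[i]) t : {for t, continuous (fun s => Re (g s))} ->
  {for t, continuous (fun s => Im (g s))} -> {for t, continuous (fun s => nc (g s))}.
Proof.
move=> h1 h2.
have -> : (fun s => nc (g s)) = (fun s => Num.sqrt (Re (g s) * Re (g s) + Im (g s) * Im (g s))).
  by apply/funext => s; rewrite -!expr2 -nc_sqr sqrtr_sqr ger0_norm // nc_ge0.
apply: continuous_comp; last exact: sqrt_continuous.
by apply: continuousD; apply: continuousM.
Qed.

Lemma cont_on_nc_integrable a b (g : R -> R[i]) : cont_on a b g ->
  mu.-integrable `[a, b] (EFin \o (fun x => nc (g x))).
Proof.
by move=> H; apply: continuous_integrable => x /H[]; exact: nc_continuous.
Qed.

Lemma cint_sub_le a b (f1 f2 : R -> R[i]) (h1 h2 : R -> R) : a <= b ->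
  cintegrable a b f1 -> cintegrable a b f2 ->
  mu.-integrable `[a, b] (EFin \o h1) -> mu.-integrable `[a, b] (EFin \o h2) ->
  (forall x, a <= x <= b -> nc (f1 x) <= h1 x /\ nc (f2 x) <= h2 x) ->
  nc (cint a b (fun x => f1 x - f2 x)) <= 2 * (rint a b h1 + rint a b h2).
Proof.
move=> ab F1 F2 H1 H2 H; rewrite /rint -RintegralD //.
apply: cint_norm_le => //; first exact: cintegrableB.
  by apply: (@eq_integrable _ _ _ mu _ _ ((EFin \o h1) \+ (EFin \o h2))%E) => //; exact: integrableD.
move=> x /H[e1 e2]; apply: le_trans (nc_le_sub _ _) _; exact: lerD.
Qed.

Lemma rint_EFin a b (u : R -> R) : mu.-integrable `[a, b] (EFin \o u) ->
  (rint a b u)%:E = (\int[mu]_(x in `[a, b]) (u x)%:E)%E.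
Proof. by move=> iu; rewrite /rint /Rintegral fineK // integrable_fin_num. Qed.

Lemma rintZ a b k (u : R -> R) : mu.-integrable `[a, b] (EFin \o u) ->
  rint a b (fun x => k * u x) = k * rint a b u.
Proof. by move=> iu; rewrite /rint RintegralZl. Qed.

Lemma integrableZ_EFin a b k (u : R -> R) : mu.-integrable `[a, b] (EFin \o u) ->
  mu.-integrable `[a, b] (EFin \o (fun x => k * u x)).
Proof.
move=> H; have -> : (EFin \o (fun x => k * u x)) = (fun x => k%:E * (EFin \o u) x)%E.
  by apply/funext.
exact: integrableZl.
Qed.

(** On the four sides the kernel [1 / (w - z0)] is at most [s^-1] in modulus, while its own boundary
    integral is at least [4]; half of this [4] is lost to the factor [2] of [cint_norm_le]. *)
Lemma square_cauchy F x0 y0 s : 0 < s ->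
  (forall x y, x0 - s <= x <= x0 + s -> y0 - s <= y <= y0 + s -> cdifferentiable F (x +i* y)%C) ->
  2 * s * nc (F (x0 +i* y0)%C) <=
    rint (x0 - s) (x0 + s) (fun x => nc (F (x +i* (y0 - s))%C)) +
    rint (x0 - s) (x0 + s) (fun x => nc (F (x +i* (y0 + s))%C)) +
    rint (y0 - s) (y0 + s) (fun y => nc (F ((x0 + s) +i* y)%C)) +
    rint (y0 - s) (y0 + s) (fun y => nc (F ((x0 - s) +i* y)%C)).
Proof.
move=> s0 HF; set z0 := (x0 +i* y0)%C.
have px : x0 - s < x0 < x0 + s by apply/andP; split; lra.
have py : y0 - s < y0 < y0 + s by apply/andP; split; lra.
have xs : x0 - s <= x0 + s by lra. have ys : y0 - s <= y0 + s by lra.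
pose k w := (w - z0)^-1.
have K := @cauchy_kernel R F k (x0 - s) (x0 + s) (y0 - s) (y0 + s) x0 y0 1 1 px py HF
  (fun x y _ _ h => @cdifferentiable_inv R z0 (x +i* y)%C h) ltr01 (fun z h _ => inv_dist_bound h).
have kG := @bd_inv_ge R x0 y0 s s0.
have cF x y : x0 - s <= x <= x0 + s -> y0 - s <= y <= y0 + s -> ccont F (x +i* y)%C.
  by move=> hx hy; exact/cdiff_ccont/HF.
have FL : off_lines (fun w => F w * k w) (x0 - s) (x0 + s) (y0 - s) (y0 + s).
  apply: off_center_lines px py _ => x y hx hy hz.
  by apply: ccontM; [exact: cF|exact/cdiff_ccont/cdifferentiable_inv].
have [f1 f2 f3 f4] := off_lines_cintegrable FL.
have h1 y : y0 - s <= y <= y0 + s ->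
   mu.-integrable `[x0 - s, x0 + s] (EFin \o (fun x => nc (F (x +i* y)%C))).
  by move=> hy; apply/cont_on_nc_integrable/hline_cont => x hx; exact: cF.
have h2 x : x0 - s <= x <= x0 + s ->
   mu.-integrable `[y0 - s, y0 + s] (EFin \o (fun y => nc (F (x +i* y)%C))).
  by move=> hx; apply/cont_on_nc_integrable/vline_cont => y hy; exact: cF.
have s1 : x0 - s <= x0 + s <= x0 + s by rewrite xs lexx.
have s2 : x0 - s <= x0 - s <= x0 + s by rewrite xs lexx.
have s3 : y0 - s <= y0 + s <= y0 + s by rewrite ys lexx.
have s4 : y0 - s <= y0 - s <= y0 + s by rewrite ys lexx.
have B w : s <= nc (w - z0) -> nc (F w * k w) <= s^-1 * nc (F w).
  move=> sw; rewrite Normc.normcM mulrC; apply: ler_wpM2r; first exact: nc_ge0.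
  by rewrite Normc.normcV lef_pV2 ?posrE // (lt_le_trans s0).
have Bv x y : `|y - y0| = s -> s <= nc ((x +i* y)%C - z0).
  by move=> <-; have := Im_le_nc ((x +i* y)%C - z0).
have Bh x y : `|x - x0| = s -> s <= nc ((x +i* y)%C - z0).
  by move=> <-; have := Re_le_nc ((x +i* y)%C - z0).
have E1 : `|y0 - s - y0| = s by rewrite addrAC subrr add0r normrN gtr0_norm.
have E2 : `|y0 + s - y0| = s by rewrite addrAC subrr add0r gtr0_norm.
have E3 : `|x0 - s - x0| = s by rewrite addrAC subrr add0r normrN gtr0_norm.
have E4 : `|x0 + s - x0| = s by rewrite addrAC subrr add0r gtr0_norm.
have C1 := cint_sub_le xs f1 f2 (integrableZ_EFin s^-1 (h1 _ s4)) (integrableZ_EFin s^-1 (h1 _ s3))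
  (fun x _ => conj (B _ (Bv x _ E1)) (B _ (Bv x _ E2))).
have C2 := cint_sub_le ys f4 f3 (integrableZ_EFin s^-1 (h2 _ s1)) (integrableZ_EFin s^-1 (h2 _ s2))
  (fun y _ => conj (B _ (Bh _ y E4)) (B _ (Bh _ y E3))).
rewrite !rintZ in C1 C2; try by [exact: h1|exact: h2].
have T : nc (bd (fun w => F w * k w) (x0 - s) (x0 + s) (y0 - s) (y0 + s)) =
  nc (F z0) * nc (bd k (x0 - s) (x0 + s) (y0 - s) (y0 + s)) by rewrite K Normc.normcM.
have := nc_le_add (cint (x0 - s) (x0 + s) (fun x => F (x +i* (y0 - s))%C * k (x +i* (y0 - s))%C - F (x +i* (y0 + s))%C * k (x +i* (y0 + s))%C))
  ((0 +i* 1)%C * cint (y0 - s) (y0 + s) (fun y => F ((x0 + s) +i* y)%C * k ((x0 + s) +i* y)%C - F ((x0 - s) +i* y)%C * k ((x0 - s) +i* y)%C)).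
rewrite -/(bd (fun w => F w * k w) (x0 - s) (x0 + s) (y0 - s) (y0 + s)) T.
rewrite (Normc.normcM (0 +i* 1)%C) [nc (0 +i* 1)%C]/= expr0n expr1n add0r sqrtr1 mul1r.
move=> h; have := le_trans h (lerD C1 C2).
have := ler_wpM2l (nc_ge0 (F z0)) kG; rewrite -/(bd k _ _ _ _) -/z0 -/k => g.
move=> /(le_trans g).
rewrite -!mulrDr; move: (rint _ _ _) (rint _ _ _) (rint _ _ _) (rint _ _ _) (nc _) => r1 r2 r3 r4 m.
have -> : 2 * (s^-1 * (r4 + r3 + (r2 + r1))) = 2 * (r4 + r3 + r2 + r1) / s by field; rewrite gt_eqF.
rewrite ler_pdivlMr //; move: (r4 + r3 + r2 + r1) => t.
have -> : m * 4 * s = 2 * (2 * s * m) by ring.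
by rewrite ler_pM2l.
Qed.

End SquareMean.

(** * Measures with a density and change of variables *)

Section Density.
Local Open Scope ereal_scope.
Context d (T : measurableType d) (R : realType).
Variables (mu : {measure set T -> \bar R}) (w : T -> R).

(** The two properties of [w] are arguments so that the structure of a measure can be attached to
    [dens mw w0]. *)
Definition dens of measurable_fun [set: T] w & (forall x, 0 <= w x)%R : set T -> \bar R :=
  fun A => \int[mu]_(x in A) (w x)%:E.

Hypotheses (mw : measurable_fun [set: T] w) (w0 : forall x, (0 <= w x)%R).
Local Notation nu := (dens mw w0).

Let dens0 : nu set0 = 0. Proof. exact: integral_set0. Qed.
Let mwE : measurable_fun [set: T] (EFin \o w). Proof. exact/measurable_EFinP. Qed.
Let w0E x : 0 <= (w x)%:E. Proof. by rewrite lee_fin. Qed.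
Let dens_ge0 A : 0 <= nu A. Proof. by apply: integral_ge0 => x _; exact: w0E. Qed.
Let dens_sigma_additive : semi_sigma_additive nu.
Proof.
move=> F mF tF mUF; rewrite /dens ge0_integral_bigcup //; last first.
  exact: measurable_funTS.
by apply: is_cvg_ereal_nneg_natsum => n _; exact: dens_ge0.
Qed.

HB.instance Definition _ := isMeasure.Build _ _ _ nu
  dens0 dens_ge0 dens_sigma_additive.

Import HBNNSimple.

(** Both sides are limits along the simple functions [f_ n] that approximate [h], and for a single
    level set the identity is the definition of [dens]. *)
Lemma ge0_integral_dens (h : T -> \bar R) : measurable_fun [set: T] h ->
  (forall x, 0 <= h x) -> \int[nu]_x h x = \int[mu]_x (h x * (w x)%:E).
Proof.
move=> mh h0; pose f_ := nnsfun_approx measurableT mh.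
transitivity (limn (fun n => \int[nu]_x (f_ n x)%:E)).
  rewrite -monotone_convergence //.
  - apply: eq_integral => x _; apply/esym/cvg_lim => //.
    exact: cvg_nnsfun_approx.
  - by move=> n; exact/measurable_EFinP.
  - by move=> n x _; rewrite lee_fin.
  - by move=> x _ m n mn; rewrite lee_fin; exact/lefP/nd_nnsfun_approx.
transitivity (limn (fun n => \int[mu]_x ((f_ n x)%:E * (w x)%:E))); last first.
  rewrite -monotone_convergence //.
  - apply: eq_integral => x _; apply/cvg_lim => //.
    have : (f_ n x)%:E @[n --> \oo] --> h x by exact: cvg_nnsfun_approx.
    exact: cvgeZr.
  - move=> n; apply: emeasurable_funM => //; exact/measurable_EFinP.
  - by move=> n x _; rewrite mule_ge0 // lee_fin.
  - move=> x _ m n mn; apply: lee_wpmul2r => //; rewrite lee_fin.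
    exact/lefP/nd_nnsfun_approx.
congr (limn _); apply/funext => n.
transitivity (\int[nu]_x
   (\sum_(y \in range (f_ n)) (y * \1_(f_ n @^-1` [set y]) x)%:E)).
  by apply: eq_integral => x _; rewrite /= fimfunE -fsumEFin.
rewrite ge0_integral_fsum //; last 2 first.
- by move=> r; exact/measurable_EFinP/measurable_funM.
- by move=> r x _; rewrite nnfun_muleindic_ge0.
transitivity (\int[mu]_x (\sum_(y \in range (f_ n))
    (y * \1_(f_ n @^-1` [set y]) x)%:E * (w x)%:E)); last first.
  apply: eq_integral => x _; rewrite -ge0_mule_fsuml.
    by rewrite fsumEFin // -(fimfunE _ x).
  by move=> y; exact: nnfun_muleindic_ge0.
rewrite ge0_integral_fsum //; last 2 first.
- move=> r; apply: emeasurable_funM => //.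
  by apply/measurable_EFinP; exact: measurable_funM.
- by move=> r x _; rewrite mule_ge0 // nnfun_muleindic_ge0.
apply: eq_fsbigr => r /set_mem[t _ tr].
have r0 : (0 <= r)%R by rewrite -tr.
rewrite integralZl_indic_nnsfun //.
under [RHS]eq_integral do rewrite EFinM -muleA.
rewrite ge0_integralZl //; last 2 first.
- by apply: emeasurable_funM => //; apply/measurable_EFinP.
- by move=> x _; rewrite mule_ge0 // lee_fin.
congr (_ * _); rewrite integral_indic // setIT.
rewrite [LHS]integral_mkcond; apply: eq_integral => x _.
by rewrite muleC epatch_indic.
Qed.

End Density.

Section Substitution.
Local Open Scope ereal_scope.
Context d d' (T : measurableType d) (T' : measurableType d') (R : realType).
Variables (mu : {measure set T -> \bar R}) (nu : {measure set T' -> \bar R}).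

(** The hypothesis on sets says that [nu] is the image under [phi] of the measure with density [w],
    so the formula is that of a push-forward. *)
Lemma ge0_integral_subst (phi : T -> T') (w : T -> R) :
  measurable_fun [set: T] phi -> measurable_fun [set: T] w ->
  (forall x, 0 <= w x)%R ->
  (forall A, measurable A -> \int[mu]_(x in phi @^-1` A) (w x)%:E = nu A) ->
  forall h : T' -> \bar R, measurable_fun [set: T'] h -> (forall x, 0 <= h x) ->
  \int[nu]_x h x = \int[mu]_x (h (phi x) * (w x)%:E).
Proof.
move=> mphi mw w0 H h mh h0.
rewrite -(@ge0_integral_dens _ _ _ mu w mw w0 (h \o phi)
  (measurableT_comp mh mphi) (fun x => h0 _)).
have := @ge0_integral_pushforward _ _ T T' R phi mphi (dens mu mw w0) setT h measurableT mh.
rewrite preimage_setT => <- //.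
by apply: eq_measure_integral => A mA _; rewrite -H.
Qed.

End Substitution.

Section ExpSubstitution.
Local Open Scope ereal_scope.
Variable R : realType.
Notation mu := (@lebesgue_measure R).

Lemma integral_expR_Noo (b : R) : \int[mu]_(x in `]-oo, b]) (expR x)%:E = (expR b)%:E.
Proof.
have := @ge0_integration_by_substitutionNy R expR (- b)%R; rewrite opprK => -> //; last first.
  by apply: continuous_subspaceT; exact: continuous_expR.
rewrite /= (@ge0_continuous_FTC2y _ _ (fun x => - expR (- x))%R _ 0%R).
- by rewrite opprK sub0e -EFinN opprK.
- by move=> x _; exact: expR_ge0.
- apply: continuous_subspaceT => x.
  by apply: continuous_comp; [exact: opp_continuous|exact: continuous_expR].
- rewrite -[0%R]oppr0; apply: cvgN; exact: cvgr_expR.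
- by [].
- apply: cvg_at_right_filter; apply: cvgN.
  by apply: continuous_comp; [exact: opp_continuous|exact: continuous_expR].
- move=> x _; rewrite derive1E derive_val.
  by rewrite mulrN1 opprK.
Qed.


(** Lebesgue measure is determined by its values on the intervals []a, b]]. The image under [exp] of
    [exp x dx] lives on the positive half-line only, so Lebesgue measure on []-oo, 0]] is added to
    it before the comparison. *)
Lemma ge0_integral_expR (h : R -> \bar R) : measurable_fun [set: R] h ->
  (forall x, 0 <= h x) ->
  \int[mu]_(x in `]0%R, +oo[) h x = \int[mu]_x (h (expR x) * (expR x)%:E).
Proof.
move=> mh h0.
have mpos : measurable (`]0%R, +oo[ : set (measurableTypeR R)) by [].
have mneg : measurable (`]-oo, 0%R] : set (measurableTypeR R)) by [].
have e0 x : (0 <= expR x :> R)%R by exact: expR_ge0.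
pose nu := dens mu (@measurable_expR R) e0.
pose m0 := measure_add (pushforward nu (@expR R : R -> measurableTypeR R)) (mrestr mu mneg).
pose m := m0 (@measurable_expR R).
have nuab (u v : R) : (u <= v)%R ->
    nu `]u, v]%classic = (expR v - expR u)%:E.
  move=> uv; have : nu `]-oo, v]%classic = nu `]-oo, u]%classic + nu `]u, v]%classic.
    rewrite /nu /dens -ge0_integral_setU //.
    - by rewrite -itv_bndbnd_setU.
    - by apply/measurable_EFinP; apply: measurable_funTS; exact: measurable_expR.
    - apply/disj_setPS => x [/=]; rewrite !in_itv /= => xu /andP[ux _].
      by move: ux; rewrite ltNge xu.
  rewrite /nu /dens !integral_expR_Noo; case: (\int[_]_(_ in _) _) => // r [] ->.
  by congr EFin; ring.
have mD A : m A = nu (expR @^-1` A) + mu (A `&` `]-oo, 0%R]%classic) by exact: measure_addE.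
have mE A : measurable A -> mu A = m A.
  apply: lebesgue_measure_unique => _ [[a b]] _ <-; rewrite -[RHS]/(m `]a, b]%classic).
  rewrite mD.
  have [ba|ab] := leP b a.
    have -> : `]a, b]%classic = set0 :> set R by rewrite set_itv_ge // bnd_simp -leNgt.
    by rewrite preimage_set0 set0I !measure0 adde0.
  have [b0|b0] := leP b 0%R.
    have -> : expR @^-1` `]a, b]%classic = set0 :> set R.
      rewrite -subset0 => x /=; rewrite in_itv /= => /andP[_ xb].
      by have := expR_gt0 x; rewrite ltNge (le_trans xb b0).
    rewrite /nu /dens integral_set0 add0e; congr (lebesgue_measure _).
    apply/seteqP; split=> x /=; last by case.
    by rewrite !in_itv /= => /andP[xa xb]; rewrite xa xb (le_trans xb b0).
  have [a0|a0] := leP a 0%R.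
    have -> : expR @^-1` `]a, b]%classic = `]-oo, ln b]%classic :> set R.
      apply/seteqP; split=> x /=; rewrite !in_itv /=.
        by move=> /andP[_ xb]; rewrite -ler_expR lnK // posrE.
      rewrite -ler_expR lnK ?posrE // => ->; rewrite andbT.
      by rewrite (le_lt_trans a0) ?expR_gt0.
    rewrite /nu /dens integral_expR_Noo lnK //.
    have -> : `]a, b]%classic `&` `]-oo, 0%R]%classic = `]a, 0%R]%classic :> set R.
      apply/seteqP; split=> x /=; rewrite !in_itv /=.
        by move=> [/andP[-> _] ->].
      by move=> /andP[-> x0]; rewrite x0 (le_trans x0 (ltW b0)).
    rewrite !lebesgue_measure_itv /= !lte_fin ab; case: ltgtP a0 => // [a0 _|-> _].
      by rewrite -!EFinD; congr EFin; ring.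
    by rewrite adde0 -EFinD subr0.
  have -> : expR @^-1` `]a, b]%classic = `]ln a, ln b]%classic :> set R.
    apply/seteqP; split=> x /=; rewrite !in_itv /=.
      by rewrite -(ltr_expR (ln a)) -(ler_expR x) !lnK // posrE (lt_trans a0).
  by rewrite -(ltr_expR (ln a)) -(ler_expR x) !lnK // posrE (lt_trans a0).
  rewrite nuab ?ler_ln // ?(ltW ab) // !lnK //.
  have -> : `]a, b]%classic `&` `]-oo, 0%R]%classic = set0 :> set R.
    rewrite -subset0 => x /=; rewrite !in_itv /= => -[/andP[ax _] x0].
    by have := lt_trans a0 ax; rewrite ltNge x0.
  by rewrite measure0 adde0 lebesgue_measure_itv /= lte_fin ab EFinB.
rewrite -(@ge0_integral_dens _ _ _ mu (@expR R) (@measurable_expR R) e0 (h \o @expR R)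
  (measurableT_comp mh (@measurable_expR R)) (fun x => h0 _)).
have := @ge0_integral_pushforward _ _ (measurableTypeR R) (measurableTypeR R) R (@expR R) (@measurable_expR R) nu
   `]0%R, +oo[%classic h mpos (measurable_funTS mh) (fun x _ => h0 x).
have -> : expR @^-1` `]0%R, +oo[%classic = setT :> set R.
  by apply/seteqP; split=> x //= _; rewrite in_itv /= expR_gt0.
move=> <-; apply: eq_measure_integral => A mA A0.
suff E : mu A = nu (expR @^-1` A) by first [exact: E | exact: esym E].
rewrite (mE _ mA) mD [X in _ + X](_ : _ = 0) ?adde0 //.
have -> : A `&` `]-oo, 0%R]%classic = set0.
  rewrite -subset0 => x /= -[/A0]; rewrite /= !in_itv /= andbT => x0.
  by rewrite leNgt x0.
exact: measure0.
Qed.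


End ExpSubstitution.

(** * One-dimensional substitutions: affine maps, squares, inverses *)

Section OneDimSubstitution.
Local Open Scope ereal_scope.
Variable R : realType.
Notation mu := (@lebesgue_measure R).
Implicit Types h : R -> \bar R.

Lemma measurable_if0 h : measurable_fun [set: R] h ->
  measurable_fun [set: R] (fun x => if (0 < x)%R then h x else 0).
Proof.
move=> mh; apply: measurable_fun_ifT => //.
by apply: measurable_fun_ltr.
Qed.

(** In this logarithmic coordinate on the positive half-line squaring becomes [x |-> 2 x] and
    inversion [x |-> - x], so that both reduce to [ge0_integral_affine]. *)
Lemma ge0_integral_pos_expR h : measurable_fun [set: R] h ->
  (forall x, (0 < x)%R -> 0 <= h x) ->
  \int[mu]_x (if (0 < x)%R then h x else 0) = \int[mu]_x (h (expR x) * (expR x)%:E).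
Proof.
move=> mh h0; set g := fun x => if (0 < x)%R then h x else 0.
have g0 x : 0 <= g x by rewrite /g; case: ifPn => // /h0.
transitivity (\int[mu]_(x in `]0%R, +oo[) g x).
  rewrite [RHS]integral_mkcond; apply: eq_integral => x _; rewrite patchE.
  have -> : (x \in `]0%R, +oo[%classic) = (0 < x)%R by apply/idP/idP; rewrite inE /= in_itv /= andbT.
  by rewrite /g; case: ifP.
rewrite ge0_integral_expR //; last exact: measurable_if0.
by apply: eq_integral => x _; rewrite /g expR_gt0.
Qed.

Lemma ge0_integral_affine (a b : R) h : (a != 0)%R -> measurable_fun [set: R] h ->
  (forall x, 0 <= h x) ->
  \int[mu]_x h x = \int[mu]_x (h (a * x + b)%R * `|a|%:E).
Proof.
move=> a0 mh h0.
have mphi : measurable_fun [set: R] (fun x : R => a * x + b)%R.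
  by apply: measurable_funD => //; exact: measurable_funM.
have ma : measurable_fun [set: R] (fun=> `|a|%R : R) by [].
apply: (@ge0_integral_subst _ _ (measurableTypeR R) (measurableTypeR R) R mu mu
  (fun x : R => a * x + b)%R (fun=> `|a|%R) mphi ma) => //.
move=> A mA.
pose nu := dens mu ma (fun=> normr_ge0 a).
pose mm (nu' : {measure set (measurableTypeR R) -> \bar R}) := nu'.
pose m0 := mm (pushforward nu ((fun x : R => a * x + b)%R : R -> measurableTypeR R)).
pose m := m0 mphi.
suff E : mu A = m A by exact: esym E.
apply: lebesgue_measure_unique => // _ [[c d]] _ <-.
rewrite -[RHS]/(nu ((fun x : R => a * x + b)%R @^-1` `]c, d]%classic)) /nu /dens.
have L (i : interval R) : \int[mu]_(x in [set` i]) (`|a|%R)%:E = (`|a|%R)%:E * mu [set` i].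
  by rewrite integral_cst.
have [dc|cd] := leP d c.
  have -> : `]c, d]%classic = set0 :> set R by rewrite set_itv_ge // bnd_simp -leNgt.
  by rewrite preimage_set0 measure0 integral_set0.
rewrite lebesgue_measure_itv /= lte_fin cd.
case: ltgtP a0 => // a0 _.
  have -> : (fun x : R => a * x + b)%R @^-1` `]c, d]%classic =
     [set` `[((d - b) / a)%R, ((c - b) / a)%R[].
    apply/seteqP; split=> x /=; rewrite !in_itv /= ler_ndivrMr // ltr_ndivlMr //;
    by rewrite ltrBlDr lerBrDr [(x * a)%R]mulrC andbC.
  rewrite L lebesgue_measure_itv /= lte_fin ltr_ndivrMr // divfK ?lt_eqF //.
  rewrite ltrD2r cd -!EFinD -EFinM ltr0_norm //.
  by congr EFin; field; rewrite lt_eqF.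
have -> : (fun x : R => a * x + b)%R @^-1` `]c, d]%classic =
     [set` `]((c - b) / a)%R, ((d - b) / a)%R]].
  apply/seteqP; split=> x /=; rewrite !in_itv /= ler_pdivlMr // ltr_pdivrMr //;
  by rewrite ltrBlDr lerBrDr [(x * a)%R]mulrC.
rewrite L lebesgue_measure_itv /= lte_fin ltr_pdivrMr // divfK ?gt_eqF //.
rewrite ltrD2r cd -!EFinD -EFinM gtr0_norm //.
by congr EFin; field; rewrite gt_eqF.
Qed.

Lemma ge0_integral_pos_sqr h : measurable_fun [set: R] h ->
  (forall x, (0 < x)%R -> 0 <= h x) ->
  \int[mu]_x (if (0 < x)%R then h x else 0) =
  \int[mu]_x (if (0 < x)%R then h (x ^+ 2)%R * (2 * x)%:E else 0).
Proof.
move=> mh h0.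
rewrite ge0_integral_pos_expR // [RHS]ge0_integral_pos_expR; last 2 first.
- apply: emeasurable_funM; last by apply/measurable_EFinP; exact: measurable_funM.
  by apply: measurableT_comp => //; exact: measurable_funX.
- by move=> x x0; rewrite mule_ge0 ?h0 ?exprn_gt0 // lee_fin mulr_ge0 // ltW.
rewrite (@ge0_integral_affine 2 0) //; last 2 first.
- apply: emeasurable_funM; last by apply/measurable_EFinP; exact: measurable_expR.
  by apply: measurableT_comp => //; exact: measurable_expR.
- by move=> x; rewrite mule_ge0 ?h0 ?expR_gt0 // lee_fin expR_ge0.
apply: eq_integral => x _; rewrite addr0 expRM_natl -!muleA -!EFinM.
congr (_ * _%:E); rewrite ger0_norm //; ring.
Qed.

Lemma measurable_inv : measurable_fun [set: R] (@GRing.inv R).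
Proof.
have -> : @GRing.inv R = fun x => if (0 <= x)%R then (x `^ (-1))%R else (- ((- x) `^ (-1)))%R.
  apply/funext => x; case: ifPn => [x0|]; first by rewrite powR_inv1.
  by rewrite -ltNge => x0; rewrite powR_inv1 ?oppr_ge0 ?ltW // invrN opprK.
apply: measurable_fun_ifT.
- exact: measurable_fun_ler.
- exact: measurable_powR.
- apply: measurable_funN; apply: (measurableT_comp (measurable_powR (-1)%R)).
  exact: measurable_funN.
Qed.

Lemma ge0_integral_pos_inv h : measurable_fun [set: R] h ->
  (forall x, (0 < x)%R -> 0 <= h x) ->
  \int[mu]_x (if (0 < x)%R then h x else 0) =
  \int[mu]_x (if (0 < x)%R then h (x^-1)%R * (x ^- 2)%:E else 0).
Proof.
move=> mh h0.
rewrite ge0_integral_pos_expR // [RHS]ge0_integral_pos_expR; last 2 first.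
- apply: emeasurable_funM; first exact: (measurableT_comp mh measurable_inv).
  apply/measurable_EFinP; apply: (measurableT_comp measurable_inv).
  exact: measurable_funX.
- by move=> x x0; rewrite mule_ge0 ?h0 ?invr_gt0 // lee_fin invr_ge0 sqr_ge0.
rewrite (@ge0_integral_affine (-1) 0) ?oppr_eq0 ?oner_eq0 //; last 2 first.
- apply: emeasurable_funM; last by apply/measurable_EFinP; exact: measurable_expR.
  by apply: measurableT_comp => //; exact: measurable_expR.
- by move=> x; rewrite mule_ge0 ?h0 ?expR_gt0 // lee_fin expR_ge0.
apply: eq_integral => x _; rewrite addr0 mulN1r -!expRN -!muleA -!EFinM.
congr (_ * _%:E); rewrite normrN1 mulr1 expRN; field.
by rewrite gt_eqF ?expR_gt0.
Qed.

End OneDimSubstitution.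

(** * Mean value inequality over the area of a square *)

Section AreaMean.
Variable R : realType.
Implicit Types (F : R[i] -> R[i]) (z : R[i]) (a b c d x y : R).
Notation mu := (@lebesgue_measure R).

Lemma rint_le_integral a b (u : R -> R) (v : R -> \bar R) : 
  mu.-integrable `[a, b] (EFin \o u) -> measurable_fun [set: R] v -> (forall x, 0 <= v x)%E ->
  (forall x, a <= x <= b -> v x = (u x)%:E) -> ((rint a b u)%:E <= \int[mu]_x v x)%E.
Proof.
move=> iu mv v0 uv; rewrite (rint_EFin iu).
have -> : (\int[mu]_(x in `[a, b]) (u x)%:E = \int[mu]_(x in `[a, b]) v x)%E.
  by apply: eq_integral => x; rewrite inE /= in_itv /= => /uv ->.
by apply: ge0_subset_integral => //; exact: measurable_itv.
Qed.

Lemma ge0_integral_flip (v : R -> \bar R) t : measurable_fun [set: R] v -> (forall x, 0 <= v x)%E ->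
  (\int[mu]_s v (t - s)%R = \int[mu]_s v s)%E /\ (\int[mu]_s v (t + s)%R = \int[mu]_s v s)%E.
Proof.
move=> mv v0; have n1 : -1 != 0 :> R by rewrite oppr_eq0 oner_neq0.
split; rewrite -[RHS]/(integral mu setT v).
  rewrite (ge0_integral_affine t n1 mv v0); apply: eq_integral => s _.
  by rewrite normrN1 mule1 mulN1r addrC.
rewrite (ge0_integral_affine t (oner_neq0 R) mv v0); apply: eq_integral => s _.
by rewrite normr1 mule1 mul1r addrC.
Qed.

Lemma ge0_integral_sum4 (f1 f2 f3 f4 : R -> \bar R) :
  measurable_fun [set: R] f1 -> measurable_fun [set: R] f2 ->
  measurable_fun [set: R] f3 -> measurable_fun [set: R] f4 ->
  (forall x, 0 <= f1 x)%E -> (forall x, 0 <= f2 x)%E ->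
  (forall x, 0 <= f3 x)%E -> (forall x, 0 <= f4 x)%E ->
  measurable_fun [set: R] (fun x => f1 x + f2 x + f3 x + f4 x)%E /\
  (\int[mu]_x (f1 x + f2 x + f3 x + f4 x) =
   \int[mu]_x f1 x + \int[mu]_x f2 x + \int[mu]_x f3 x + \int[mu]_x f4 x)%E.
Proof.
move=> m1 m2 m3 m4 p1 p2 p3 p4.
have m12 : measurable_fun [set: R] (fun x => f1 x + f2 x)%E by exact: emeasurable_funD.
have m123 : measurable_fun [set: R] (fun x => f1 x + f2 x + f3 x)%E by exact: emeasurable_funD.
split; first exact: emeasurable_funD.
by rewrite !ge0_integralD // => x _; rewrite !adde_ge0.
Qed.

Definition csq x0 y0 (rho : R) : set (R * R) :=
  `[x0 - rho, x0 + rho] `*` `[y0 - rho, y0 + rho].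

(** [square_cauchy] is integrated over half-sides [s] from [rho / 2] to [rho]. As [s] varies each of
    the four sides sweeps out part of the square, so by Fubini its contribution is at most the
    integral [I] over the square; from [rho / 2 * rho * h <= 4 I] comes the [8]. The real function
    [h] represents [|F|] so that measurability is available on the whole plane. *)
Theorem submean_square F x0 y0 (rho : R) (h : R * R -> R) : 0 < rho ->
  (forall x y, csq x0 y0 rho (x, y) -> cdifferentiable F (x +i* y)%C) ->
  measurable_fun [set: R * R] h -> (forall p, 0 <= h p) ->
  (forall x y, csq x0 y0 rho (x, y) -> h (x, y) = nc (F (x +i* y)%C)) ->
  ((rho ^+ 2 * h (x0, y0))%:E <= 8%:E * \int[@lebesgue2 R]_(p in csq x0 y0 rho) (h p)%:E)%E.
Proof.
move=> r0 HF mh h0 hF.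
set Q := csq x0 y0 rho.
have mQ : measurable Q by apply: measurableX; exact: measurable_itv.
pose g (p : R * R) : \bar R := (h p * \1_Q p)%:E.
have mg : measurable_fun [set: R * R] g.
  by apply/measurable_EFinP; apply: measurable_funM => //; exact: measurable_indic.
have g0 p : (0 <= g p)%E by rewrite lee_fin mulr_ge0.
have gE x y : Q (x, y) -> g (x, y) = (nc (F (x +i* y)%C))%:E.
  by move=> Qxy; rewrite /g hF // indicE mem_set // mulr1.
pose A y : \bar R := (\int[mu]_x g (x, y))%E; pose B x : \bar R := (\int[mu]_y g (x, y))%E.
have mA : measurable_fun [set: R] A by exact: (@measurable_fun_fubini_tonelli_G _ _ _ _ R mu _ mg g0).
have mB : measurable_fun [set: R] B by exact: (@measurable_fun_fubini_tonelli_F _ _ _ _ R mu _ mg g0).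
have A0 y : (0 <= A y)%E by exact: integral_ge0.
have B0 x : (0 <= B x)%E by exact: integral_ge0.
pose I : \bar R := (\int[@lebesgue2 R]_(p in Q) (h p)%:E)%E.
rewrite -/Q -/I; have Ig : I = (\int[@lebesgue2 R]_p g p)%E.
  rewrite /I integral_mkcond; apply: eq_integral => p _.
  by rewrite patchE /g indicE; case: (p \in Q); rewrite ?mulr1 ?mulr0.
have IB : (I = \int[mu]_x B x)%E.
  rewrite Ig; exact: (@fubini_tonelli1 _ _ _ _ R mu mu _ mg g0).
have IA : (I = \int[mu]_y A y)%E.
  rewrite IB; exact: (@fubini_tonelli _ _ _ _ R mu mu _ mg g0).
have inQ x y : x0 - rho <= x <= x0 + rho -> y0 - rho <= y <= y0 + rho -> Q (x, y).
  by move=> hx hy; split; rewrite /= in_itv.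
have Q0 : Q (x0, y0) by apply: inQ; apply/andP; split; lra.
have step s : rho / 2 <= s <= rho ->
  ((rho * h (x0, y0))%:E <= A (y0 - s)%R + A (y0 + s)%R + B (x0 + s)%R + B (x0 - s)%R)%E.
  move=> /andP[s1 s2]; have s0 : 0 < s by lra.
  have ux x : x0 - s <= x <= x0 + s -> x0 - rho <= x <= x0 + rho by move=> /andP[? ?]; apply/andP; split; lra.
  have uy y : y0 - s <= y <= y0 + s -> y0 - rho <= y <= y0 + rho by move=> /andP[? ?]; apply/andP; split; lra.
  have dF x y : x0 - s <= x <= x0 + s -> y0 - s <= y <= y0 + s -> cdifferentiable F (x +i* y)%C.
    by move=> /ux hx /uy hy; exact/HF/inQ.
  have cF x y : x0 - s <= x <= x0 + s -> y0 - s <= y <= y0 + s -> ccont F (x +i* y)%C.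
    by move=> hx hy; exact/cdiff_ccont/dF.
  have := square_cauchy s0 dF.
  have h1 y : y0 - s <= y <= y0 + s ->
     ((rint (x0 - s) (x0 + s) (fun x => nc (F (x +i* y)%C)))%:E <= A y)%E.
    move=> hy; apply: rint_le_integral => //.
    - by apply/cont_on_nc_integrable/hline_cont => x hx; exact: cF.
    - exact: (measurable_fun_pair1 y mg).
    - by move=> x hx; apply: gE; apply: inQ; [exact: ux|exact: uy].
  have h2 x : x0 - s <= x <= x0 + s ->
     ((rint (y0 - s) (y0 + s) (fun y => nc (F (x +i* y)%C)))%:E <= B x)%E.
    move=> hx; apply: rint_le_integral => //.
    - by apply/cont_on_nc_integrable/vline_cont => y hy; exact: cF.
    - exact: (measurable_fun_pair2 x mg).
    - by move=> y hy; apply: gE; apply: inQ; [exact: ux|exact: uy].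
  have e1 : y0 - s <= y0 - s <= y0 + s by apply/andP; split; lra.
  have e2 : y0 - s <= y0 + s <= y0 + s by apply/andP; split; lra.
  have e3 : x0 - s <= x0 - s <= x0 + s by apply/andP; split; lra.
  have e4 : x0 - s <= x0 + s <= x0 + s by apply/andP; split; lra.
  have := leeD (leeD (leeD (h1 _ e1) (h1 _ e2)) (h2 _ e4)) (h2 _ e3).
  rewrite -!EFinD => L U; apply: le_trans L; rewrite lee_fin; apply: le_trans U.
  rewrite (hF _ _ Q0); apply: ler_wpM2r; first exact: nc_ge0.
  by lra.
clearbody A B I.
pose D : set R := `[rho / 2, rho]%classic.
have mD : measurable D by exact: measurable_itv.
have mT1 (t : R) : measurable_fun [set: R] (fun s : R => t - s) by exact: measurable_funB.
have mT2 (t : R) : measurable_fun [set: R] (fun s : R => t + s) by exact: measurable_funD.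
have m1 : measurable_fun [set: R] (fun s => A (y0 - s)%R) := measurableT_comp mA (mT1 y0).
have m2 : measurable_fun [set: R] (fun s => A (y0 + s)%R) := measurableT_comp mA (mT2 y0).
have m3 : measurable_fun [set: R] (fun s => B (x0 + s)%R) := measurableT_comp mB (mT2 x0).
have m4 : measurable_fun [set: R] (fun s => B (x0 - s)%R) := measurableT_comp mB (mT1 x0).
pose G s : \bar R := (A (y0 - s)%R + A (y0 + s)%R + B (x0 + s)%R + B (x0 - s)%R)%E.
have [mG IG] : measurable_fun [set: R] G /\ (\int[mu]_s G s = I + I + I + I)%E.
  have [i1 i2] := ge0_integral_flip y0 mA A0; have [i4 i3] := ge0_integral_flip x0 mB B0.
  have [mG ->] := ge0_integral_sum4 m1 m2 m3 m4 (fun s => A0 _) (fun s => A0 _) (fun s => B0 _) (fun s => B0 _).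
  by rewrite i1 i2 i3 i4 -IA -IB.
have G0 s : (0 <= G s)%E by exact: (adde_ge0 (adde_ge0 (adde_ge0 (A0 _) (A0 _)) (B0 _)) (B0 _)).
have I0 : (0 <= I)%E by rewrite IB; apply: integral_ge0.
have stepG s : rho / 2 <= s <= rho -> ((rho * h (x0, y0))%:E <= G s)%E := @step s.
clearbody G.
have L1 : (\int[mu]_(s in D) (rho * h (x0, y0))%:E <= I + I + I + I)%E.
  rewrite -IG; apply: (@le_trans _ _ (\int[mu]_(s in D) G s)%E).
    apply: ge0_le_integral => //.
    - by move=> s _; rewrite lee_fin mulr_ge0 // ltW.
    - exact: measurable_funTS.
  exact: (@ge0_subset_integral _ _ R mu _ _ mD measurableT G mG (fun s _ => G0 s) (@subsetT _ _)).
have muD : mu D = (rho / 2)%:E.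
  rewrite /D lebesgue_measure_itv /= lte_fin ifT; last lra.
  by rewrite -EFinB; congr (_%:E); field.
have E : (\int[mu]_(s in D) (rho * h (x0, y0))%:E = (rho ^+ 2 * h (x0, y0) / 2)%:E)%E.
  rewrite integral_cst //.
  rewrite [X in (_ * X)%E](_ : _ = (rho / 2)%:E); last exact: muD.
  by rewrite -EFinM; congr (_%:E); field.
rewrite E in L1; move: L1 I0; clear; case: I => [i| |] // L1 I0; last first.
  by rewrite gt0_muley ?lte_fin // leey.
by move: L1; rewrite -EFinM -!EFinD !lee_fin; lra.
Qed.

End AreaMean.

(** * Invariance of the hyperbolic measure *)

Section HyperbolicIntegral.
Local Open Scope ereal_scope.
Variable R : realType.
Notation mu := (@lebesgue_measure R).
Implicit Types H : R * R -> \bar R.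

(** The value 0 outside the upper half-plane lets hyperbolic integrals be taken over all of [R * R],
    where Fubini applies directly. *)
Definition hdens H (p : R * R) : \bar R :=
  if (0 < p.2)%R then H p * (p.2 ^- 2)%:E else 0.

Definition hint H : \bar R := \int[@lebesgue2 R]_p hdens H p.

Lemma measurable_inv_sqr : measurable_fun [set: R] (fun x : R => x ^- 2)%R.
Proof. apply: (measurableT_comp (@measurable_inv R)); exact: measurable_funX. Qed.

Lemma measurable_hint H : measurable_fun [set: R * R] H ->
  measurable_fun [set: R * R] (hdens H).
Proof.
move=> mH; apply: measurable_fun_ifT => //.
  by apply: measurable_fun_ltr => //; exact: measurable_snd.
apply: emeasurable_funM => //; apply/measurable_EFinP.
by apply: (measurableT_comp measurable_inv_sqr); exact: measurable_snd.
Qed.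

Lemma hint_integrand_ge0 H p : (forall p, 0 <= H p) ->
  0 <= hdens H p.
Proof.
by move=> H0; rewrite /hdens; case: ifP => // _; rewrite mule_ge0 // lee_fin invr_ge0 sqr_ge0.
Qed.

Lemma hint_yx H : measurable_fun [set: R * R] H -> (forall p, 0 <= H p) ->
  hint H = \int[mu]_y \int[mu]_x hdens H (x, y).
Proof.
move=> mH H0; have h0 p := @hint_integrand_ge0 H p H0.
have E0 : hint H = \int[mu]_x fubini_F mu (hdens H) x.
  exact: (@fubini_tonelli1 _ _ _ _ R mu mu _ (measurable_hint mH) h0).
have E1 : hint H = \int[mu]_x \int[mu]_y hdens H (x, y) by exact: E0.
have E2 : \int[mu]_x \int[mu]_y hdens H (x, y) = \int[mu]_y \int[mu]_x hdens H (x, y).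
  exact: (@fubini_tonelli _ _ _ _ R mu mu _ (measurable_hint mH) h0).
rewrite E1 E2.
by apply: eq_integral => y _; apply: eq_integral => x _.
Qed.

Lemma hint_xy H : measurable_fun [set: R * R] H -> (forall p, 0 <= H p) ->
  hint H = \int[mu]_x \int[mu]_y hdens H (x, y).
Proof.
move=> mH H0; have h0 p := @hint_integrand_ge0 H p H0.
have E0 : hint H = \int[mu]_x fubini_F mu (hdens H) x.
  exact: (@fubini_tonelli1 _ _ _ _ R mu mu _ (measurable_hint mH) h0).
have E1 : hint H = \int[mu]_x \int[mu]_y hdens H (x, y) by exact: E0.
exact: E1.
Qed.

Lemma hint_translate (b : R) H : measurable_fun [set: R * R] H -> (forall p, 0 <= H p) ->
  hint (fun p => H (p.1 + b, p.2)%R) = hint H.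
Proof.
move=> mH H0.
have mT : measurable_fun [set: R * R] (fun p : R * R => (p.1 + b, p.2))%R.
  apply: measurable_fun_pair; last exact: measurable_snd.
  by apply: measurable_funD => //; exact: measurable_fst.
rewrite (hint_yx mH H0) (hint_yx (measurableT_comp mH mT) (fun p => H0 _)).
apply: eq_integral => y _; rewrite /hdens /=; have [y0|//] := boolP (0 < y)%R.
have mh : measurable_fun [set: R] (fun x => H (x, y) * (y ^- 2)%:E).
  apply: emeasurable_funM => //; exact: (measurable_fun_pair1 y mH).
have h0 x : 0 <= H (x, y) * (y ^- 2)%:E.
  by rewrite mule_ge0 // lee_fin invr_ge0 sqr_ge0.
rewrite (ge0_integral_affine b (oner_neq0 R) mh h0).
by apply: eq_integral => x _; rewrite mul1r normr1 mule1.
Qed.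

Lemma hint_scale (l : R) H : (0 < l)%R -> measurable_fun [set: R * R] H ->
  (forall p, 0 <= H p) -> hint (fun p => H (l * p.1, l * p.2)%R) = hint H.
Proof.
move=> l0 mH H0.
have mT : measurable_fun [set: R * R] (fun p : R * R => (l * p.1, l * p.2))%R.
  by apply: measurable_fun_pair; apply: measurable_funM.
have mG := measurable_hint mH.
have ln0 : (l != 0)%R by rewrite gt_eqF.
rewrite (hint_yx mH H0) (hint_yx (measurableT_comp mH mT) (fun p => H0 _)).
have h0 p := @hint_integrand_ge0 H p H0.
pose g y := \int[mu]_x hdens H (x, y).
have mg : measurable_fun [set: R] g.
  exact: (@measurable_fun_fubini_tonelli_G _ _ _ _ R mu _ mG h0).
have g0 y : 0 <= g y by apply: integral_ge0 => x _; exact: h0.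
rewrite -[RHS]/(\int[mu]_y g y) (ge0_integral_affine 0 ln0 mg g0).
apply: eq_integral => y _; rewrite addr0 /g.
have mx : measurable_fun [set: R] (fun x => hdens H (x, l * y)%R).
  exact: (measurable_fun_pair1 (l * y)%R mG).
rewrite (ge0_integral_affine 0 ln0 mx (fun x => h0 _)).
rewrite -ge0_integralZr //; last 2 first.
- apply: emeasurable_funM => //; apply: (measurableT_comp mx).
  by apply: measurable_funD => //; exact: measurable_funM.
- by move=> x _; rewrite mule_ge0.
apply: eq_integral => x _; rewrite addr0 /hdens /= pmulr_rgt0 //.
case: ifPn => y0; last by rewrite !mul0e.
rewrite -!muleA -!EFinM; congr (_ * _%:E).
by rewrite gtr0_norm //; field; rewrite ln0 gt_eqF.
Qed.

(* With [r = x^2 + y^2] the hyperbolic measure becomes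
   [dx dr / (2 (r - x^2)^(3/2))], and [z |-> -1/z] becomes
   [(x, r) |-> (- x / r, 1 / r)], linear in [x] for fixed [r]. *)
Lemma hint_inversion H : measurable_fun [set: R * R] H -> (forall p, 0 <= H p) ->
  hint (fun p => H (- p.1 / (p.1 ^+ 2 + p.2 ^+ 2), p.2 / (p.1 ^+ 2 + p.2 ^+ 2))%R) = hint H.
Proof.
move=> mH H0.
pose K (x r : R) : \bar R := if (x ^+ 2 < r)%R then
   H (x, Num.sqrt (r - x ^+ 2))%R * ((Num.sqrt (r - x ^+ 2) ^- 3) / 2)%R%:E else 0.
have K0 x r : 0 <= K x r.
  by rewrite /K; case: ifP => // _; rewrite mule_ge0 // lee_fin divr_ge0 // invr_ge0 exprn_ge0 // sqrtr_ge0.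
have mx2 : measurable_fun [set: R * R] (fun p : R * R => p.1 ^+ 2)%R.
  by apply: measurable_funX; exact: measurable_fst.
have mrx : measurable_fun [set: R * R] (fun p : R * R => Num.sqrt (p.2 - p.1 ^+ 2))%R.
  apply: (measurableT_comp (continuous_measurable_fun (@sqrt_continuous R))).
  by apply: measurable_funB => //; exact: measurable_snd.
have mK : measurable_fun [set: R * R] (fun p => K p.1 p.2).
  apply: measurable_fun_ifT => //.
    by apply: measurable_fun_ltr => //; exact: measurable_snd.
  apply: emeasurable_funM.
    apply: (measurableT_comp mH); apply: measurable_fun_pair => //; exact: measurable_fst.
  apply/measurable_EFinP; apply: measurable_funM => //.
  by apply: (measurableT_comp (@measurable_inv R)); exact: measurable_funX.
have S (x : R) (h : R -> \bar R) : measurable_fun [set: R] h -> (forall r, 0 <= h r) ->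
   (forall r, (r <= x ^+ 2)%R -> h r = 0) ->
   \int[mu]_r h r = \int[mu]_y (if (0 < y)%R then h (x ^+ 2 + y ^+ 2)%R * (2 * y)%:E else 0).
  move=> mh h0 hx.
  rewrite -(@ge0_integral_pos_sqr _ (fun t => h (x ^+ 2 + t)%R)) //; last first.
    by apply: (measurableT_comp mh); exact: measurable_funD.
  rewrite (ge0_integral_affine (x ^+ 2) (oner_neq0 R) mh h0).
  apply: eq_integral => t _; rewrite mul1r normr1 mule1 addrC; case: ltP => // t0.
  by rewrite hx // gerDl.
transitivity (\int[mu]_x \int[mu]_r K x r); last first.
  rewrite (hint_xy mH H0); apply: eq_integral => x _.
  have Kx r : (r <= x ^+ 2)%R -> K x r = 0 by move=> rx; rewrite /K ltNge rx.
  rewrite (S x (K x) (measurable_fun_pair2 x mK) (K0 x) Kx).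
  apply: eq_integral => y _; rewrite /hdens /=; case: ifPn => // y0.
  rewrite /K ltrDl exprn_gt0 // addrAC subrr add0r sqrtr_sqr gtr0_norm // -muleA -EFinM.
  by congr (_ * _%:E); field; rewrite gt_eqF.
(* After this exchange [x] is multiplied by [- r] at fixed [r], which gives [L]; a second exchange
   allows [r] to be inverted at fixed [x]. *)
have -> : \int[mu]_x \int[mu]_r K x r = \int[mu]_r \int[mu]_x K x r.
  exact: (@fubini_tonelli _ _ _ _ R mu mu (fun p => K p.1 p.2) mK (fun p => K0 _ _)).
pose L (x r : R) := if (0 < r)%R then K (- (x * r))%R r * r%:E else 0.
have L0 x r : 0 <= L x r by rewrite /L; case: ifP => // r0; rewrite mule_ge0 // lee_fin ltW.
have mL : measurable_fun [set: R * R] (fun p => L p.1 p.2).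
  apply: measurable_fun_ifT => //.
    by apply: measurable_fun_ltr => //; exact: measurable_snd.
  apply: emeasurable_funM; last by apply/measurable_EFinP; exact: measurable_snd.
  apply: (measurableT_comp mK (g := fun p : R * R => (- (p.1 * p.2), p.2)%R)).
  apply: measurable_fun_pair; last exact: measurable_snd.
  apply: measurable_funN; apply: measurable_funM; [exact: measurable_fst|exact: measurable_snd].
transitivity (\int[mu]_r \int[mu]_x L x r); last first.
  apply: eq_integral => r _; rewrite /L; case: ltP => r0; last first.
    rewrite integral0; apply/esym; rewrite -[RHS](integral0 mu setT).
    by apply: eq_integral => x _; rewrite /K ltNge (le_trans r0) ?sqr_ge0.
  have rn0 : (- r != 0)%R by rewrite oppr_eq0 gt_eqF.
  rewrite (ge0_integral_affine 0 rn0 (measurable_fun_pair1 r mK) (fun x => K0 x r)).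
  by apply: eq_integral => x _; rewrite addr0 mulNr [(r * x)%R]mulrC normrN gtr0_norm.
have <- : \int[mu]_x \int[mu]_r L x r = \int[mu]_r \int[mu]_x L x r.
  exact: (@fubini_tonelli _ _ _ _ R mu mu (fun p => L p.1 p.2) mL (fun p => L0 _ _)).
have mJ : measurable_fun [set: R * R] (fun p : R * R =>
    (- p.1 / (p.1 ^+ 2 + p.2 ^+ 2), p.2 / (p.1 ^+ 2 + p.2 ^+ 2))%R).
  have mi : measurable_fun [set: R * R] (fun p : R * R => (p.1 ^+ 2 + p.2 ^+ 2)^-1)%R.
    apply: (measurableT_comp (@measurable_inv R)); apply: measurable_funD => //.
    by apply: measurable_funX; exact: measurable_snd.
  apply: measurable_fun_pair; apply: measurable_funM => //.
  by apply: measurable_funN; exact: measurable_fst.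
rewrite (hint_xy (measurableT_comp mH mJ) (fun p => H0 _)).
apply: eq_integral => x _; rewrite /hdens /=.
rewrite [RHS](_ : _ = \int[mu]_r (if (0 < r)%R then K (- (x * r))%R r * r%:E else 0)) //.
have mKx : measurable_fun [set: R] (fun r => K (- (x * r))%R r * r%:E).
  apply: emeasurable_funM; last by apply/measurable_EFinP.
  apply: (measurableT_comp mK (g := fun r : R => (- (x * r), r)%R)).
  apply: measurable_fun_pair => //; apply: measurable_funN; exact: measurable_funM.
have Kp r : (0 < r)%R -> 0 <= K (- (x * r))%R r * r%:E.
  by move=> r0; rewrite mule_ge0 // lee_fin ltW.
rewrite (ge0_integral_pos_inv mKx Kp).
pose h := fun r : R => if (0 < r)%R then
   K (- (x * r^-1))%R (r^-1)%R * (r^-1)%R%:E * (r ^- 2)%:E else 0.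
rewrite -[RHS]/(\int[mu]_r h r).
have mh : measurable_fun [set: R] h.
  rewrite /h; apply: (@measurable_if0 R (fun r => K (- (x * r^-1))%R (r^-1)%R * (r^-1)%R%:E * (r ^- 2)%:E)).
  apply: emeasurable_funM.
    exact: (measurableT_comp mKx (@measurable_inv R)).
  by apply/measurable_EFinP; exact: measurable_inv_sqr.
have h0 r : 0 <= h r.
  rewrite /h; case: ifP => // r0; rewrite !mule_ge0 // lee_fin ?invr_ge0 ?sqr_ge0 //.
  exact: ltW.
have hx r : (r <= x ^+ 2)%R -> h r = 0.
  move=> rx; rewrite /h; case: ifP => // r0; rewrite /K.
  rewrite ifF ?mul0e //; apply/negbTE; rewrite -leNgt sqrrN exprMn exprVn.
  by rewrite ler_pdivlMr ?exprn_gt0 // expr2 mulrA mulVf ?mul1r // gt_eqF.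
rewrite (S x h mh h0 hx) /h.
apply: eq_integral => y _; case: ifPn => // y0.
have p0 : (0 < x ^+ 2 + y ^+ 2)%R by rewrite ltr_wpDl ?sqr_ge0 // exprn_gt0.
have y20 : (0 < y / (x ^+ 2 + y ^+ 2))%R by rewrite divr_gt0.
rewrite p0 /K.
have E : ((x ^+ 2 + y ^+ 2)^-1 - (- (x / (x ^+ 2 + y ^+ 2))) ^+ 2 = (y / (x ^+ 2 + y ^+ 2)) ^+ 2)%R.
  by field; rewrite gt_eqF.
rewrite -subr_gt0 E exprn_gt0 // sqrtr_sqr gtr0_norm // mulNr -!muleA -!EFinM.
congr (_ * _%:E); field; by rewrite !gt_eqF.
Qed.

End HyperbolicIntegral.

(** * Counting elements of discrete subgroups of SL2 *)

Section Matrix2.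
Variable R : realType.
Implicit Types M N : 'M[R]_2.

Lemma mx2_mulE M N i j : (M *m N) i j = M i 0 * N 0 j + M i 1 * N 1 j.
Proof.
by rewrite mxE big_ord_recl big_ord1; congr (_ + M i _ * N _ j); apply: val_inj.
Qed.

Lemma mx2P M N : M 0 0 = N 0 0 -> M 0 1 = N 0 1 -> M 1 0 = N 1 0 -> M 1 1 = N 1 1 ->
  M = N.
Proof.
move=> h1 h2 h3 h4; apply/matrixP => i j.
have E (k : 'I_2) : k = 0 \/ k = 1.
  by case: k => -[|[|//]] h; [left|right]; apply: val_inj.
by case: (E i) => ->; case: (E j) => ->.
Qed.

Definition mk2 (a b c d : R) : 'M[R]_2 :=
  \matrix_(i, j) (if i == 0 then if j == 0 then a else b else if j == 0 then c else d).

Lemma mk2E a b c d :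
  ((mk2 a b c d) 0 0 = a) * ((mk2 a b c d) 0 1 = b) *
  ((mk2 a b c d) 1 0 = c) * ((mk2 a b c d) 1 1 = d).
Proof. by rewrite !mxE. Qed.

Lemma det_mx2 M : \det M = M 0 0 * M 1 1 - M 0 1 * M 1 0.
Proof.
rewrite (expand_det_row _ 0) !big_ord_recl big_ord0 addr0.
rewrite /cofactor !det_mx11 !mxE /= expr0 mul1r expr1 mulN1r mulrN.
by congr (_ * M _ _ - M _ _ * M _ _); apply: val_inj.
Qed.

(** The squared Frobenius norm. It is kept squared to be polynomial in the entries; it is
    submultiplicative and, in determinant 1, invariant under inversion. *)
Definition n2 M : R := M 0 0 ^+ 2 + M 0 1 ^+ 2 + M 1 0 ^+ 2 + M 1 1 ^+ 2.

Lemma n2_ge0 M : 0 <= n2 M.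
Proof. by rewrite /n2 !addr_ge0 ?sqr_ge0. Qed.

Lemma n2_eq0 M : n2 M = 0 -> M = 0.
Proof.
rewrite /n2 => /eqP; rewrite !paddr_eq0 ?addr_ge0 ?sqr_ge0 // !sqrf_eq0.
by move=> /andP[/andP[/andP[/eqP h1 /eqP h2] /eqP h3] /eqP h4]; apply: mx2P; rewrite ?mxE.
Qed.

Lemma n2_gt0 M : M != 0 -> 0 < n2 M.
Proof.
move=> M0; rewrite lt_neqAle n2_ge0 andbT eq_sym; apply: contra M0 => /eqP.
by move/n2_eq0/eqP.
Qed.

Lemma n2M_le M N : n2 (M *m N) <= n2 M * n2 N.
Proof.
rewrite /n2 !mx2_mulE.
have CS (a b c d : R) : (a * c + b * d) ^+ 2 <= (a ^+ 2 + b ^+ 2) * (c ^+ 2 + d ^+ 2).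
  rewrite -subr_ge0.
  have -> : (a ^+ 2 + b ^+ 2) * (c ^+ 2 + d ^+ 2) - (a * c + b * d) ^+ 2 = (a * d - b * c) ^+ 2 by ring.
  exact: sqr_ge0.
have := CS (M 0 0) (M 0 1) (N 0 0) (N 1 0).
have := CS (M 0 0) (M 0 1) (N 0 1) (N 1 1).
have := CS (M 1 0) (M 1 1) (N 0 0) (N 1 0).
have := CS (M 1 0) (M 1 1) (N 0 1) (N 1 1).
set a := M 0 0; set b := M 0 1; set c := M 1 0; set d := M 1 1.
set p := N 0 0; set q := N 0 1; set r := N 1 0; set s := N 1 1.
move=> h1 h2 h3 h4.
apply: le_trans (lerD (lerD (lerD h4 h3) h2) h1) _.
by rewrite le_eqVlt; apply/orP; left; apply/eqP; ring.
Qed.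

Lemma n2D_le M N : n2 (M + N) <= 2 * (n2 M + n2 N).
Proof.
have S (a b : R) : (a + b) ^+ 2 <= 2 * (a ^+ 2 + b ^+ 2).
  rewrite -subr_ge0.
  have -> : 2 * (a ^+ 2 + b ^+ 2) - (a + b) ^+ 2 = (a - b) ^+ 2 by ring.
  exact: sqr_ge0.
rewrite /n2 !mxE.
have := S (M 0 0) (N 0 0); have := S (M 0 1) (N 0 1).
have := S (M 1 0) (N 1 0); have := S (M 1 1) (N 1 1) => h1 h2 h3 h4.
apply: le_trans (lerD (lerD (lerD h4 h3) h2) h1) _.
by rewrite le_eqVlt; apply/orP; left; apply/eqP; ring.
Qed.

Lemma n2N M : n2 (- M) = n2 M.
Proof. by rewrite /n2 !mxE !sqrrN. Qed.

Lemma n2B_le M N : n2 (M - N) <= 2 * (n2 M + n2 N).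
Proof. by rewrite -(n2N N) n2D_le. Qed.

Lemma n2_1 : n2 1%:M = 2.
Proof. by rewrite /n2 !mxE /= !expr1n !expr0n /= !addr0. Qed.

Definition adj2 M := mk2 (M 1 1) (- M 0 1) (- M 1 0) (M 0 0).

Lemma n2_adj M : n2 (adj2 M) = n2 M.
Proof. by rewrite /n2 /adj2 !mk2E; ring. Qed.

Lemma mul_adj2 M : \det M = 1 -> M *m adj2 M = 1%:M.
Proof.
rewrite det_mx2 => D; apply: mx2P; rewrite mx2_mulE /adj2 !mk2E !mxE /= ?mulr1n ?mulr0n -?D; ring.
Qed.

Lemma invmx_adj2 M : \det M = 1 -> invmx M = adj2 M.
Proof.
move=> D; have U : M \in unitmx by rewrite unitmxE D unitr1.
by rewrite -[RHS](mulKmx U) mul_adj2 // mulmx1.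
Qed.

Lemma n2_inv M : \det M = 1 -> n2 (invmx M) = n2 M.
Proof. by move=> D; rewrite invmx_adj2 // n2_adj. Qed.

Lemma n2_near1 M : n2 (M - 1%:M) <= 1 / 100 -> n2 M <= 5.
Proof.
move=> h; rewrite -[M](subrK 1%:M); apply: le_trans (n2D_le _ _) _.
by rewrite n2_1; move: h; move: (n2 _) => x; lra.
Qed.

(** The commutator minus 1 is the bracket of [M - 1] and [N - 1] times [M^-1 N^-1]. The bracket
    costs a factor [4] and the two inverses [5 * 5], so the bound is [n2 (M - 1)] times
    [100 * n2 (N - 1)]: this is the origin of [1 / 100]. *)
Lemma n2_commutator M N : \det M = 1 -> \det N = 1 ->
  n2 (M - 1%:M) <= 1 / 100 -> n2 (N - 1%:M) < 1 / 100 -> M != 1%:M ->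
  n2 (M *m N *m invmx M *m invmx N - 1%:M) < n2 (M - 1%:M).
Proof.
move=> DM DN hM hN M1.
have UM : M \in unitmx by rewrite unitmxE DM unitr1.
have UN : N \in unitmx by rewrite unitmxE DN unitr1.
have -> : M *m N *m invmx M *m invmx N - 1%:M =
   ((M - 1%:M) *m (N - 1%:M) - (N - 1%:M) *m (M - 1%:M)) *m (invmx M *m invmx N).
  have -> : (M - 1%:M) *m (N - 1%:M) - (N - 1%:M) *m (M - 1%:M) = M *m N - N *m M.
    rewrite !mulmxBl !mulmxBr !mul1mx !mulmx1; apply/matrixP => i j; rewrite !mxE; ring.
  by rewrite mulmxBl !mulmxA -[N *m M *m _](mulmxA N) (mulmxV UM) mulmx1 (mulmxV UN).
set P := M - 1%:M in hM *; set Q := N - 1%:M in hN *.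
have P0 : 0 < n2 P by rewrite n2_gt0 // subr_eq0.
have Q0 := n2_ge0 Q; have M5 := n2_near1 hM; have N5 := n2_near1 (ltW hN).
apply: le_lt_trans (n2M_le _ _) _.
have h1 : n2 (P *m Q - Q *m P) <= 4 * (n2 P * n2 Q).
  apply: le_trans (n2B_le _ _) _.
  have := n2M_le P Q; have := n2M_le Q P; rewrite [n2 Q * _]mulrC.
  move: (n2 (P *m Q)) (n2 (Q *m P)) (n2 P * n2 Q) => x y z; lra.
have h2 : n2 (invmx M *m invmx N) <= 25.
  apply: le_trans (n2M_le _ _) _; rewrite !n2_inv //.
  have -> : 25 = 5 * 5 :> R by ring.
  by apply: ler_pM => //; exact: n2_ge0.
apply: le_lt_trans (ler_pM (n2_ge0 _) (n2_ge0 _) h1 h2) _.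
have -> : 4 * (n2 P * n2 Q) * 25 = n2 P * (100 * n2 Q) by ring.
rewrite gtr_pMr //; move: hN; move: (n2 Q) => x; lra.
Qed.

(** Commuting with [X] means that the vector of [A 0 1], [A 1 0], [A 0 0 - A 1 1] is proportional to
    that of [X], which is nonzero as [X] is not scalar. The vectors of [A] and [B] are then
    parallel, which is what [f1], [f2], [f3] say. *)
Lemma mx2_centralizer_abelian (X A B : 'M[R]_2) : (forall k : R, X != k%:M) ->
  X *m A = A *m X -> X *m B = B *m X -> A *m B = B *m A.
Proof.
move=> Xs /matrixP XA /matrixP XB.
have := XA 0 0; have := XA 0 1; have := XA 1 0.
have := XB 0 0; have := XB 0 1; have := XB 1 0.
rewrite !mx2_mulE.
have : X 0 1 != 0 \/ X 1 0 != 0 \/ X 0 0 - X 1 1 != 0.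
  have [x1|] := eqVneq (X 0 1) 0; last by left.
  have [x2|] := eqVneq (X 1 0) 0; last by right; left.
  have [x3|] := eqVneq (X 0 0 - X 1 1) 0; last by right; right.
  exfalso; move: (Xs (X 0 0)); apply/negP; rewrite negbK; apply/eqP.
  apply: mx2P; rewrite !mxE /= ?mulr1n ?mulr0n //.
  by apply/esym/eqP; rewrite -subr_eq0 x3.
set a := A 0 0; set b := A 0 1; set c := A 1 0; set d := A 1 1.
set p := B 0 0; set q := B 0 1; set r := B 1 0; set s := B 1 1.
set x := X 0 0; set y := X 0 1; set z := X 1 0; set w := X 1 1.
move=> nz h3 h2 h1 k3 k2 k1.
have e1 : y * c - b * z = 0 by move: k1; lra.
have e2 : y * r - q * z = 0 by move: h1; lra.
have e3 : (x - w) * b - y * (a - d) = 0 by move: k2; lra.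
have e4 : (x - w) * q - y * (p - s) = 0 by move: h2; lra.
have e5 : (x - w) * c - z * (a - d) = 0 by move: k3; lra.
have e6 : (x - w) * r - z * (p - s) = 0 by move: h3; lra.
have f1 : b * r - c * q = 0.
  case: nz => [|[|]] n0; apply: (mulfI n0); rewrite mulr0.
  - have -> : y * (b * r - c * q) = b * (y * r - q * z) - q * (y * c - b * z) by ring.
    by rewrite e1 e2; ring.
  - have -> : z * (b * r - c * q) = c * (y * r - q * z) - r * (y * c - b * z) by ring.
    by rewrite e1 e2; ring.
  - have -> : (x - w) * (b * r - c * q) =
       r * ((x - w) * b - y * (a - d)) - q * ((x - w) * c - z * (a - d)) + (a - d) * (y * r - q * z) by ring.
    by rewrite e2 e3 e5; ring.
have f2 : b * (p - s) - q * (a - d) = 0.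
  case: nz => [|[|]] n0; apply: (mulfI n0); rewrite mulr0.
  - have -> : y * (b * (p - s) - q * (a - d)) =
       q * ((x - w) * b - y * (a - d)) - b * ((x - w) * q - y * (p - s)) by ring.
    by rewrite e3 e4; ring.
  - have -> : z * (b * (p - s) - q * (a - d)) =
       q * ((x - w) * c - z * (a - d)) - b * ((x - w) * r - z * (p - s)) + (x - w) * (b * r - c * q) by ring.
    by rewrite e5 e6 f1; ring.
  - have -> : (x - w) * (b * (p - s) - q * (a - d)) =
       (p - s) * ((x - w) * b - y * (a - d)) - (a - d) * ((x - w) * q - y * (p - s)) by ring.
    by rewrite e3 e4; ring.
have f3 : c * (p - s) - r * (a - d) = 0.
  case: nz => [|[|]] n0; apply: (mulfI n0); rewrite mulr0.
  - have -> : y * (c * (p - s) - r * (a - d)) =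
       r * ((x - w) * b - y * (a - d)) - c * ((x - w) * q - y * (p - s)) - (x - w) * (b * r - c * q) by ring.
    by rewrite e3 e4 f1; ring.
  - have -> : z * (c * (p - s) - r * (a - d)) =
       r * ((x - w) * c - z * (a - d)) - c * ((x - w) * r - z * (p - s)) by ring.
    by rewrite e5 e6; ring.
  - have -> : (x - w) * (c * (p - s) - r * (a - d)) =
       (p - s) * ((x - w) * c - z * (a - d)) - (a - d) * ((x - w) * r - z * (p - s)) by ring.
    by rewrite e5 e6; ring.
apply: mx2P; rewrite !mx2_mulE -/a -/b -/c -/d -/p -/q -/r -/s; move: f1 f2 f3; lra.
Qed.

End Matrix2.

(** * Moebius transformations and displacement *)

Section Moebius.
Variable R : realType.
Implicit Types (A B : SL2 R) (z w : UHP R) (M : 'M[R]_2).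

Lemma mkUHP_subproof (x y : R) : 0 < y ->
  (x +i* y)%C \in [set z : (R[i])^o | 0 < complex.Im z].
Proof. by move=> y0; apply/mem_set. Qed.

Definition mkUHP (x y : R) (y0 : 0 < y) : UHP R := SigSub (mkUHP_subproof x y0).

Lemma UHP_ext z w : reH z = reH w -> imH z = imH w -> z = w.
Proof.
rewrite /reH /imH => h1 h2; apply: val_inj.
by apply/eqP; rewrite eq_complex h1 h2 !eqxx.
Qed.

Lemma val_UHP z : val z = (reH z +i* imH z)%C :> R[i].
Proof. by rewrite /reH /imH; case: (val z : R[i]). Qed.

Lemma SL2_ext A B : val A 0 0 = val B 0 0 -> val A 0 1 = val B 0 1 ->
  val A 1 0 = val B 1 0 -> val A 1 1 = val B 1 1 -> A = B.
Proof. by move=> *; apply: val_inj; apply: mx2P. Qed.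

Lemma mkSL2_subproof (a b c d : R) : a * d - b * c = 1 ->
  mk2 a b c d \in [set A : 'M[R]_2 | \det A = 1].
Proof. by move=> D; apply/mem_set; rewrite /= det_mx2 !mk2E. Qed.

Definition mkSL2 (a b c d : R) (D : a * d - b * c = 1) : SL2 R := SigSub (mkSL2_subproof D).

Definition den A z : R := (val A 1 0 * reH z + val A 1 1) ^+ 2 + (val A 1 0 * imH z) ^+ 2.

Lemma nc_automorphy A z : nc (automorphy A z) ^+ 2 = den A z.
Proof. by rewrite nc_sqr automorphyE. Qed.

Lemma automorphy_neq0 A z : automorphy A z != 0.
Proof.
rewrite automorphyE eq_complex /=; apply/negP => /andP[/eqP h1 /eqP h2].
have c0 : val A 1 0 = 0.
  by move/eqP: h2; rewrite mulf_eq0 (gt_eqF (imH_gt0 z)) orbF => /eqP.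
have := SL2_det2 A; move: h1; rewrite c0 mul0r add0r => ->.
by rewrite !mulr0 subr0 => /eqP; rewrite eq_sym oner_eq0.
Qed.

Lemma den_gt0 A z : 0 < den A z.
Proof. by rewrite -nc_automorphy exprn_gt0 // nc_gt0 automorphy_neq0. Qed.

Lemma val_mobius A z : val (mobius A z) =
  ((val A 0 0)%:C%C * val z + (val A 0 1)%:C%C) / automorphy A z :> R[i].
Proof. by []. Qed.

Lemma mobius_re A z : reH (mobius A z) =
  ((val A 0 0 * reH z + val A 0 1) * (val A 1 0 * reH z + val A 1 1)
    + val A 0 0 * val A 1 0 * imH z ^+ 2) / den A z.
Proof.
rewrite {1}/reH val_mobius val_UHP automorphyE /den.
have := den_gt0 A z; rewrite /den.
move: (val A 0 0) (val A 0 1) (val A 1 0) (val A 1 1) (reH z) (imH z) => a b c d x y n0.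
by rewrite /= !mul0r !addr0 !subr0; field; rewrite gt_eqF.
Qed.

Lemma mobius_im A z : imH (mobius A z) = imH z / den A z.
Proof.
rewrite {1}/imH val_mobius val_UHP automorphyE /den.
have := den_gt0 A z; have := SL2_det2 A; rewrite /den.
move: (val A 0 0) (val A 0 1) (val A 1 0) (val A 1 1) (reH z) (imH z) => a b c d x y D n0.
rewrite /= !mul0r !addr0 !subr0 ?add0r.
have -> : y / ((c * x + d) ^+ 2 + (c * y) ^+ 2) = y * (a * d - b * c) / ((c * x + d) ^+ 2 + (c * y) ^+ 2).
  by rewrite D mulr1.
by field; rewrite gt_eqF.
Qed.

Lemma val_SL2ME A B :
  (val (A * B)%g 0 0 = val A 0 0 * val B 0 0 + val A 0 1 * val B 1 0) *
  (val (A * B)%g 0 1 = val A 0 0 * val B 0 1 + val A 0 1 * val B 1 1) *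
  (val (A * B)%g 1 0 = val A 1 0 * val B 0 0 + val A 1 1 * val B 1 0) *
  (val (A * B)%g 1 1 = val A 1 0 * val B 0 1 + val A 1 1 * val B 1 1).
Proof. by rewrite !val_SL2M !mx2_mulE. Qed.

Lemma val_SL2VE A :
  (val (A^-1)%g 0 0 = val A 1 1) * (val (A^-1)%g 0 1 = - val A 0 1) *
  (val (A^-1)%g 1 0 = - val A 1 0) * (val (A^-1)%g 1 1 = val A 0 0).
Proof. by rewrite !val_SL2V invmx_adj2 ?SL2_det // /adj2 !mk2E. Qed.

Lemma realC_M (x y : R) : ((x * y)%:C)%C = (x%:C)%C * (y%:C)%C :> R[i].
Proof. exact: rmorphM. Qed.
Lemma realC_D (x y : R) : ((x + y)%:C)%C = (x%:C)%C + (y%:C)%C :> R[i].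
Proof. exact: rmorphD. Qed.

Lemma automorphyM A B z :
  automorphy (A * B)%g z = automorphy A (mobius B z) * automorphy B z.
Proof.
have n0 := automorphy_neq0 B z.
rewrite /automorphy val_mobius !val_SL2ME !realC_D !realC_M.
move: n0; rewrite /automorphy => n0; field; exact: n0.
Qed.

Lemma mobiusM A B z : mobius (A * B)%g z = mobius A (mobius B z).
Proof.
apply: val_inj; rewrite [LHS]val_mobius [RHS]val_mobius automorphyM.
have n0 := automorphy_neq0 B z; have n1 := automorphy_neq0 A (mobius B z).
move: n1; set j := automorphy A _ => n1.
rewrite val_mobius !val_SL2ME !realC_D !realC_M.
move: n0; rewrite /automorphy => n0; field; exact/andP.
Qed.

Lemma mobius1 z : mobius 1%g z = z.
Proof.
have d1 : den 1%g z = 1 by rewrite /den val_SL21 !mxE /= ?mulr1n ?mulr0n; ring.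
apply: UHP_ext; rewrite ?mobius_re ?mobius_im d1 divr1 //.
by rewrite val_SL21 !mxE /= ?mulr1n ?mulr0n; ring.
Qed.

Lemma mobiusK A : cancel (mobius A) (mobius A^-1)%g.
Proof. by move=> z; rewrite -mobiusM mulVg mobius1. Qed.

Lemma mobiusVK A : cancel (mobius A^-1)%g (mobius A).
Proof. by move=> z; rewrite -mobiusM mulgV mobius1. Qed.

(* [1 + 2 ud z w] is the hyperbolic cosine of the distance between [z] and [w]. *)
Definition ud z w : R := nc (val z - val w) ^+ 2 / (4 * imH z * imH w).

Lemma ud_ge0 z w : 0 <= ud z w.
Proof. by rewrite divr_ge0 ?sqr_ge0 // !mulr_ge0 // ltW // imH_gt0. Qed.

Lemma udC z w : ud z w = ud w z.
Proof. by rewrite /ud nc_subC -!mulrA [imH z * _]mulrC. Qed.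

Lemma udE z w : ud z w =
  ((reH z - reH w) ^+ 2 + (imH z - imH w) ^+ 2) / (4 * imH z * imH w).
Proof. by rewrite /ud nc_sqr !val_UHP ReD ImD ReN ImN. Qed.

Lemma ud_mobius A z w : ud (mobius A z) (mobius A w) = ud z w.
Proof.
have nz := automorphy_neq0 A z; have nw := automorphy_neq0 A w.
have E : val (mobius A z) - val (mobius A w) =
   (val z - val w) / (automorphy A z * automorphy A w) :> R[i].
  rewrite !val_mobius.
  have D : (val A 0 0)%:C%C * (val A 1 1)%:C%C - (val A 0 1)%:C%C * (val A 1 0)%:C%C = 1 :> R[i].
    by rewrite -!realC_M -(rmorphB (real_complex R)) (SL2_det2 A).
  move: D nz nw; rewrite /automorphy.
  move: (val A 0 0)%:C%C (val A 0 1)%:C%C (val A 1 0)%:C%C (val A 1 1)%:C%C (val z : R[i]) (val w : R[i]).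
  move=> a b c d Z W D nz nw.
  transitivity ((a * d - b * c) * (Z - W) / ((c * Z + d) * (c * W + d))).
    by field; exact/andP.
  by rewrite D mul1r.
rewrite /ud E !mobius_im Normc.normcM Normc.normcV Normc.normcM.
rewrite exprMn exprVn exprMn !nc_automorphy.
have := den_gt0 A z; have := den_gt0 A w; have := imH_gt0 z; have := imH_gt0 w.
move: (den A z) (den A w) (imH z) (imH w) (nc _) => p q r s t s0 r0 q0 p0.
by field; rewrite !gt_eqF.
Qed.

(* Conjugation by [z |-> imH w z + reH w] moves the base point [w] to [i]. *)
Definition cjm w M : 'M[R]_2 :=
  mk2 (imH w)^-1 (- reH w / imH w) 0 1 *m M *m mk2 (imH w) (reH w) 0 1.

Definition cj w A := cjm w (val A).

Let GK w : mk2 (imH w) (reH w) 0 1 *m mk2 (imH w)^-1 (- reH w / imH w) 0 1 = 1%:M.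
Proof.
have y0 := imH_gt0 w.
by apply: mx2P; rewrite mx2_mulE !mk2E !mxE /= ?mulr1n ?mulr0n; field; rewrite ?gt_eqF.
Qed.

Let KG w : mk2 (imH w)^-1 (- reH w / imH w) 0 1 *m mk2 (imH w) (reH w) 0 1 = 1%:M.
Proof.
have y0 := imH_gt0 w.
by apply: mx2P; rewrite mx2_mulE !mk2E !mxE /= ?mulr1n ?mulr0n; field; rewrite ?gt_eqF.
Qed.

Lemma cjmM w M N : cjm w (M *m N) = cjm w M *m cjm w N.
Proof.
rewrite /cjm.
set G := mk2 _ _ _ _; set K := mk2 (imH w) (reH w) 0 1.
rewrite !mulmxA -[G *m M *m K *m G]mulmxA GK mulmx1 //.
Qed.

Lemma cjm1 w : cjm w 1%:M = 1%:M.
Proof. by rewrite /cjm mulmx1 KG. Qed.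

Lemma cjmB w M N : cjm w (M - N) = cjm w M - cjm w N.
Proof. by rewrite /cjm mulmxBr mulmxBl. Qed.

Lemma cjmD w M N : cjm w (M + N) = cjm w M + cjm w N.
Proof. by rewrite /cjm mulmxDr mulmxDl. Qed.

Lemma cjmZ w (k : R) M : cjm w (k *: M) = k *: cjm w M.
Proof. by rewrite /cjm -scalemxAr -scalemxAl. Qed.

Lemma cjm_inj w : injective (cjm w).
Proof.
move=> M N /(congr1 (fun X => mk2 (imH w) (reH w) 0 1 *m X *m mk2 (imH w)^-1 (- reH w / imH w) 0 1)).
by rewrite /cjm !mulmxA GK !mul1mx -!mulmxA GK !mulmx1.
Qed.

Lemma cjmE w M :
  (cjm w M 0 0 = M 0 0 - reH w * M 1 0) *
  (cjm w M 0 1 = (M 0 1 + M 0 0 * reH w - reH w * (M 1 0 * reH w + M 1 1)) / imH w) *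
  (cjm w M 1 0 = M 1 0 * imH w) * (cjm w M 1 1 = M 1 0 * reH w + M 1 1).
Proof.
have y0 := imH_gt0 w.
by rewrite /cjm !mx2_mulE !mk2E; do ![split]; field; rewrite ?gt_eqF.
Qed.

Lemma det_cj w A : \det (cj w A) = 1.
Proof.
have y0 := imH_gt0 w; rewrite -(SL2_det2 A) det_mx2 /cj !cjmE.
by field; rewrite gt_eqF.
Qed.

Lemma cjM w A B : cj w (A * B)%g = cj w A *m cj w B.
Proof. by rewrite /cj val_SL2M cjmM. Qed.

Lemma cj1 w : cj w 1%g = 1%:M. Proof. by rewrite /cj val_SL21 cjm1. Qed.

Lemma cj_unit w A : cj w A \in unitmx.
Proof. by rewrite unitmxE det_cj unitr1. Qed.

Lemma cjV w A : cj w A^-1%g = invmx (cj w A).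
Proof.
by rewrite -[LHS](mulKmx (cj_unit w A)) -cjM mulgV cj1 mulmx1.
Qed.

Lemma cj_inj w : injective (cj w).
Proof. by move=> A B /cjm_inj /val_inj. Qed.

Definition tr2 A : R := val A 0 0 + val A 1 1.

Lemma tr_cj w A : cj w A 0 0 + cj w A 1 1 = tr2 A.
Proof. by rewrite /cj !cjmE /tr2; ring. Qed.

(** The right side is [2 cosh] of the distance from [w] to its image, so bounding the matrix
    conjugated to the base point [w] amounts to bounding the displacement of [w]. *)
Lemma n2_cj w A : n2 (cj w A) = 2 + 4 * ud (mobius A w) w.
Proof.
have y0 := imH_gt0 w; have q0 := den_gt0 A w.
rewrite udE mobius_re mobius_im /n2 /cj !cjmE.
have D := SL2_det2 A; move: q0; rewrite /den.
move: (val A 0 0) (val A 0 1) (val A 1 0) (val A 1 1) (reH w) (imH w) y0 D => a b c d x y y0 D q0.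
pose P := (a * x + b) * (c * x + d) + a * c * y ^+ 2; rewrite -/P.
pose q := (c * x + d) ^+ 2 + (c * y) ^+ 2; rewrite -/q in q0 *.
(* [P + i y] is [a w + b] times the conjugate of [c w + d]; the determinant enters through the
   imaginary part. *)
have E1 : P ^+ 2 + y ^+ 2 = q * ((a * x + b) ^+ 2 + a ^+ 2 * y ^+ 2).
  have -> : P ^+ 2 + y ^+ 2 = P ^+ 2 + y ^+ 2 * (a * d - b * c) ^+ 2 by rewrite D expr1n mulr1.
  by rewrite /P /q; ring.
transitivity (((P ^+ 2 + y ^+ 2) / q - 2 * x * P + q * (x ^+ 2 + y ^+ 2)) / y ^+ 2).
  rewrite E1 mulrAC divff ?gt_eqF // mul1r /P /q.
  by field; rewrite gt_eqF.
by field; rewrite !gt_eqF.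
Qed.

Lemma n2_sub1 M : n2 (M - 1%:M) = n2 M - 2 * (M 0 0 + M 1 1) + 2.
Proof. by rewrite /n2 !mxE /= ?mulr1n ?mulr0n; ring. Qed.

Lemma tr2_conj A B : tr2 (B^-1 * A * B)%g = tr2 A.
Proof.
rewrite /tr2 !val_SL2ME !val_SL2VE; have := SL2_det2 B.
move: (val B 0 0) (val B 0 1) (val B 1 0) (val B 1 1) => p q r s D.
move: (val A 0 0) (val A 0 1) (val A 1 0) (val A 1 1) => a b c d.
transitivity ((a + d) * (p * s - q * r)); last by rewrite D mulr1.
ring.
Qed.

(* If the distance is moderate, so is the ratio of the heights; this gives a
   weak triangle inequality for [ud]. *)
Lemma ud_im_ratio z w : ud z w <= 1 -> imH z <= 6 * imH w.
Proof.
have z0 := imH_gt0 z; have w0 := imH_gt0 w.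
rewrite udE ler_pdivrMr ?mulr_gt0 // mul1r => h.
have : (imH z - imH w) ^+ 2 <= 4 * imH z * imH w.
  by apply: le_trans h; rewrite lerDr sqr_ge0.
move: (imH z) (imH w) z0 w0 => a b a0 b0 {}h; rewrite leNgt; apply/negP => ab; nra.
Qed.

Lemma ud_triangle x z w : ud x z <= 1 -> ud z w <= 1 -> ud x w <= 12 * (ud x z + ud z w).
Proof.
move=> h1 h2; have := ud_im_ratio h2; have h1' := h1; rewrite udC in h1'.
have := ud_im_ratio h1'.
have x0 := imH_gt0 x; have z0 := imH_gt0 z; have w0 := imH_gt0 w.
rewrite /ud => r1 r2.
have P : nc (val x - val w) ^+ 2 <= 2 * (nc (val x - val z) ^+ 2 + nc (val z - val w) ^+ 2).
  have T := nc_dist_triangle (val z) (val x : R[i]) (val w).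
  have T0 := nc_ge0 (val x - val w : R[i]).
  have Q : nc (val x - val w) ^+ 2 <= (nc (val x - val z) + nc (val z - val w)) ^+ 2.
    by rewrite ler_pXn2r // nnegrE // addr_ge0 ?nc_ge0.
  apply: le_trans Q _; rewrite -subr_ge0.
  set a := nc _; set b := nc _.
  have -> : 2 * (a ^+ 2 + b ^+ 2) - (a + b) ^+ 2 = (a - b) ^+ 2 by ring.
  exact: sqr_ge0.
move: P; set p := nc (val x - val z) ^+ 2; set q := nc (val z - val w) ^+ 2.
have p0 : 0 <= p by exact: sqr_ge0.
have q0 : 0 <= q by exact: sqr_ge0.
move: (nc _ ^+ 2) p q p0 q0 => r p q p0 q0 P.
move: (imH x) (imH z) (imH w) x0 z0 w0 r1 r2 => a b c a0 b0 c0 r1 r2.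
rewrite ler_pdivrMr ?mulr_gt0 //; apply: le_trans P _.
have -> : 12 * (p / (4 * a * b) + q / (4 * b * c)) * (4 * a * c) = 2 * (p * (6 * c / b) + q * (6 * a / b)).
  by field; rewrite !gt_eqF.
rewrite ler_pM2l //; apply: lerD; rewrite ler_peMr // ler_pdivlMr // mul1r //.
Qed.

End Moebius.

(** * Cardinality bounds *)

Section Counting.

(** Counting by duplicate-free sequences presupposes no finiteness of [S], and the bounds pass along
    injections and finitely many fibers. *)
Definition atmost (T : eqType) (S : set T) (N : nat) :=
  forall s : seq T, uniq s -> (forall x, x \in s -> S x) -> (size s <= N)%N.

Lemma atmostS (T : eqType) (S S' : set T) N : S `<=` S' -> atmost S' N -> atmost S N.
Proof. by move=> SS H s us sS; apply: H => // x /sS /SS. Qed.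

Lemma atmost_le (T : eqType) (S : set T) N N' : (N <= N')%N -> atmost S N -> atmost S N'.
Proof. by move=> NN H s us sS; apply: leq_trans NN; apply: H. Qed.

Lemma atmost_inj (T U : eqType) (f : T -> U) (S : set T) (S' : set U) N :
  injective f -> (forall x, S x -> S' (f x)) -> atmost S' N -> atmost S N.
Proof.
move=> fi SS H s us sS; rewrite -(size_map f); apply: H; first by rewrite map_inj_uniq.
by move=> _ /mapP[x /sS/SS Sx ->].
Qed.

Lemma atmost_fibers (T : eqType) (U : finType) (c : T -> U) (S : set T) n :
  (forall u, atmost [set x | S x /\ c x = u] n) -> atmost S (#|U| * n).
Proof.
move=> H s us sS.
have -> : size s = (\sum_(u : U) count (fun x => c x == u) s)%N.
  elim: s {us sS} => [|x s IH] /=; first by rewrite big1.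
  rewrite big_split /= -IH -add1n; congr (_ + _)%N.
  rewrite (bigD1 (c x)) //= eqxx big1 ?addn0 // => u.
  by rewrite eq_sym => /negbTE ->.
apply: leq_trans (_ : (\sum_(u : U) n <= _)%N); last by rewrite sum_nat_const.
apply: leq_sum => u _; rewrite -size_filter; apply: (H u); first exact: filter_uniq.
by move=> x; rewrite mem_filter => /andP[/eqP cx /sS Sx]; split.
Qed.

Lemma atmost_enum (T : eqType) (S : set T) N : atmost S N ->
  exists2 s : seq T, uniq s & forall x, S x <-> x \in s.
Proof.
move=> H.
have [n /asboolP[s [us sS sn]] max] : exists2 n,
   `[< exists s : seq T, [/\ uniq s, (forall x, x \in s -> S x) & size s = n] >] &
   forall m, `[< exists s : seq T, [/\ uniq s, (forall x, x \in s -> S x) & size s = m] >] -> (m <= n)%N.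
  have ex : exists n, `[< exists s : seq T, [/\ uniq s, (forall x, x \in s -> S x) & size s = n] >].
    by exists 0%N; apply/asboolP; exists [::].
  have bd m : `[< exists s : seq T, [/\ uniq s, (forall x, x \in s -> S x) & size s = m] >] -> (m <= N)%N.
    by move=> /asboolP[s [us sS <-]]; exact: H.
  by case: (ex_maxnP ex bd) => n Pn Hn; exists n.
exists s => // x; split; last exact: sS.
move=> Sx; apply/negPn/negP => xs.
have /max : `[< exists s0 : seq T, [/\ uniq s0, (forall x0, x0 \in s0 -> S x0) & size s0 = n.+1] >].
  apply/asboolP; exists (x :: s); split => /=; rewrite ?xs ?sn //.
  by move=> y; rewrite inE => /orP[/eqP ->|/sS].
by rewrite ltnn.
Qed.

Lemma seq_min (T : eqType) (R : realDomainType) (f : T -> R) (s : seq T) : s != [::] ->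
  exists2 x, x \in s & forall y, y \in s -> f x <= f y.
Proof.
elim: s => // a s IH _; have [s0|/IH[x xs xm]] := eqVneq s [::].
  by exists a; rewrite ?mem_head // => y; rewrite s0 inE => /eqP ->.
have [fax|fxa] := leP (f a) (f x).
  exists a; rewrite ?mem_head // => y; rewrite inE => /orP[/eqP -> //|/xm].
  exact: le_trans.
exists x; first by rewrite inE xs orbT.
by move=> y; rewrite inE => /orP[/eqP ->|/xm //]; exact: ltW.
Qed.

End Counting.

(** * Discrete subgroups near the identity *)

Section DiscreteGroups.
Local Open Scope quotient_scope.
Variable R : realType.
Implicit Types (A B : SL2 R) (z w : UHP R) (M : 'M[R]_2) (H : set (SL2 R)).

(** The pigeonhole principle takes the place of compactness: the entries are rounded to a grid of
    width [h], and two bounded matrices with the same rounding differ by at most [4 * h ^+ 2] in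
    [n2]. *)
Lemma grid (C e : R) : 0 < e -> exists (T : finType) (cell : 'M[R]_2 -> T),
  forall M N : 'M[R]_2, n2 M <= C -> n2 N <= C -> cell M = cell N -> n2 (M - N) < e.
Proof.
move=> e0; pose h := Num.min 1 (e / 8).
have h0 : 0 < h by rewrite lt_min ltr01 divr_gt0.
have h4 : 4 * h ^+ 2 < e.
  have : h <= e / 8 by rewrite /h ge_min lexx orbT.
  have : h <= 1 by rewrite /h ge_min lexx.
  move: h0; move: (h) => x; nra.
pose c := `|C| + 1.
pose m := Num.trunc (2 * c / h).
pose k (a : R) : 'I_m.+1 := inord (Num.trunc ((a + c) / h)).
have kP a b : a ^+ 2 <= C -> b ^+ 2 <= C -> k a = k b -> (a - b) ^+ 2 <= h ^+ 2.
  move=> aC bC.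
  have bd x : x ^+ 2 <= C -> 0 <= (x + c) / h /\ (Num.trunc ((x + c) / h) < m.+1)%N.
    move=> xC.
    have : x ^+ 2 <= c ^+ 2.
      apply: le_trans xC _; apply: le_trans (ler_norm C) _; rewrite /c.
      have := normr_ge0 C; move: (`|C|) => t t0; nra.
    have c0 : 0 <= c by rewrite /c addr_ge0.
    move=> x2; have /andP[x3 x4] : - c <= x <= c.
      by rewrite -ler_norml -(ger0_norm c0) -ler_sqr ?nnegrE // !real_normK ?num_real.
    split; first by rewrite divr_ge0 ?(ltW h0) //; lra.
    rewrite ltnS; apply: le_truncn.
    by rewrite ler_pM2r ?invr_gt0 //; lra.
  have [a0 am] := bd _ aC; have [b0 bm] := bd _ bC.
  move=> /(congr1 (@nat_of_ord _)); rewrite /k !inordK // => ab.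
  have /andP[a1 a2] := truncn_itv a0; have /andP[b1 b2] := truncn_itv b0.
  rewrite ab in a1 a2; move: a1 a2 b1 b2; move: (Num.trunc _) => n.
  rewrite ler_pdivlMr // ltr_pdivrMr // ler_pdivlMr // ltr_pdivrMr // -natr1 mulrDl mul1r.
  move: (n%:R * h) => t a1 a2 b1 b2.
  rewrite -(real_normK (num_real (a - b))) ler_pXn2r ?nnegrE ?(ltW h0) //.
  by rewrite ler_norml; lra.
exists ('I_m.+1 * 'I_m.+1 * 'I_m.+1 * 'I_m.+1)%type,
  (fun M => (k (M 0 0), k (M 0 1), k (M 1 0), k (M 1 1))) => M N MC NC [k1 k2 k3 k4].
apply: le_lt_trans h4; rewrite /n2 !mxE.
have en (P : 'M[R]_2) : n2 P <= C -> [/\ P 0 0 ^+ 2 <= C, P 0 1 ^+ 2 <= C, P 1 0 ^+ 2 <= C & P 1 1 ^+ 2 <= C].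
  rewrite /n2; have := sqr_ge0 (P 0 0); have := sqr_ge0 (P 0 1).
  have := sqr_ge0 (P 1 0); have := sqr_ge0 (P 1 1).
  by move: (_ ^+ 2) (_ ^+ 2) (_ ^+ 2) (_ ^+ 2) => p q r s *; split; lra.
have [m1 m2 m3 m4] := en _ MC; have [n1 n2 n3 n4] := en _ NC.
have := kP _ _ m1 n1 k1; have := kP _ _ m2 n2 k2.
have := kP _ _ m3 n3 k3; have := kP _ _ m4 n4 k4.
by move: (_ ^+ 2) (_ ^+ 2) (_ ^+ 2) (_ ^+ 2) (_ ^+ 2) => p q r s t; lra.
Qed.

Lemma n2_entry M i j : M i j ^+ 2 <= n2 M.
Proof.
have E (k : 'I_2) : k = 0 \/ k = 1.
  by case: k => -[|[|//]] h; [left|right]; apply: val_inj.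
have := sqr_ge0 (M 0 0); have := sqr_ge0 (M 0 1).
have := sqr_ge0 (M 1 0); have := sqr_ge0 (M 1 1).
rewrite /n2; case: (E i) => ->; case: (E j) => ->;
move: (M 0 0 ^+ 2) (M 0 1 ^+ 2) (M 1 0 ^+ 2) (M 1 1 ^+ 2) => p q r t; lra.
Qed.

Definition sgp H := [/\ H 1%g, (forall A B, H A -> H B -> H (A * B)%g) & (forall A, H A -> H A^-1%g)].

Definition dsc H := exists2 e : R, 0 < e & forall A, H A -> n2 (val A - 1%:M) < e -> A = 1%g.

(** The full preimage in [SL2], in which every element of [G] occurs with both signs; counting here
    requires no choice of representatives. *)
Definition hat (G : set (PSL2 R)) : set (SL2 R) := [set A | G (\pi_(PSL2 R) A)].

Lemma hat_sgp G : is_subgroup G -> sgp (hat G).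
Proof.
move=> HG; have [G1 _] := HG; rewrite /hat; split => /=.
- by rewrite pi_PSL21 -inE.
- by move=> A B hA hB; rewrite pi_PSL2M -inE; apply: (group_closedM HG); rewrite inE.
- by move=> A hA; rewrite pi_PSL2V -inE; apply: (group_closedV HG); rewrite inE.
Qed.

Lemma hat_dsc G : is_subgroup G -> is_discrete G -> dsc (hat G).
Proof.
move=> HG DG; have [G1 _ _] := hat_sgp HG.
have {}G1 : G (1%g : PSL2 R) by rewrite -pi_PSL21.
have [_ [V V1 VG]] := DG _ G1.
have /pi_continuous : nbhs (\pi_(PSL2 R) (1%g : SL2 R)) V by rewrite pi_PSL21.
rewrite nbhsE => -[B [oB B1] BV].
have [W oW WB] := oB.
have /open_nbhs_nbhs : open_nbhs (val (1%g : SL2 R)) W.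
  by split=> //; move: B1; rewrite -WB.
move=> [P HP PW].
have ex i j : exists2 e : R, 0 < e & ball ((1%:M : 'M[R]_2) i j) e `<=` P i j.
  by have := HP i j; rewrite -nbhs_ballE => -[e e0 He]; exists e.
have [e1 e10 H1] := ex 0 0; have [e2 e20 H2] := ex 0 1.
have [e3 e30 H3] := ex 1 0; have [e4 e40 H4] := ex 1 1.
(* The bound [e <= 1] excludes the other preimage of the identity, the matrix [-1], whose diagonal
   entries differ from 1 by [2]. *)
pose e := Num.min 1 (Num.min (Num.min e1 e2) (Num.min e3 e4)).
have e0 : 0 < e by rewrite !lt_min ltr01 e10 e20 e30 e40.
exists (e ^+ 2); first exact: exprn_gt0.
move=> A GA An.
have en i j : `|(1%:M : 'M[R]_2) i j - val A i j| < e.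
  rewrite -ltr_sqr ?nnegrE ?(ltW e0) // real_normK ?num_real //.
  apply: le_lt_trans An; apply: le_trans (n2_entry _ i j).
  by rewrite !mxE -sqrrN opprB.
have VA : V (\pi_(PSL2 R) A).
  apply: BV; rewrite -WB; apply: PW => i j; move: (en i j); rewrite !lt_min.
  have E (k : 'I_2) : k = 0 \/ k = 1.
    by case: k => -[|[|//]] h; [left|right]; apply: val_inj.
  move=> /and3P[_ /andP[a1 a2] /andP[a3 a4]].
  by move: a1 a2 a3 a4; case: (E i) => ->; case: (E j) => -> a1 a2 a3 a4;
    [apply: H1|apply: H2|apply: H3|apply: H4]; rewrite -ball_normE.
have : (V `&` G) (\pi_(PSL2 R) A) by split.
rewrite VG /= -pi_PSL21 => /PSL2_piP /orP[/eqP h|/eqP h]; first exact: val_inj.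
have := en 0 0; rewrite h val_SL21 !mxE /= mulr1n opprK.
rewrite ger0_norm ?addr_ge0 // !lt_min => /andP[]; rewrite gtrDl.
by rewrite ltr10.
Qed.


Lemma n2_cj_quot w A B : n2 (cj w (A^-1 * B)%g - 1%:M) <= n2 (cj w A) * n2 (cj w B - cj w A).
Proof.
have -> : cj w (A^-1 * B)%g - 1%:M = cj w (A^-1)%g *m (cj w B - cj w A).
  by rewrite mulmxBr -!cjM mulVg cj1.
by apply: le_trans (n2M_le _ _) _; rewrite cjV n2_inv ?det_cj.
Qed.

Section Fixed.
Variable H : set (SL2 R).
Hypotheses (sH : sgp H) (dH : dsc H).

Lemma dsc_at w : exists2 e : R, 0 < e & forall A, H A -> n2 (cj w A - 1%:M) < e -> A = 1%g.
Proof.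
have [e e0 He] := dH.
have y0 := imH_gt0 w.
pose K := n2 (mk2 (imH w) (reH w) 0 1) * n2 (mk2 (imH w)^-1 (- reH w / imH w) 0 1) + 1.
have K0 : 0 < K by rewrite /K ltr_wpDl // mulr_ge0 ?n2_ge0.
exists (e / K); first exact: divr_gt0.
move=> A HA h; apply: He => //.
set G := mk2 (imH w)^-1 (- reH w / imH w) 0 1; set L := mk2 (imH w) (reH w) 0 1.
have LG : L *m G = 1%:M.
  by apply: mx2P; rewrite mx2_mulE !mk2E !mxE /= ?mulr1n ?mulr0n; field; rewrite ?gt_eqF.
have -> : val A - 1%:M = L *m (cj w A - 1%:M) *m G.
  have -> : cj w A - 1%:M = cjm w (val A - 1%:M) by rewrite cjmB cjm1.
  by rewrite /cjm !mulmxA LG mul1mx -mulmxA LG mulmx1.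
have h1 : n2 (L *m (cj w A - 1%:M) *m G) <= K * n2 (cj w A - 1%:M).
  apply: le_trans (n2M_le _ _) _.
  apply: (@le_trans _ _ (n2 L * n2 (cj w A - 1%:M) * n2 G)).
    by apply: ler_wpM2r; [exact: n2_ge0|exact: n2M_le].
  have -> : K * n2 (cj w A - 1%:M) = n2 L * n2 (cj w A - 1%:M) * n2 G + n2 (cj w A - 1%:M).
    by rewrite /K -/L -/G; ring.
  by rewrite lerDl n2_ge0.
by apply: le_lt_trans h1 _; rewrite mulrC -ltr_pdivlMr.
Qed.

(** Two elements in the same cell of a fine grid have a quotient so close to 1 that discreteness
    makes it trivial; each cell thus holds at most one element. *)
Lemma bounded_atmost w (C : R) : exists N, atmost [set A | H A /\ n2 (cj w A) <= C] N.
Proof.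
have [H1 HM HV] := sH; have [e e0 He] := dsc_at w.
have C0 : 0 < `|C| + 1 by rewrite ltr_wpDl.
have [T [cell Hcell]] := @grid C (e / (`|C| + 1)) (divr_gt0 e0 C0).
exists (#|T| * 1)%N; apply: (atmost_fibers (c := fun A => cell (cj w A))) => u.
move=> [//|A [//|B s]] /= /andP[]; rewrite inE negb_or => /andP[/eqP AB _] _ Hs.
exfalso; apply: AB.
have [[HA nA] cA] : [set x | [set A0 | H A0 /\ n2 (cj w A0) <= C] x /\ cell (cj w x) = u] A by apply: Hs; rewrite mem_head.
have [[HB nB] cB] : [set x | [set A0 | H A0 /\ n2 (cj w A0) <= C] x /\ cell (cj w x) = u] B by apply: Hs; rewrite !inE eqxx orbT.
have : (A^-1 * B)%g = 1%g.
  apply: He; first by apply: HM => //; exact: HV.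
  apply: le_lt_trans (n2_cj_quot _ _ _) _.
  have h1 : n2 (cj w B - cj w A) < e / (`|C| + 1) by apply: Hcell => //; rewrite cA cB.
  have h2 : n2 (cj w A) <= `|C| by apply: le_trans nA (ler_norm _).
  have h3 := n2_ge0 (cj w B - cj w A).
  apply: (@le_lt_trans _ _ (`|C| * (e / (`|C| + 1)))).
    by apply: ler_pM => //; [exact: n2_ge0|exact: ltW].
  rewrite mulrA ltr_pdivrMr // mulrC ltr_pM2l // ltrDl //.
by move=> /(congr1 (fun X => A * X)%g); rewrite mulgA mulgV mul1g mulg1.
Qed.

Lemma near_atmost w (e : R) : exists N, atmost [set A | H A /\ n2 (cj w A - 1%:M) < e] N.
Proof.
have [N HN] := bounded_atmost w (2 * (`|e| + 2)); exists N; apply: atmostS HN => A [HA nA]; split=> //.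
rewrite -[cj w A](subrK 1%:M); apply: le_trans (n2D_le _ _) _.
rewrite n2_1 ler_pM2l // lerD2r; apply: le_trans (ltW nA) (ler_norm _).
Qed.

(** Only finitely many elements lie within [e] of 1, so a minimum exists among them, and all other
    nontrivial elements are farther away. *)
Lemma near_minimal w (e : R) A : H A -> A <> 1%g -> n2 (cj w A - 1%:M) < e ->
  exists X, [/\ H X, X <> 1%g, n2 (cj w X - 1%:M) < e &
    forall B, H B -> B <> 1%g -> n2 (cj w X - 1%:M) <= n2 (cj w B - 1%:M)].
Proof.
move=> HA A1 nA; have [N HN] := near_atmost w e.
have [s us sP] := atmost_enum HN.
pose s' := [seq B <- s | B != 1%g].
have As : A \in s' by rewrite mem_filter; apply/andP; split; [exact/eqP|apply/sP].
have [|X Xs Xm] := seq_min (fun B => n2 (cj w B - 1%:M)) (s := s').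
  by apply/eqP => h; rewrite h in As.
move: (Xs); rewrite mem_filter => /andP[/eqP X1 /sP[HX nX]].
exists X; split => // B HB B1.
have [nB|nB] := ltP (n2 (cj w B - 1%:M)) e; last by apply: le_trans (ltW nX) nB.
by apply: Xm; rewrite mem_filter; apply/andP; split; [exact/eqP|apply/sP].
Qed.

Lemma cj_neq1 w A : A <> 1%g -> cj w A != 1%:M.
Proof. by move=> A1; apply/eqP; rewrite -(cj1 w) => /cj_inj. Qed.

Lemma near_not_scalar w A : A <> 1%g -> n2 (cj w A - 1%:M) < 1 / 100 ->
  forall k : R, val A != k%:M.
Proof.
move=> A1 nA k; apply/eqP => Ak.
have E : cj w A = k%:M.
  by rewrite /cj Ak -scalemx1 cjmZ cjm1.
have D := det_cj w A; move: D; rewrite E det_mx2 !mxE /= !mulr1n mulr0n mulr0 subr0.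
have : cj w A != 1%:M by exact: cj_neq1.
rewrite E => k1; move: nA; rewrite E /n2 !mxE /= !mulr1n !mulr0n.
move=> h kk; have [kE|kn1] := eqVneq k 1; first by rewrite kE eqxx in k1.
have k2 : k = -1.
  apply/eqP; rewrite -addr_eq0; move: kk => /eqP; rewrite -subr_eq0.
  have -> : k * k - 1 = (k - 1) * (k + 1) by ring.
  by rewrite mulf_eq0 subr_eq0 (negbTE kn1).
by move: h; rewrite k2; lra.
Qed.

(* The commutator with a nontrivial element of minimal distance to 1 would be
   even closer to 1, so it is trivial. *)
Lemma near_commute w A B : H A -> H B ->
  n2 (cj w A - 1%:M) < 1 / 100 -> n2 (cj w B - 1%:M) < 1 / 100 -> (A * B = B * A)%g.
Proof.
move=> HA HB nA nB; have [H1 HM HV] := sH.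
have [->|/eqP A1] := eqVneq A 1%g; first by rewrite mulg1 mul1g.
have [X [HX X1 nX Xm]] := near_minimal HA A1 nA.
have cX Y : H Y -> n2 (cj w Y - 1%:M) < 1 / 100 -> (X * Y = Y * X)%g.
  move=> HY nY.
  have : (X * Y * X^-1 * Y^-1)%g = 1%g.
    apply/eqP/negPn/negP => /eqP /(Xm _ (HM _ _ (HM _ _ (HM _ _ HX HY) (HV _ HX)) (HV _ HY))).
    rewrite !cjM !cjV leNgt => /negP; apply; apply: n2_commutator; rewrite ?det_cj //.
      exact: ltW.
    exact: cj_neq1.
  move=> /(congr1 (fun Z => Z * Y)%g); rewrite mulgVK mul1g.
  by move=> /(congr1 (fun Z => Z * X)%g); rewrite mulgVK.
have h1 := cX _ HA nA; have h2 := cX _ HB nB.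
apply: val_inj; rewrite !val_SL2M; apply: (mx2_centralizer_abelian (X := val X)).
- exact: near_not_scalar nX.
- by rewrite -!val_SL2M h1.
- by rewrite -!val_SL2M h2.
Qed.

End Fixed.

End DiscreteGroups.

(** * Multiplicities, and parabolic elements near the identity *)

Section Multiplicity.
Variable R : realType.
Implicit Types (A B X : SL2 R) (z w : UHP R) (M N : 'M[R]_2) (H : set (SL2 R)) (Q : set (UHP R)).

(** A nonscalar matrix of size two has a cyclic vector, so its centralizer consists of the
    polynomials in it. The coefficient of [X] is found by dividing by an off-diagonal entry, or by
    the difference of the diagonal entries, whichever is nonzero. *)
Lemma commute_span (X A : 'M[R]_2) : (forall k : R, X != k%:M) -> X *m A = A *m X ->
  exists a b : R, A = a%:M + b *: X.
Proof.
move=> Xs /matrixP XA.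
have := XA 0 0; have := XA 0 1; have := XA 1 0; rewrite !mx2_mulE.
have : X 0 1 != 0 \/ X 1 0 != 0 \/ X 0 0 - X 1 1 != 0.
  have [x1|] := eqVneq (X 0 1) 0; last by left.
  have [x2|] := eqVneq (X 1 0) 0; last by right; left.
  have [x3|] := eqVneq (X 0 0 - X 1 1) 0; last by right; right.
  exfalso; move: (Xs (X 0 0)); apply/negP; rewrite negbK; apply/eqP.
  apply: mx2P; rewrite !mxE /= ?mulr1n ?mulr0n //.
  by apply/esym/eqP; rewrite -subr_eq0 x3.
have E (u v : R) : A 0 0 = u + v * X 0 0 -> A 0 1 = v * X 0 1 ->
   A 1 0 = v * X 1 0 -> A 1 1 = u + v * X 1 1 -> exists a b : R, A = a%:M + b *: X.
  move=> h1 h2 h3 h4; exists u, v; apply: mx2P; rewrite !mxE /= ?mulr1n ?mulr0n ?add0r //.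
move: E.
move: (A 0 0) (A 0 1) (A 1 0) (A 1 1) (X 0 0) (X 0 1) (X 1 0) (X 1 1) => a b c d x y z w E nz k3 k2 k1.
have e1 : y * c = b * z by move: k1; lra.
have e3 : (x - w) * b = y * (a - d) by move: k2; lra.
have e5 : (x - w) * c = z * (a - d) by move: k3; lra.
case: nz => [|[|]] n0.
- apply: (E (a - b / y * x) (b / y)).
  + ring.
  + by field.
  + by apply: (mulfI n0); rewrite e1; field.
  + apply: (mulfI n0); have -> : y * (a - b / y * x + b / y * w) = y * a - (x - w) * b by field.
    by rewrite e3; ring.
- apply: (E (a - c / z * x) (c / z)).
  + ring.
  + by apply: (mulfI n0); rewrite mulrC -e1; field.
  + by field.
  + apply: (mulfI n0); have -> : z * (a - c / z * x + c / z * w) = z * a - (x - w) * c by field.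
    by rewrite e5; ring.
- apply: (E (a - (a - d) / (x - w) * x) ((a - d) / (x - w))).
  + ring.
  + by apply: (mulfI n0); rewrite e3; field.
  + by apply: (mulfI n0); rewrite e5; field.
  + by field.
Qed.

(** The threshold lies strictly below the [1 / 100] of [near_commute], so that commutation still
    holds for elements at distance exactly [1 / 400]. *)
Definition near H w : set (SL2 R) := [set B | H B /\ n2 (cj w B - 1%:M) < 1 / 400].

(** Returns of an orbit to [Q] are counted with the group elements that produce them; this number is
    the loss incurred in [unfolding]. *)
Definition multiplicity_le H Q (N : nat) := forall w, atmost [set A | H A /\ Q (mobius A w)] N.

Lemma atmost_base (T : eqType) (S : set T) n : (forall x, S x -> atmost S n) -> atmost S n.
Proof.
move=> HS [//|x s] us sS; apply: (HS x) => //; apply: sS; exact: mem_head.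
Qed.

Lemma mulgA_inj A : injective (fun B => A * B)%g.
Proof. by move=> B C /(congr1 (fun Z => A^-1 * Z)%g); rewrite !mulKg. Qed.

Lemma mulgAr_inj A : injective (fun B => B * A)%g.
Proof. by move=> B C /(congr1 (fun Z => Z * A^-1)%g); rewrite !mulgK. Qed.

(* Elements of [H] moving [w] inside [Q] are distributed among boundedly many
   cells, and the quotients within a cell are close to 1. *)
Lemma near_multiplicity : exists T : nat, forall H Q (rho : R) n, sgp H -> rho <= 1 ->
  (forall w w', Q w -> Q w' -> ud w w' <= rho) ->
  (forall w, Q w -> atmost [set B | near H w B /\ ud (mobius B w) w <= rho] n) ->
  multiplicity_le H Q (T * n).
Proof.
(* A displacement of at most 1 means [n2 <= 2 + 4 = 6], and [6 * (1 / 2400)] is the threshold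
   [1 / 400] of [near]. *)
have [T [cell Hcell]] := @grid R 6 (1 / 2400) ltac:(lra).
exists #|T| => H Q rho n [H1 HM HV] rho1 Qd Qn w.
apply: atmost_base => A1 [HA1 QA1].
apply: (@atmost_inj _ _ (fun A => A * A1^-1)%g _
   [set B | H B /\ Q (mobius B (mobius A1 w))]).
- exact: mulgAr_inj.
- by move=> A /= [HA QA]; split; [apply: HM => //; exact: HV|rewrite -mobiusM mulgVK].
move: (mobius A1 w) QA1 => {A1 HA1} w1 Qw1.
apply: (atmost_fibers (c := fun A => cell (cj w1 A))) => u.
have n6 B : H B -> Q (mobius B w1) -> n2 (cj w1 B) <= 6.
  by move=> HB QB; rewrite n2_cj; have := Qd _ _ QB Qw1; move: (ud _ _) => t; lra.
apply: atmost_base => A [[HA QA] cA].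
apply: (@atmost_inj _ _ (fun B => A^-1 * B)%g _ [set B | near H w1 B /\ ud (mobius B w1) w1 <= rho]).
- exact: mulgA_inj.
- move=> B /= [[HB QB] cB]; split.
    split; first by apply: HM => //; exact: HV.
    apply: le_lt_trans (n2_cj_quot _ _ _) _.
    have h1 : n2 (cj w1 B - cj w1 A) < 1 / 2400.
      by apply: Hcell; rewrite ?n6 // cA cB.
    have h2 := n6 _ HA QA.
    apply: (@le_lt_trans _ _ (6 * n2 (cj w1 B - cj w1 A))).
      by apply: ler_wpM2r => //; exact: n2_ge0.
    by move: h1; move: (n2 _) => t; lra.
  by rewrite -(ud_mobius A) -mobiusM mulVKg; exact: Qd.
- exact: Qn.
Qed.

Lemma near_100 w B : n2 (cj w B - 1%:M) < 1 / 400 -> n2 (cj w B - 1%:M) < 1 / 100.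
Proof. by move: (n2 _) => t; lra. Qed.

Lemma near_trivial H w : (forall B, near H w B -> B = 1%g) -> atmost (near H w) 1.
Proof.
move=> Hn [//|A [//|B s]] /= /andP[]; rewrite inE negb_or => /andP[/eqP AB _] _ Hs.
have hA : A = 1%g by apply: Hn; apply: Hs; rewrite mem_head.
have hB : B = 1%g by apply: Hn; apply: Hs; rewrite !inE eqxx orbT.
by case: AB; rewrite hA hB.
Qed.

Lemma tr_near_mx M (e : R) : n2 (M - 1%:M) < e -> (M 0 0 + M 1 1 - 2) ^+ 2 < 2 * e.
Proof.
rewrite /n2 !mxE /= !mulr1n !mulr0n.
have := sqr_ge0 (M 0 1 - 0); have := sqr_ge0 (M 1 0 - 0).
move: (M 0 0) (M 1 1) (_ ^+ 2) (_ ^+ 2) => a d p q p0 q0 h.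
have -> : a + d - 2 = (a - 1) + (d - 1) by ring.
have : 0 <= ((a - 1) - (d - 1)) ^+ 2 by exact: sqr_ge0.
move: h; move: (a - 1) (d - 1) => u v; nra.
Qed.

Lemma tr_near w B : n2 (cj w B - 1%:M) < 1 / 400 -> (tr2 B - 2) ^+ 2 < 1 / 200.
Proof.
move/tr_near_mx; rewrite tr_cj; move: (_ ^+ 2) => t; lra.
Qed.

Lemma det_span (a b : R) M : M 0 0 + M 1 1 = 0 ->
  \det (a%:M + b *: M) = a ^+ 2 + b ^+ 2 * \det M.
Proof.
rewrite !det_mx2 !mxE /= ?mulr1n ?mulr0n => /eqP; rewrite addr_eq0 => /eqP ->.
ring.
Qed.

Lemma n2_span (a b : R) M : M 0 0 + M 1 1 = 0 ->
  n2 (a%:M + b *: M - 1%:M) = 2 * (a - 1) ^+ 2 + b ^+ 2 * n2 M.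
Proof.
rewrite /n2 !mxE /= ?mulr1n ?mulr0n => /eqP; rewrite addr_eq0 => /eqP ->.
ring.
Qed.

Lemma mx2_nilpotent M : M 0 0 + M 1 1 = 0 -> \det M = 0 -> M *m M = 0.
Proof.
rewrite det_mx2 => /eqP; rewrite addr_eq0 => /eqP h1; rewrite h1 => h2.
apply: mx2P; rewrite mx2_mulE mxE ?h1; move: h2;
  move: (M 0 1) (M 1 0) (M 1 1) => p q r; lra.
Qed.

Section InGroup.
Variable H : set (SL2 R).
Hypotheses (sH : sgp H) (dH : dsc H).

(** Since [B] commutes with [X], it is a scalar plus a multiple of the nilpotent matrix [X - 1].
    Determinant 1 forces the scalar to be [1] or [-1], and nearness to 1 selects [1]. *)
Lemma near_parabolic_span w X B : near H w X -> X <> 1%g -> tr2 X = 2 -> near H w B ->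
  exists b : R, val B = 1%:M + b *: (val X - 1%:M).
Proof.
move=> [HX nX] X1 tX [HB nB].
have XB := near_commute sH dH HX HB (near_100 nX) (near_100 nB).
have [|a [b E]] := @commute_span (val X) (val B) (near_not_scalar X1 (near_100 nX)).
  by rewrite -!val_SL2M XB.
exists b; pose N := val X - 1%:M.
have N0 : N 0 0 + N 1 1 = 0.
  by move: tX; rewrite /tr2 /N !mxE /= mulr1n; move: (val X 0 0) (val X 1 1) => u v; lra.
have dN : \det N = 0.
  have := det_span 1 1 N0; rewrite scale1r /N addrC subrK SL2_det expr1n !mul1r -/N.
  by move: (\det N) => t; lra.
have E' : val B = (a + b)%:M + b *: N.
  by rewrite E /N; apply: mx2P; rewrite !mxE /= ?mulr1n ?mulr0n; ring.
have g2 : (a + b) ^+ 2 = 1.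
  by have := det_span (a + b) b N0; rewrite -E' SL2_det dN mulr0 addr0.
have g0 : a + b = 1.
  have tB : tr2 B = 2 * (a + b).
    by rewrite /tr2 E' !mxE /= !mulr1n; move: N0; rewrite /N !mxE /= mulr1n; move: (val X 0 0) (val X 1 1) => u v; nra.
  have := tr_near nB; rewrite tB.
  move: g2; move: (a + b) => g g2 h.
  have : (g - 1) * (g + 1) = 0 by rewrite -[RHS](subrr 1) -{3}g2; ring.
  move/eqP; rewrite mulf_eq0 => /orP[|/eqP g1]; first by rewrite subr_eq0 => /eqP.
  by exfalso; move: h; have -> : g = -1 by [move: g1; lra]; lra.
by rewrite E' g0.
Qed.

Lemma parabolic_trace w (b : R) X B : tr2 X = 2 -> val B = 1%:M + b *: (val X - 1%:M) ->
  tr2 B = 2 /\ n2 (cj w B - 1%:M) = b ^+ 2 * n2 (cj w X - 1%:M).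
Proof.
move=> tX E.
have N0 : (val X - 1%:M) 0 0 + (val X - 1%:M) 1 1 = 0.
  by move: tX; rewrite /tr2 !mxE /= mulr1n; move: (val X 0 0) (val X 1 1) => u v; lra.
split.
  by rewrite /tr2 E !mxE /= !mulr1n; move: tX; rewrite /tr2; move: (val X 0 0) (val X 1 1) => u v; nra.
have -> : cj w B - 1%:M = b *: (cj w X - 1%:M).
  by rewrite /cj E cjmD cjm1 cjmZ cjmB cjm1 addrC addKr.
by rewrite /n2 !mxE; ring.
Qed.

Lemma parabolic_ud w B : tr2 B = 2 -> n2 (cj w B - 1%:M) = 4 * ud (mobius B w) w.
Proof. by move=> tB; rewrite n2_sub1 tr_cj tB n2_cj; ring. Qed.

(** The parameters [beta] of the near elements differ by at least 1: the difference for [B] and [C]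
    is the parameter of [B C^-1], and a parameter of absolute value below 1 would contradict the
    minimality of [X]. Displacement at most [rho] confines them to [[-b, b]]. *)
Lemma near_parabolic_count w X (rho b : R) : near H w X -> X <> 1%g -> tr2 X = 2 ->
  (forall B, H B -> B <> 1%g -> n2 (cj w X - 1%:M) <= n2 (cj w B - 1%:M)) ->
  0 <= b -> 4 * rho <= b ^+ 2 * n2 (cj w X - 1%:M) ->
  atmost [set B | near H w B /\ ud (mobius B w) w <= rho] (Num.trunc (2 * b)).+1.
Proof.
move=> nX X1 tX Xm b0 hb; have [H1 HM HV] := sH.
pose beta B := xget 0 [set b : R | val B = 1%:M + b *: (val X - 1%:M)].
have betaP B : near H w B -> val B = 1%:M + beta B *: (val X - 1%:M).
  move=> nB; have [t Ht] := near_parabolic_span nX X1 tX nB.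
  exact: (@xgetPex _ 0 [set b : R | val B = 1%:M + b *: (val X - 1%:M)] (ex_intro _ t Ht)).
have N0 : 0 < n2 (cj w X - 1%:M) by rewrite n2_gt0 // subr_eq0; exact: cj_neq1.
have bd B : near H w B -> ud (mobius B w) w <= rho -> `|beta B| <= b.
  move=> nB uB; have [tB nB2] := parabolic_trace w tX (betaP _ nB).
  have : beta B ^+ 2 * n2 (cj w X - 1%:M) <= b ^+ 2 * n2 (cj w X - 1%:M).
    by rewrite -nB2 (parabolic_ud w tB); apply: le_trans hb; rewrite ler_pM2l.
  by rewrite ler_pM2r // -(real_normK (num_real (beta B))) ler_pXn2r ?nnegrE.
have sep B C : near H w B -> near H w C -> `|beta B - beta C| < 1 -> B = C.
  move=> nB nC bc.
  have E : val (B * C^-1)%g = 1%:M + (beta B - beta C) *: (val X - 1%:M).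
    have UC := SL2_unitmx C.
    apply: (can_inj (mulmxK UC)); rewrite val_SL2M val_SL2V mulmxKV // (betaP _ nB) (betaP _ nC).
    pose N := val X - 1%:M; rewrite -/N.
    have N2 : N *m N = 0.
      have N0' : N 0 0 + N 1 1 = 0.
        by move: tX; rewrite /tr2 /N !mxE /= mulr1n; move: (val X 0 0) (val X 1 1) => u v; lra.
      apply: mx2_nilpotent => //.
      have := det_span 1 1 N0'; rewrite scale1r /N addrC subrK SL2_det expr1n !mul1r -/N.
      by move: (\det N) => t; lra.
    rewrite mulmxDl mul1mx mulmxDr mulmx1 -scalemxAl -scalemxAr N2 !scaler0 addr0.
    by rewrite -addrA; congr (_ + _); rewrite -scalerDl addrC subrK.
  have [_ nE] := parabolic_trace w tX E.
  apply/eqP/negPn/negP => /eqP BC.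
  have BC1 : (B * C^-1)%g <> 1%g.
    by move=> /(congr1 (fun Z => Z * C)%g); rewrite mulgVK mul1g.
  have := Xm _ (HM _ _ (proj1 nB) (HV _ (proj1 nC))) BC1.
  rewrite nE ler_pMl // leNgt => /negP; apply.
  by rewrite -(real_normK (num_real (_ - _))) expr_lt1.
pose m := Num.trunc (2 * b).
pose k B : 'I_m.+1 := inord (Num.trunc (beta B + b)).
rewrite -[m.+1]muln1 -{1}(card_ord m.+1).
apply: (atmost_fibers (c := k)) => u.
move=> [//|B [//|C s]] /= /andP[]; rewrite inE negb_or => /andP[/eqP BC _] _ Hs.
exfalso; apply: BC.
have [[nB uB] cB] : [set x | [set B0 | near H w B0 /\ ud (mobius B0 w) w <= rho] x /\ k x = u] B.
  by apply: Hs; rewrite mem_head.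
have [[nC uC] cC] : [set x | [set B0 | near H w B0 /\ ud (mobius B0 w) w <= rho] x /\ k x = u] C.
  by apply: Hs; rewrite !inE eqxx orbT.
have kb D : near H w D -> ud (mobius D w) w <= rho ->
    0 <= beta D + b /\ (Num.trunc (beta D + b) < m.+1)%N.
  move=> nD uD; have := bd _ nD uD; rewrite ler_norml => /andP[d1 d2].
  split; first by lra.
  by rewrite ltnS; apply: le_truncn; lra.
have [B0 Bm] := kb _ nB uB; have [C0 Cm] := kb _ nC uC.
have := cB; rewrite -cC => /(congr1 (@nat_of_ord _)); rewrite /k !inordK // => BC.
have /andP[a1 a2] := truncn_itv B0; have /andP[c1 c2] := truncn_itv C0.
apply: sep => //; rewrite BC in a1 a2; move: a1 a2 c1 c2; rewrite -natr1.
by move: (_%:R) => t *; rewrite ltr_norml; apply/andP; split; lra.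
Qed.

End InGroup.
End Multiplicity.

(** * Nonparabolic elements near the identity *)

Section NonParabolic.
Variable R : realType.
Implicit Types (A B X : SL2 R) (z w p : UHP R) (M N : 'M[R]_2).
Variable H : set (SL2 R).

Definition thick w := forall B, H B -> n2 (cj w B - 1%:M) < 1 / 400 -> B = 1%g.

(** Stands for compactness of the thick part modulo [H]. The cusps are left out, so that finite area
    is enough to obtain it. *)
Definition thick_cover := exists ps : seq (UHP R), forall w, thick w ->
  exists A p, [/\ H A, p \in ps & ud (mobius A w) p <= 1 / 100].

(** The trace condition holds for all near elements and, unlike nearness at a given base point, is
    invariant under conjugation. *)
Definition Z3 X : set (SL2 R) :=
  [set B | [/\ H B, (X * B = B * X)%g & -3 <= tr2 B <= 3]].

Definition half_tr X : R := tr2 X / 2.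
Definition traceless X : 'M[R]_2 := val X - (half_tr X)%:M.

Lemma tr_traceless X : traceless X 0 0 + traceless X 1 1 = 0.
Proof. by rewrite /traceless /half_tr /tr2 !mxE /= !mulr1n; field. Qed.

Lemma val_traceless X : val X = (half_tr X)%:M + 1 *: traceless X.
Proof. by rewrite scale1r /traceless addrC subrK. Qed.

Lemma det_traceless X : half_tr X ^+ 2 + \det (traceless X) = 1.
Proof.
by have := det_span (half_tr X) 1 (tr_traceless X); rewrite -val_traceless SL2_det expr1n mul1r.
Qed.

Lemma cj_traceless w X : cjm w (traceless X) 0 0 + cjm w (traceless X) 1 1 = 0.
Proof. by rewrite !cjmE -[RHS](tr_traceless X); ring. Qed.

Lemma span_near w X B (b : R) : val B = (half_tr B)%:M + b *: traceless X ->
  n2 (cj w B - 1%:M) = 2 * (half_tr B - 1) ^+ 2 + b ^+ 2 * n2 (cjm w (traceless X)).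
Proof.
move=> E; rewrite /cj E cjmD cjmZ.
have -> : cjm w (half_tr B)%:M = (half_tr B)%:M.
  by rewrite -scalemx1 cjmZ cjm1.
exact: n2_span (cj_traceless w X).
Qed.

Lemma commuting_span X B : (forall k : R, val X != k%:M) -> (X * B = B * X)%g ->
  exists b : R, val B = (half_tr B)%:M + b *: traceless X.
Proof.
move=> Xs XB; have [|a [b E]] := @commute_span _ (val X) (val B) Xs.
  by rewrite -!val_SL2M XB.
exists b; have tB : half_tr B = a + b * half_tr X.
  rewrite /half_tr /tr2 E !mxE /= !mulr1n.
  by move: (val X 0 0) (val X 1 1) => u v; field.
rewrite tB {1}E /traceless; move: (half_tr X) (val X) => h Y.
by apply: mx2P; rewrite !mxE /= ?mulr1n ?mulr0n; ring.
Qed.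

Lemma span_det X B (b : R) : val B = (half_tr B)%:M + b *: traceless X ->
  half_tr B ^+ 2 - 1 = b ^+ 2 * (half_tr X ^+ 2 - 1).
Proof.
move=> E; have := det_span (half_tr B) b (tr_traceless X); rewrite -E SL2_det.
have := det_traceless X; move: (\det _) => d h1 h2.
have -> : half_tr X ^+ 2 - 1 = - d by move: h1; lra.
by rewrite mulrN {1}h2; ring.
Qed.

Lemma near_half_tr w B : n2 (cj w B - 1%:M) <= 1 / 400 -> (half_tr B - 1) ^+ 2 <= 1 / 800.
Proof.
move=> h; have : n2 (cj w B - 1%:M) < 1 / 400 + 1 / 10 ^+ 9 by move: h; move: (n2 _) => t; lra.
move=> _.
have := h; rewrite /n2 -[cj w B]/(cj w B).
have E : half_tr B - 1 = ((cj w B 0 0 - 1) + (cj w B 1 1 - 1)) / 2.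
  by rewrite /half_tr -(tr_cj w); field.
rewrite E.
have e1 : (cj w B - 1%:M) 0 0 = cj w B 0 0 - 1.
  by move: (cj w B) => M; rewrite !mxE /= mulr1n.
have e2 : (cj w B - 1%:M) 1 1 = cj w B 1 1 - 1.
  by move: (cj w B) => M; rewrite !mxE /= mulr1n.
rewrite e1 e2.
have := sqr_ge0 ((cj w B - 1%:M) 0 1); have := sqr_ge0 ((cj w B - 1%:M) 1 0).
move: (cj w B 0 0 - 1) (cj w B 1 1 - 1) (_ ^+ 2) (_ ^+ 2) => u v p q p0 q0 {}h.
have : 0 <= (u - v) ^+ 2 by exact: sqr_ge0.
have -> : ((u + v) / 2) ^+ 2 = (2 * (u ^+ 2 + v ^+ 2) - (u - v) ^+ 2) / 4 by field.
by move: h; move: (u ^+ 2) (v ^+ 2) ((u - v) ^+ 2) => x y z; lra.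
Qed.

(* Moving the base point horizontally, the distance of a nonparabolic element
   to 1 becomes large. *)
Lemma horizontal_escape w X : (forall k : R, val X != k%:M) -> tr2 X ^+ 2 != 4 ->
  n2 (cj w X - 1%:M) < 1 / 400 ->
  exists w', n2 (cj w' X - 1%:M) = 1 / 400.
Proof.
move=> Xs tX nX; have y0 := imH_gt0 w.
pose a := val X 0 0; pose b := val X 0 1; pose c := val X 1 0; pose d := val X 1 1.
pose y := imH w.
(* If [c] is nonzero, [x1] makes the upper left entry of the conjugated matrix equal to [2]; if
   [c = 0], it makes the upper right entry equal to [1], which is possible since [a] and [d] differ
   for a nonparabolic [X]. *)
have [x1 Hx1] : exists x1 : R, 1 <= n2 (cj (mkUHP x1 y0) X - 1%:M).
  have [c0|c0] := eqVneq c 0.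
    have ad : a - d != 0.
      apply: contra tX => /eqP ad; have := SL2_det2 X; rewrite -/a -/b -/c -/d c0 mulr0 subr0 /tr2 -/a -/d.
      have -> : a = d by move: ad; lra.
      by move=> h; apply/eqP; rewrite -mulr2n exprMn_n -mulr_natr expr2 h; ring.
    exists ((y - b) / (a - d)).
    apply: le_trans (n2_entry _ 0 1).
    rewrite [X in X ^+ 2](_ : _ = 1) ?expr1n //.
    transitivity (cj (mkUHP ((y - b) / (a - d)) y0) X 0 1).
      by move: (cj _ _) => M; rewrite !mxE /= mulr0n subr0.
    rewrite /cj !cjmE /reH /imH /= -/a -/b -/c -/d c0 -/(imH w) -/y.
    by field; rewrite ad gt_eqF.
  exists ((a - 2) / c).
  apply: le_trans (n2_entry _ 0 0).
  rewrite [X in X ^+ 2](_ : _ = 1) ?expr1n //.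
  transitivity (cj (mkUHP ((a - 2) / c) y0) X 0 0 - 1).
    by move: (cj _ _) => M; rewrite !mxE /= mulr1n.
  rewrite /cj !cjmE /reH /imH /= -/a -/b -/c -/d.
  by field.
(* As a function of the real part of the base point the distance to 1 is a polynomial, so the
   intermediate value theorem for polynomials reaches [1 / 400] exactly. *)
pose P : {poly R} := (a%:P - c *: 'X - 1) ^+ 2
  + (y^-1 *: (b%:P + a *: 'X - 'X * (c *: 'X + d%:P))) ^+ 2
  + ((c * y) ^+ 2)%:P + (c *: 'X + d%:P - 1) ^+ 2 - (1 / 400)%:P.
have PE x : P.[x] = n2 (cj (mkUHP x y0) X - 1%:M) - 1 / 400.
  have -> : n2 (cj (mkUHP x y0) X - 1%:M) =
     (cj (mkUHP x y0) X 0 0 - 1) ^+ 2 + cj (mkUHP x y0) X 0 1 ^+ 2 +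
     cj (mkUHP x y0) X 1 0 ^+ 2 + (cj (mkUHP x y0) X 1 1 - 1) ^+ 2.
    by move: (cj _ _) => M; rewrite /n2 !mxE /= !mulr1n !mulr0n !subr0.
  rewrite /cj !cjmE /P !hornerE /reH /imH /= -/a -/b -/c -/d -/(imH w) -/y.
  by rewrite -!/(imH w) -/y; field; rewrite gt_eqF.
pose x0 := reH w.
have w0 : mkUHP x0 y0 = w by apply: UHP_ext.
pose S : {poly R} := P \Po (x0%:P + (x1 - x0) *: 'X).
have SE t : S.[t] = P.[x0 + (x1 - x0) * t] by rewrite /S horner_comp !hornerE.
have [|t _ /rootP] := @poly_ivt R S 0 1 ler01.
  rewrite ?in_itv /= !SE !PE mulr0 addr0 mulr1 w0.
  have -> : x0 + (x1 - x0) = x1 by ring.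
  by move: nX Hx1; move: (n2 _) (n2 _) => u v *; apply/andP; split; lra.
rewrite SE PE => /eqP; rewrite subr_eq0 => /eqP h.
by exists (mkUHP (x0 + (x1 - x0) * t) y0).
Qed.

Hypotheses (sH : sgp H) (dH : dsc H).

Lemma n2_cjm_gt0 w M : M != 0 -> 0 < n2 (cjm w M).
Proof.
move=> M0; rewrite n2_gt0 //; apply: contra M0 => /eqP E; apply/eqP.
by apply: (@cjm_inj _ w); rewrite E /cjm mulmx0 mul0mx.
Qed.

(* At the base point where a minimal nonparabolic element reaches distance
   [1/400], every other element commuting with it is at least as far. *)
Lemma minimal_reaches_thick w X : H X -> X <> 1%g -> tr2 X ^+ 2 != 4 ->
  n2 (cj w X - 1%:M) < 1 / 400 ->
  (forall B, H B -> B <> 1%g -> n2 (cj w X - 1%:M) <= n2 (cj w B - 1%:M)) ->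
  exists w', thick w' /\ n2 (cj w' X - 1%:M) = 1 / 400.
Proof.
move=> HX X1 tX nX Xm.
have Xs := near_not_scalar X1 (near_100 nX).
have [w' nX'] := horizontal_escape Xs tX nX.
exists w'; split=> // B HB nB; apply/eqP/negPn/negP => /eqP B1.
have nX100 : n2 (cj w' X - 1%:M) < 1 / 100 by rewrite nX'; lra.
have XB := near_commute sH dH HX HB nX100 (near_100 nB).
have [b EB] := commuting_span Xs XB.
have N0 : traceless X != 0.
  by rewrite subr_eq0 Xs.
have s0 := n2_cjm_gt0 w N0.
have hB := span_near w EB; have hB' := span_near w' EB.
have hX := span_near w (val_traceless X); have hX' := span_near w' (val_traceless X).
have D := span_det EB.
have m := Xm _ HB B1.
have aX := near_half_tr (ltW nX); have aB := near_half_tr (ltW nB).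
rewrite hX hB expr1n mul1r in m; rewrite hX expr1n mul1r in nX.
rewrite hX' expr1n mul1r in nX'; rewrite hB' in nB.
move: s0 m nX nX' nB D aX aB; clear.
move: (n2 (cjm w _)) (n2 (cjm w' _)) (half_tr X) (half_tr B) => s s' al be s0 m nX nX' nB D aX aB.
(* Comparing the distances at [w] and [w'] gives [s < s'] and [b ^+ 2 < 1], and then minimality at
   [w] makes [be] farther from 1 than [al]. But [D] reads [be ^+ 2 - 1 = b ^+ 2 * (al ^+ 2 - 1)],
   which puts [be] between 1 and [al]. *)
have b0 : 0 <= b ^+ 2 by exact: sqr_ge0.
have ss : s < s' by lra.
have b1 : b ^+ 2 < 1.
  rewrite ltNge; apply/negP => b1.
  have : 0 <= (b ^+ 2 - 1) * (s' - s) by rewrite mulr_ge0 // subr_ge0 // ltW.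
  have : b ^+ 2 * s' - s' - b ^+ 2 * s + s < 0 by lra.
  have -> : (b ^+ 2 - 1) * (s' - s) = b ^+ 2 * s' - s' - b ^+ 2 * s + s by ring.
  by move: (b ^+ 2 * s' - s' - b ^+ 2 * s + s) => t; lra.
have a1 : (al - 1) ^+ 2 < (be - 1) ^+ 2.
  have : (b ^+ 2 - 1) * s < 0 by rewrite pmulr_llt0 // subr_lt0.
  have -> : (b ^+ 2 - 1) * s = b ^+ 2 * s - s by ring.
  by move: m; move: (b ^+ 2 * s) => t; lra.
have al0 : 0 < al by move: aX; nra.
have be0 : 0 < be by move: aB; nra.
move: D b0 b1; move: (b ^+ 2) => q D b0 b1.
have [al1|al1] := leP 1 al.
  have p0 : 0 <= al ^+ 2 - 1 by rewrite subr_ge0 expr_ge1 // ltW.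
  have p1 := mulr_ge0 b0 p0.
  have p2 : 0 <= (1 - q) * (al ^+ 2 - 1) by rewrite mulr_ge0 // subr_ge0 ltW.
  have h1 : be ^+ 2 <= al ^+ 2.
    by rewrite -subr_ge0; have <- : (1 - q) * (al ^+ 2 - 1) = al ^+ 2 - be ^+ 2 by rewrite mulrBl mul1r -D; ring.
  have h2 : 1 <= be ^+ 2 by rewrite -subr_ge0 D.
  have h3 : be <= al by rewrite -(ler_pXn2r (n := 2)) // nnegrE ltW.
  have h4 : 1 <= be by rewrite -(ler_pXn2r (n := 2)) ?expr1n // nnegrE ltW.
  by move: a1; nra.
have p0 : 0 <= 1 - al ^+ 2 by rewrite subr_ge0 expr_le1 // ltW.
have p1 := mulr_ge0 b0 p0.
have p2 : 0 <= (1 - q) * (1 - al ^+ 2) by rewrite mulr_ge0 // subr_ge0 ltW.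
have bE : be ^+ 2 = 1 + q * (al ^+ 2 - 1) by rewrite -D; ring.
have h1 : al ^+ 2 <= be ^+ 2.
  rewrite -subr_ge0; have -> : be ^+ 2 - al ^+ 2 = (1 - q) * (1 - al ^+ 2) by rewrite bE; ring.
  exact: p2.
have h2 : be ^+ 2 <= 1.
  rewrite -subr_ge0; have -> : 1 - be ^+ 2 = q * (1 - al ^+ 2) by rewrite bE; ring.
  exact: p1.
have h3 : al <= be by rewrite -(ler_pXn2r (n := 2)) // nnegrE ltW.
have h4 : be <= 1 by rewrite -(ler_pXn2r (n := 2)) ?expr1n // nnegrE ltW.
by move: a1; nra.
Qed.

(** An element commuting with [X] is determined by its half trace and the coefficient [b] of
    [traceless X]. Determinant 1 links the two through [span_det], so for nonparabolic [X] a bounded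
    trace bounds [b], hence the matrix, and discreteness leaves finitely many. *)
Lemma Z3_atmost (w : UHP R) X : (forall k : R, val X != k%:M) -> tr2 X ^+ 2 != 4 ->
  exists n, atmost (Z3 X) n.
Proof.
move=> Xs tX.
pose D := half_tr X ^+ 2 - 1.
have D0 : D != 0.
  apply: contra tX; rewrite /D /half_tr subr_eq0 => /eqP h; apply/eqP.
  by transitivity (4 * (tr2 X / 2) ^+ 2); [field|rewrite h; ring].
pose s := n2 (cjm w (traceless X)).
have s0 : 0 <= s by exact: n2_ge0.
(* For traces in [[-3, 3]] the half trace differs from 1 by at most [5 / 2], and [b ^+ 2] is at most
   [2] divided by the absolute value of [D]. *)
pose C := 2 * ((2 * (5 / 2) ^+ 2 + (2 / `|D|) * s) + 2).
have [n Hn] := bounded_atmost sH dH w C.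
exists n; apply: atmostS Hn => B [HB XB /andP[t1 t2]]; split=> //.
have [b EB] := commuting_span Xs XB.
rewrite -[cj w B](subrK 1%:M); apply: le_trans (n2D_le _ _) _.
rewrite /C ler_pM2l // n2_1 lerD2r (span_near w EB) -/s.
have h1 : -3 / 2 <= half_tr B <= 3 / 2 by rewrite /half_tr; lra.
have Db := span_det EB; rewrite -/D in Db.
have b2 : b ^+ 2 <= 2 / `|D|.
  rewrite ler_pdivlMr ?normr_gt0 //.
  have : `|b ^+ 2 * D| <= 2.
    by rewrite -Db ler_norml; move: h1; move: (half_tr B) => t /andP[]; nra.
  by rewrite normrM (ger0_norm (sqr_ge0 b)).
apply: lerD; last by apply: ler_wpM2r.
by rewrite ler_pM2l //; move: h1; move: (half_tr B) => t /andP[]; nra.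
Qed.

Lemma Z3_conj X A n : H A -> atmost (Z3 (A * X * A^-1)%g) n -> atmost (Z3 X) n.
Proof.
move=> HA; have [H1 HM HV] := sH.
apply: (@atmost_inj _ _ (fun B => A * B * A^-1)%g).
  by move=> B C /mulgAr_inj /mulgA_inj.
move=> B [HB XB tB]; split.
- by apply: (HM); [apply: (HM)|apply: (HV)].
- rewrite !mulgA !mulgVK -[in LHS](mulgA A) XB !mulgA; by [].
- by have := tr2_conj B (A^-1)%g; rewrite invgK => ->.
Qed.

Lemma conj_not_scalar X A : (forall k : R, val X != k%:M) ->
  forall k : R, val (A * X * A^-1)%g != k%:M.
Proof.
move=> Xs k; apply/eqP => E; move: (Xs k); apply/negP; rewrite negbK; apply/eqP.
have -> : X = (A^-1 * (A * X * A^-1) * A)%g by rewrite !mulgA mulVg mul1g mulgVK.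
set Z := (A * X * A^-1)%g in E *.
rewrite (val_SL2M (A^-1 * Z)%g A) (val_SL2M A^-1%g Z) E -scalemx1 -scalemxAr mulmx1 -scalemxAl val_SL2V mulVmx //.
exact: SL2_unitmx.
Qed.

(** All near elements lie in [Z3 X0] for a minimal [X0], which is nonparabolic since otherwise [X]
    would be parabolic too. At a thick point [w'] this [X0] still has moderate displacement, so
    conjugating [w'] close to a point [p] of the cover turns [X0] into one of finitely many
    elements; [Z3_conj] carries the bound back. *)
Theorem nonparabolic_near_count : thick_cover -> exists K, forall w X,
  near H w X -> X <> 1%g -> tr2 X <> 2 -> atmost (near H w) K.
Proof.
move=> [ps Hps]; have [H1 HM HV] := sH.
have [K HK] : exists K, forall p Y, p \in ps -> H Y -> ud (mobius Y p) p <= 8 ->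
    (forall k : R, val Y != k%:M) -> tr2 Y ^+ 2 != 4 -> atmost (Z3 Y) K.
  elim: ps {Hps} => [|p ps [K HK]]; first by exists 0%N.
  (* [34 = 2 + 4 * 8] translates the bound [8] on the displacement into one on [n2]. *)
  have [n Hn] := bounded_atmost sH dH p 34.
  have [s us sP] := atmost_enum Hn.
  have [K' HK'] : exists K', forall Y, Y \in s -> (forall k : R, val Y != k%:M) ->
      tr2 Y ^+ 2 != 4 -> atmost (Z3 Y) K'.
    elim: s {us sP} => [|Y s [K' IH]]; first by exists 0%N.
    have [|h] := pselect ((forall k : R, val Y != k%:M) /\ tr2 Y ^+ 2 != 4).
      move=> [h1 h2]; have [m Hm] := Z3_atmost p h1 h2.
      exists (maxn m K') => Z; rewrite inE => /orP[/eqP -> _ _|Zs z1 z2].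
        exact: atmost_le (leq_maxl _ _) Hm.
      exact: atmost_le (leq_maxr _ _) (IH _ Zs z1 z2).
    by exists K' => Z; rewrite inE => /orP[/eqP -> h1 h2|]; [case: h|exact: IH].
  exists (maxn K' K) => q Y; rewrite inE => /orP[/eqP ->|qs] HY uY Ys tY.
    apply: atmost_le (leq_maxl _ _) (HK' _ _ Ys tY); apply/sP; split=> //.
    by rewrite n2_cj; move: uY; move: (ud _ _) => t; lra.
  exact: atmost_le (leq_maxr _ _) (HK _ _ qs HY uY Ys tY).
exists K => w X nX X1 tX.
have [HX nX'] := nX.
have Xs := near_not_scalar X1 (near_100 nX').
have [X0 [HX0 X01 nX0 Xm]] := near_minimal sH dH HX X1 nX'.
have X0s := near_not_scalar X01 (near_100 nX0).
have nX0' : near H w X0 by [].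
have tX0 : tr2 X0 <> 2.
  move=> t0; have [b E] := near_parabolic_span sH dH nX0' X01 t0 nX.
  by have [/tX] := parabolic_trace w t0 E.
have tX04 : tr2 X0 ^+ 2 != 4.
  apply/eqP => h; have := tr_near nX0; move: tX0 h; move: (tr2 X0) => t tn h h'.
  have : (t - 2) * (t + 2) = 0 by transitivity (t ^+ 2 - 4); [ring|rewrite h subrr].
  move/eqP; rewrite mulf_eq0 => /orP[|/eqP t2]; first by rewrite subr_eq0 => /eqP.
  by move: h'; have -> : t = -2 by [move: t2; lra]; lra.
have [w' [tw' nw']] := minimal_reaches_thick HX0 X01 tX04 nX0 Xm.
have [A [p [HA pp Ap]]] := Hps _ tw'.
pose Y := (A * X0 * A^-1)%g.
have uX0 : ud (mobius X0 w') w' <= 1 / 25.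
  have := n2_sub1 (cj w' X0); rewrite tr_cj nw' n2_cj.
  have : (half_tr X0 - 1) ^+ 2 <= 1 / 800 by apply: (@near_half_tr w'); rewrite nw'.
  have -> : tr2 X0 = 2 * half_tr X0 by rewrite /half_tr; field.
  by move: (half_tr X0) (ud _ _) => h u; nra.
(* The point [p] is within [1 / 100] of [mobius A w'], which [Y] displaces by at most [1 / 25]; two
   uses of the weak triangle inequality, each with its factor [12], stay below [8]. *)
have uY : ud (mobius Y p) p <= 8.
  have e1 : ud (mobius Y (mobius A w')) (mobius A w') <= 1 / 25.
    by rewrite /Y !mobiusM mobiusK ud_mobius.
  have e2 : ud (mobius Y p) (mobius Y (mobius A w')) <= 1 / 100.
    by rewrite ud_mobius udC.
  have e3 : ud (mobius Y p) (mobius A w') <= 12 * (1 / 100 + 1 / 25).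
    apply: le_trans (ud_triangle (z := mobius Y (mobius A w')) _ _) _.
    - by apply: le_trans e2 _; lra.
    - by apply: le_trans e1 _; lra.
    - by rewrite ler_pM2l //; exact: lerD.
  apply: le_trans (ud_triangle (z := mobius A w') _ _) _.
  - by apply: le_trans e3 _; lra.
  - by apply: le_trans Ap _; lra.
  - by move: e3 Ap; move: (ud _ _) (ud _ p) => u v; lra.
have tY : tr2 Y = tr2 X0.
  by have := tr2_conj X0 (A^-1)%g; rewrite invgK.
have HY : H Y by apply: (HM); [apply: (HM)|apply: (HV)].
have aY : atmost (Z3 Y) K.
  by apply: (HK p) => //; [exact: conj_not_scalar|rewrite tY].
have aX0 := Z3_conj HA aY.
apply: atmostS aX0 => B [HB nB]; split=> //.
  have XB := near_commute sH dH HX0 HB (near_100 nX0) (near_100 nB).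
  exact: XB.
by have := tr_near nB; move: (tr2 B) => t h; apply/andP; split; nra.
Qed.

End NonParabolic.

(** * Unfolding and finite area *)

Section MoebiusInvariance.
Local Open Scope ereal_scope.
Variable R : realType.
Notation mu := (@lebesgue_measure R).
Implicit Types (A B : SL2 R) (z w : UHP R) (phi : R * R -> \bar R) (p : R * R).

Definition denR A p : R := ((val A 1 0 * p.1 + val A 1 1) ^+ 2 + (val A 1 0 * p.2) ^+ 2)%R.

(** The action in real coordinates, total on the plane so that it can be composed with functions in
    Lebesgue integrals. *)
Definition mobR A p : R * R :=
  (((val A 0 0 * p.1 + val A 0 1) * (val A 1 0 * p.1 + val A 1 1)
    + val A 0 0 * val A 1 0 * p.2 ^+ 2) / denR A p, p.2 / denR A p)%R.

Lemma coordH_mobius A z : coordH (mobius A z) = mobR A (coordH z).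
Proof. by rewrite /coordH mobius_re mobius_im. Qed.

Lemma coordH_surj p : (0 < p.2)%R -> exists z, coordH z = p.
Proof. by case: p => x y /= y0; exists (mkUHP x y0). Qed.

Lemma mobRVK A p : (0 < p.2)%R -> mobR A (mobR A^-1%g p) = p.
Proof. by move=> /coordH_surj[z <-]; rewrite -!coordH_mobius mobiusVK. Qed.

Lemma measurable_mobR A : measurable_fun [set: R * R] (mobR A).
Proof.
have m1 : measurable_fun [set: R * R] (fun p : R * R => p.1) by exact: measurable_fst.
have m2 : measurable_fun [set: R * R] (fun p : R * R => p.2) by exact: measurable_snd.
have mi : measurable_fun [set: R * R] (fun p : R * R => (denR A p)^-1)%R.
  apply: (measurableT_comp (@measurable_inv R)); apply: measurable_funD.
    by apply: measurable_funX; apply: measurable_funD => //; exact: measurable_funM.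
  by apply: measurable_funX; exact: measurable_funM.
apply: measurable_fun_pair; apply: measurable_funM => //.
apply: measurable_funD.
  by apply: measurable_funM; apply: measurable_funD => //; exact: measurable_funM.
by apply: measurable_funM => //; exact: measurable_funX.
Qed.

Lemma eq_hint phi psi : (forall p, (0 < p.2)%R -> phi p = psi p) -> hint phi = hint psi.
Proof.
by move=> E; apply: eq_integral => p _; rewrite /hdens; case: ifP => // /E ->.
Qed.

(** For [c = 0] the map is [z |-> a^2 z + a b]; otherwise it is [a / c - 1 / (c^2 (z + d / c))],
    composed of translations, a scaling and the inversion. *)
Lemma hint_mobius A phi : measurable_fun [set: R * R] phi -> (forall p, 0 <= phi p) ->
  hint (phi \o mobR A) = hint phi.
Proof.
move=> mphi phi0; have D := SL2_det2 A.
have mT (t : R) : measurable_fun [set: R * R] (fun p : R * R => (p.1 + t, p.2)%R).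
  apply: measurable_fun_pair; last exact: measurable_snd.
  by apply: measurable_funD => //; exact: measurable_fst.
have mS (l : R) : measurable_fun [set: R * R] (fun p : R * R => (l * p.1, l * p.2)%R).
  by apply: measurable_fun_pair; apply: measurable_funM.
pose a : R := (val A 0 0)%R; pose b : R := (val A 0 1)%R; pose c : R := (val A 1 0)%R; pose d : R := (val A 1 1)%R.
rewrite -/a -/b -/c -/d in D.
have [c0|c0] := eqVneq c 0%R.
  rewrite c0 mulr0 subr0 in D.
  have d0 : (d != 0)%R by apply: contra_eq_neq D => ->; rewrite mulr0 eq_sym oner_neq0.
  have a0 : (a != 0)%R by apply: contra_eq_neq D => ->; rewrite mul0r eq_sym oner_neq0.
  have aE : a = (d^-1)%R by rewrite -[LHS]mulr1 -(divff d0) mulrA D mul1r.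
  rewrite -[RHS](hint_translate (a * b)%R mphi phi0).
  have a20 : (0 < a ^+ 2)%R by rewrite exprn_even_gt0.
  rewrite -[RHS](@hint_scale _ (a ^+ 2)%R _ a20) //; last exact: (measurableT_comp mphi (mT _)).
  apply: eq_hint => p p0 /=; congr (phi (_, _)).
    rewrite /denR -/a -/b -/c -/d c0 aE !mul0r expr0n !addr0 add0r.
    by field.
  by rewrite /denR -/c -/d c0 !mul0r expr0n addr0 add0r aE; field.
have mJ : measurable_fun [set: R * R] (fun p : R * R =>
    (- p.1 / (p.1 ^+ 2 + p.2 ^+ 2), p.2 / (p.1 ^+ 2 + p.2 ^+ 2))%R).
  have m1 : measurable_fun [set: R * R] (fun p : R * R => p.1) by exact: measurable_fst.
  have m2 : measurable_fun [set: R * R] (fun p : R * R => p.2) by exact: measurable_snd.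
  have mi : measurable_fun [set: R * R] (fun p : R * R => (p.1 ^+ 2 + p.2 ^+ 2)^-1)%R.
    apply: (measurableT_comp (@measurable_inv R)).
    by apply: measurable_funD; exact: measurable_funX.
  apply: measurable_fun_pair; apply: measurable_funM => //.
  exact: measurable_funN.
have c20 : (0 < c ^+ 2)%R by rewrite exprn_even_gt0.
pose phi1 p := phi (p.1 + a / c, p.2)%R.
have m1 : measurable_fun [set: R * R] phi1 := measurableT_comp mphi (mT (a / c)%R).
pose phi2 p := phi1 (- p.1 / (p.1 ^+ 2 + p.2 ^+ 2), p.2 / (p.1 ^+ 2 + p.2 ^+ 2))%R.
have m2 : measurable_fun [set: R * R] phi2 := measurableT_comp m1 mJ.
pose phi3 p := phi2 (c ^+ 2 * p.1, c ^+ 2 * p.2)%R.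
have m3 : measurable_fun [set: R * R] phi3 := measurableT_comp m2 (mS (c ^+ 2)%R).
rewrite -(hint_translate (a / c)%R mphi phi0) -/phi1.
rewrite -(hint_inversion m1 (fun p => phi0 _)) -/phi2.
rewrite -(hint_scale c20 m2 (fun p => phi0 _)) -/phi3.
rewrite -(hint_translate (d / c)%R m3 (fun p => phi0 _)).
apply: eq_hint => -[x y] /= y0; rewrite /phi3 /phi2 /phi1 /=; congr (phi (_, _)).
  rewrite /denR -/a -/b -/c -/d /=.
  have bE : b = ((a * d - 1) / c)%R.
    by rewrite -D opprB addrCA subrr addr0 mulfK.
  have q0 : ((c * x + d) ^+ 2 + (c * y) ^+ 2 != 0)%R.
    by rewrite gt_eqF // ltr_wpDl ?sqr_ge0 // exprn_even_gt0 // mulf_neq0 // gt_eqF.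
  have -> : ((c ^+ 2 * (x + d / c)) ^+ 2 + (c ^+ 2 * y) ^+ 2 = c ^+ 2 * ((c * x + d) ^+ 2 + (c * y) ^+ 2))%R.
    by field.
  by rewrite bE; field; rewrite c0 q0.
have q0 : ((c * x + d) ^+ 2 + (c * y) ^+ 2 != 0)%R.
  by rewrite gt_eqF // ltr_wpDl ?sqr_ge0 // exprn_even_gt0 // mulf_neq0 // gt_eqF.
rewrite /denR -/a -/b -/c -/d /=.
have -> : ((c ^+ 2 * (x + d / c)) ^+ 2 + (c ^+ 2 * y) ^+ 2 = c ^+ 2 * ((c * x + d) ^+ 2 + (c * y) ^+ 2))%R.
  by field.
by field; rewrite c0 q0.
Qed.

End MoebiusInvariance.

Section Unfolding.
Local Open Scope ereal_scope.
Variable R : realType.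
Implicit Types (A B : SL2 R) (z w : UHP R) (phi : R * R -> \bar R) (p : R * R) (S Q : set (R * R)).

Definition hintS S phi : \bar R := \int[@lebesgue2 R]_(p in S) hdens phi p.

(** The group is the union of its finite subsets of bounded [n2] at one base point. The enumeration
    may repeat elements. *)
Lemma dsc_enum (H : set (SL2 R)) : sgp H -> dsc H -> exists e : nat -> SL2 R,
  (forall n, H (e n)) /\ forall A, H A -> exists n, e n = A.
Proof.
move=> sH dH; have [H1 _ _] := sH.
pose w : UHP R := @mkUHP R 0 1 ltr01.
have ex (n : nat) : exists s : seq (SL2 R), forall A, (H A /\ n2 (cj w A) <= n%:R)%R <-> A \in s.
  have [N HN] := bounded_atmost sH dH w n%:R.
  by have [s _ Hs] := atmost_enum HN; exists s.
pose s n := projT1 (cid (ex n)); have sP n := projT2 (cid (ex n)) : forall A, _ <-> A \in s n.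
pose e k := if unpickle k is Some (n, i) then nth 1%g (s n) i else 1%g : SL2 R.
exists e; split.
  move=> k; rewrite /e; case: (unpickle k : option (nat * nat)) => // -[n i].
  have [ile|ige] := ltnP i (size (s n)); last by rewrite nth_default.
  by have /sP[] := mem_nth 1%g ile.
move=> A HA; pose n := (Num.trunc (n2 (cj w A))).+1.
have As : A \in s n by apply/sP; split=> //; apply/ltW/truncnS_gt.
exists (pickle (n, index A (s n))); rewrite /e pickleK.
by rewrite nth_index.
Qed.

Lemma hdens_ge0 phi p : (forall p, 0 <= phi p) -> 0 <= hdens phi p.
Proof. exact: hint_integrand_ge0. Qed.

Lemma hint_indic S phi : hint (fun p => phi p * (\1_S p)%:E) = hintS S phi.
Proof.
rewrite /hintS integral_mkcond; apply: eq_integral => p _.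
rewrite /hdens patchE indicE; case: (p \in S); case: ifP => //.
  by rewrite mule1.
by rewrite mule0 mul0e.
Qed.

Lemma hintS_mobius A S phi : measurable S -> measurable_fun [set: R * R] phi ->
  (forall p, 0 <= phi p) -> (forall p, (0 < p.2)%R -> phi (mobR A p) = phi p) ->
  hintS (mobR A @^-1` S) phi = hintS S phi.
Proof.
move=> mS mphi phi0 inv; rewrite -!hint_indic -[RHS](@hint_mobius _ A); last 2 first.
- apply: emeasurable_funM => //; apply/measurable_EFinP; exact: measurable_indic.
- by move=> p; rewrite mule_ge0 // lee_fin.
by apply: eq_hint => p p0 /=; rewrite inv.
Qed.

(** The set [Q] is cut into pieces [D n] according to the first [e n] that sends a point into [F],
    and [e n] moves the piece onto a part [E n] of [F]. A point of [F] lies in at most [N] of the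
    sets [E n], since the inverses of the corresponding [e n] are distinct and send it into [Q]. *)
Theorem unfolding (H : set (SL2 R)) (F : set (UHP R)) Q (N : nat) phi :
  sgp H -> dsc H -> measurable (@coordH R @` F) ->
  (forall z, exists2 A, H A & F (mobius A z)) ->
  measurable Q -> multiplicity_le H (fun w => Q (coordH w)) N ->
  measurable_fun [set: R * R] phi -> (forall p, 0 <= phi p) ->
  (forall A p, H A -> (0 < p.2)%R -> phi (mobR A p) = phi p) ->
  hintS Q phi <= N%:R%:E * hintS (@coordH R @` F) phi.
Proof.
move=> sH dH mF cov mQ mult mphi phi0 inv.
have [e [eH esurj]] := dsc_enum sH dH; have [H1 HM HV] := sH.
set cF := _ @` F.
pose U : set (R * R) := [set p | (0 < p.2)%R].
have mU : measurable U.
  have := @measurable_fun_ltr _ (R * R)%type R setT (fun=> 0%R) snd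
     (measurable_cst _) (@measurable_snd _ _ R R).
  move=> /(_ measurableT [set true] I); rewrite setTI.
  by congr measurable; apply/seteqP; split => p /=; rewrite ?eqb_id //; case: (0 < p.2)%R.
pose P n : set (R * R) := mobR (e n) @^-1` cF.
have mP n : measurable (P n).
  by rewrite -[P n]setTI; apply: (measurable_mobR (e n)).
pose D n : set (R * R) := U `&` Q `&` P n `\` \big[setU/set0]_(i < n) P i.
have mD n : measurable (D n).
  apply: measurableD; last exact: bigsetU_measurable.
  by apply: measurableI => //; apply: measurableI.
have DU : \bigcup_n D n = U `&` Q.
  apply/seteqP; split=> [p [n _ [[//]]]|p [Up Qp]].
  have [z zp] := coordH_surj Up; have [A HA FA] := cov z.
  have [n0 en0] := esurj _ HA.
  have ex : exists n, `[< P n p >].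
    by exists n0; apply/asboolP; rewrite /P /= en0 -zp -coordH_mobius; exists (mobius A z).
  case: (ex_minnP ex) => n /asboolP Pn min; exists n => //; split; first by split.
  rewrite -bigcup_mkord => -[m /= mn Pm].
  by have := min m ltac:(exact/asboolP); rewrite leqNgt mn.
have tD : trivIset setT D.
  apply/trivIsetP => i j _ _; wlog ij : i j / (i < j)%N.
    move=> W; case: ltngtP => // ij _; first by apply: W => //; rewrite ltn_eqF.
    by rewrite setIC; apply: W => //; rewrite ltn_eqF.
  move=> _; rewrite -subset0 => p [[[_ Pi] _] [_]]; apply.
  by rewrite -bigcup_mkord; exists i.
have mh : measurable_fun [set: R * R] (hdens phi) by exact: measurable_hint.
have h0 p : 0 <= hdens phi p by exact: hdens_ge0.
have -> : hintS Q phi = \sum_(n <oo) hintS (D n) phi.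
  transitivity (hintS (U `&` Q) phi).
    rewrite -!hint_indic; apply: eq_hint => p p0; congr (_ * _%:E).
    by rewrite !indicE in_setI (_ : p \in U) // inE.
  rewrite -DU /hintS ge0_integral_bigcup //.
  exact: measurable_funTS.
pose E n : set (R * R) := mobR (e n)^-1%g @^-1` (D n).
have mE n : measurable (E n).
  by rewrite -[E n]setTI; apply: (measurable_mobR _).
have DE n : hintS (D n) phi = hintS (E n) phi.
  apply/esym; apply: hintS_mobius => // p p0; apply: inv => //; exact: HV.
under eq_eseriesr do rewrite DE.
apply: lime_le; first by apply: is_cvg_nneseries => n _ _; apply: integral_ge0.
apply: nearW => m; rewrite big_mkord.
(* The last conclusion deals with repetitions in the enumeration: only the first index of a group
   element gives a nonempty piece. *)
have EI n p : U p -> E n p -> [/\ cF p, Q (mobR (e n)^-1%g p) &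
    forall i : nat, (i < n)%N -> e i <> e n].
  move=> Up [[[_ Qp] Pp] nP]; split => //.
    by move: Pp; rewrite /P /= mobRVK.
  move=> i ile ein; apply: nP; rewrite -bigcup_mkord; exists i => //.
  by rewrite /P /= ein.
have card p : U p -> (\sum_(i < m) (p \in E i : nat) <= N)%N.
  move=> Up; have [w wp] := coordH_surj Up.
  pose s := [seq (e i)^-1%g | i <- iota 0 m & p \in E i].
  have -> : (\sum_(i < m) (p \in E i : nat) = size s)%N.
    rewrite size_map size_filter -(big_mkord xpredT (fun i => (p \in E i : nat))) /index_iota subn0.
    by elim: (iota 0 m) => [|k t IH] /=; rewrite ?big_nil // big_cons IH.
  apply: (mult w).
    rewrite map_inj_in_uniq ?filter_uniq ?iota_uniq // => i j.
    rewrite !mem_filter => /andP[/set_mem Ei _] /andP[/set_mem Ej _] /(congr1 (fun Z => Z^-1)%g).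
    rewrite !invgK => eij; apply/eqP/negPn/negP => ij.
    have [_ _ li] := EI _ _ Up Ei; have [_ _ lj] := EI _ _ Up Ej.
    by move: ij; case: ltngtP => // [/lj|/li] h _; apply: h.
  move=> _ /mapP[i + ->]; rewrite mem_filter => /andP[/set_mem Ei _].
  have [_ Qi _] := EI _ _ Up Ei; split; first exact: HV.
  by rewrite coordH_mobius wp.
have -> : \sum_(i < m) hintS (E i) phi =
   \int[@lebesgue2 R]_p (\sum_(i < m) hdens (fun p => phi p * (\1_(E i) p)%:E) p).
  rewrite ge0_integral_sum //.
  - by apply: eq_bigr => i _; rewrite -hint_indic.
  - move=> i; apply: measurable_hint; apply: emeasurable_funM => //.
    by apply/measurable_EFinP; exact: measurable_indic.
  - by move=> i p _; apply: hdens_ge0 => q; rewrite mule_ge0 // lee_fin.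
have NE : N%:R%:E * hintS cF phi = \int[@lebesgue2 R]_p (N%:R%:E * hdens (fun p => phi p * (\1_cF p)%:E) p).
  rewrite ge0_integralZl //.
  - by rewrite -hint_indic.
  - apply: measurable_hint; apply: emeasurable_funM => //.
    by apply/measurable_EFinP; exact: measurable_indic.
  - by move=> p _; apply: hdens_ge0 => q; rewrite mule_ge0 // lee_fin.
rewrite NE; apply: ge0_le_integral => //.
- by move=> p _; apply: sume_ge0 => i _; apply: hdens_ge0 => q; rewrite mule_ge0 // lee_fin.
- apply: emeasurable_sum => i; apply: measurable_hint; apply: emeasurable_funM => //.
  by apply/measurable_EFinP; exact: measurable_indic.
- apply: emeasurable_funM => //; apply: measurable_hint; apply: emeasurable_funM => //.
  by apply/measurable_EFinP; exact: measurable_indic.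
move=> p _; have [p0|p0] := boolP (0 < p.2)%R; last first.
  by rewrite /hdens (negbTE p0) mule0 big1.
have -> : \sum_(i < m) hdens (fun p => phi p * (\1_(E i) p)%:E) p =
   hdens phi p * (\sum_(i < m) (p \in E i : nat))%:R%:E.
  rewrite natr_sum -sumEFin ge0_sume_distrr; last by move=> i _; rewrite lee_fin.
  by apply: eq_bigr => i _; rewrite /hdens p0 indicE muleAC.
have -> : hdens (fun p => phi p * (\1_cF p)%:E) p = hdens phi p * (\1_cF p)%:E.
  by rewrite /hdens p0 muleAC.
have [Fp|nF] := boolP (p \in cF).
  rewrite indicE Fp mule1 muleC; apply: lee_wpmul2r => //.
  by rewrite lee_fin ler_nat card.
rewrite big1 ?mule0; first by rewrite mule_ge0 // mule_ge0 // lee_fin.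
move=> i _; have [/set_mem Ei|//] := boolP (p \in E i).
by have [/mem_set] := EI _ _ p0 Ei; rewrite (negbTE nF).
Qed.

End Unfolding.

(** * Finite area and the thick part *)

Section ThickCover.
Variable R : realType.
Implicit Types (A B : SL2 R) (z w : UHP R) (r : R) (s : seq (UHP R)).

Definition sq w r : set (R * R) :=
  `[reH w - r * imH w, reH w + r * imH w] `*` `[imH w - r * imH w, imH w + r * imH w].

Lemma sqP w r p : sq w r p <->
  `|p.1 - reH w| <= r * imH w /\ `|p.2 - imH w| <= r * imH w.
Proof.
case: p => x y; rewrite /sq /= !in_itv /= ![`|_ - _| <= _]ler_distl.
by split=> -[].
Qed.

Lemma measurable_sq w r : measurable (sq w r).
Proof. by apply: measurableX; exact: measurable_itv. Qed.

Lemma sq_center w r : 0 <= r -> sq w r (coordH w).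
Proof. by move=> r0; apply/sqP; rewrite !subrr normr0 mulr_ge0 // ltW // imH_gt0. Qed.

Lemma sq_im w r p : r <= 1 / 2 -> sq w r p -> imH w / 2 <= p.2 /\ p.2 <= 3 / 2 * imH w.
Proof.
move=> r2 /sqP[_]; have := imH_gt0 w; rewrite ler_distl.
move: (imH w) p.2 => y q y0 /andP[h1 h2].
have : r * y <= 1 / 2 * y by rewrite ler_pM2r.
by move: h1 h2; move: (r * y) => t; lra.
Qed.

Lemma sq_ud w r z : 0 <= r -> r <= 1 / 2 -> sq w r (coordH z) -> ud z w <= r ^+ 2.
Proof.
move=> r0 r2 sz; have [z1 _] := sq_im r2 sz; have /sqP[/= h1 h2] := sz.
have w0 := imH_gt0 w; have z0 := imH_gt0 z.
rewrite udE ler_pdivrMr ?mulr_gt0 // -[(reH z - _) ^+ 2]real_normK ?num_real //.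
rewrite -[(imH z - _) ^+ 2]real_normK ?num_real //.
have ry : 0 <= r * imH w by rewrite mulr_ge0 // ltW.
have e1 : `|reH z - reH w| ^+ 2 <= (r * imH w) ^+ 2 by rewrite lerXn2r.
have e2 : `|imH z - imH w| ^+ 2 <= (r * imH w) ^+ 2 by rewrite lerXn2r.
apply: le_trans (lerD e1 e2) _.
have -> : (r * imH w) ^+ 2 + (r * imH w) ^+ 2 = r ^+ 2 * imH w * (2 * imH w) by ring.
have -> : r ^+ 2 * (4 * imH z * imH w) = r ^+ 2 * imH w * (4 * imH z) by ring.
apply: ler_wpM2l; first by rewrite mulr_ge0 ?sqr_ge0 // ltW.
by move: z1; rewrite /=; move: (imH z) (imH w) => a b; lra.
Qed.

Lemma hintS_sq_ge w r : 0 <= r -> r <= 1 / 2 ->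
  ((r ^+ 2)%:E <= hintS (sq w r) (fun=> 1))%E.
Proof.
move=> r0 r2; have w0 := imH_gt0 w; have ry : 0 <= r * imH w by rewrite mulr_ge0 // ltW.
pose c := ((3 / 2 * imH w) ^- 2).
have c0 : 0 <= c by rewrite invr_ge0 sqr_ge0.
have mI (x : R) : lebesgue_measure (`[x - r * imH w, x + r * imH w]%classic : set R)
    = (2 * (r * imH w))%:E.
  rewrite lebesgue_measure_itv /= lte_fin; case: ltP => [_|h].
    by rewrite -EFinB; congr (_%:E); ring.
  congr (_%:E); move: h ry; move: (r * imH w) => t; lra.
have m0 : (@lebesgue2 R (sq w r) = (4 * (r * imH w) ^+ 2)%:E)%E.
  transitivity ((2 * (r * imH w))%:E * (2 * (r * imH w))%:E)%E.
    rewrite -{1}(mI (reH w)) -(mI (imH w)).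
    by apply: product_measure1E; exact: measurable_itv.
  by rewrite -EFinM; congr (_%:E); ring.
apply: (@le_trans _ _ (\int[@lebesgue2 R]_(p in sq w r) c%:E)%E).
  rewrite integral_cst; last exact: measurable_sq.
  rewrite [X in (_ * X)%E](_ : _ = (4 * (r * imH w) ^+ 2)%:E); last exact: m0.
  rewrite -EFinM lee_fin.
  have -> : c * (4 * (r * imH w) ^+ 2) = 16 / 9 * r ^+ 2 by rewrite /c; field; rewrite gt_eqF.
  by have := sqr_ge0 r; move: (r ^+ 2) => t; lra.
apply: ge0_le_integral => //; first exact: measurable_sq.
  by apply: measurable_funTS; apply: measurable_hint.
move=> p /(sq_im r2)[p1 p2]; rewrite /hdens (lt_le_trans _ p1) ?divr_gt0 // mul1e lee_fin.
have pp : 0 < p.2 by apply: lt_le_trans p1; rewrite divr_gt0.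
rewrite lef_pV2 ?posrE ?exprn_gt0 ?mulr_gt0 //.
by rewrite lerXn2r // nnegrE ltW // mulr_gt0.
Qed.

Section Count.
Variable H : set (SL2 R).
Hypotheses (sH : sgp H) (dH : dsc H).

Lemma measurable_bigsq s r : measurable (\big[setU/set0]_(w <- s) sq w r).
Proof. by apply: bigsetU_measurable => w _; exact: measurable_sq. Qed.

Lemma bigsqP s r p : (\big[setU/set0]_(w <- s) sq w r) p <-> exists2 w, w \in s & sq w r p.
Proof. by rewrite -bigcup_seq; split=> -[w ws wp]; exists w. Qed.

(** The squares are disjoint even modulo [H], and their centers are thick so that boundedly many
    elements of [H] return a square to itself. *)
Definition packing r s := [/\ uniq s, (forall w, w \in s -> thick H w) &
  forall w w' A z, w \in s -> w' \in s -> H A -> sq w r (coordH z) ->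
    sq w' r (coordH (mobius A z)) -> w = w'].

End Count.

(** In a square of this size [ud] to the center is at most [1 / 2500], and two such steps give
    [12 * (2 / 2500) < 1 / 100], the radius in [thick_cover]. *)
Definition hr : R := 1 / 50.
Let hr0 : 0 <= hr. Proof. by rewrite /hr; lra. Qed.
Let hr2 : hr <= 1 / 2. Proof. by rewrite /hr; lra. Qed.

Lemma sq_hr_ud z w : sq w hr (coordH z) -> ud z w <= 1 / 2500.
Proof. by move=> h; apply: le_trans (sq_ud hr0 hr2 h) _; rewrite /hr; lra. Qed.

(** Any two visits of an orbit to the squares fall into the same square, so the elements involved
    have [n2 <= 6] at its center; as the center is thick, each cell of the grid contains only one of
    them. The bound [T] is therefore independent of [H] and [s]. *)
Lemma packing_multiplicity : exists T : nat, forall H s, sgp H -> packing H hr s ->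
  multiplicity_le H (fun w => (\big[setU/set0]_(w <- s) sq w hr) (coordH w)) T.
Proof.
have [T [cell Hcell]] := @grid R 6 (1 / 2400) ltac:(lra).
exists (#|T| * 1)%N => H s sH [us ts ps] v; have [H1 HM HV] := sH.
apply: atmost_base => A0 [HA0 /bigsqP[w ws wA0]].
apply: (@atmost_inj _ _ (fun A => A * A0^-1)%g _ [set C | H C /\ n2 (cj w C) <= 6]).
- exact: mulgAr_inj.
- move=> A [HA /bigsqP[w' ws' wA]].
  have HAA : H (A * A0^-1)%g by apply: (HM) => //; exact: HV.
  split=> //.
  have E : mobius (A * A0^-1)%g (mobius A0 v) = mobius A v by rewrite -mobiusM mulgVK.
  have ww' : w = w' by apply: (ps w w' (A * A0^-1)%g (mobius A0 v)) => //; rewrite E.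
  rewrite n2_cj -ww' in wA *.
  have u1 := sq_hr_ud wA0; have u2 := sq_hr_ud wA.
  have u3 : ud (mobius (A * A0^-1)%g w) (mobius A v) <= 1 / 2500.
    by rewrite -E ud_mobius udC.
  have := ud_triangle (le_trans u3 _) (le_trans u2 _).
  by move: u2 u3; move: (ud _ _) (ud _ _) (ud _ _) => a b c; lra.
- apply: atmost_fibers => u [//|B [//|C t]] /= /andP[].
  rewrite inE negb_or => /andP[/eqP BC _] _ Hs.
  have [[HB nB] cB] := Hs B (mem_head _ _).
  have [|[HC nC] cC] := Hs C; first by rewrite !inE eqxx orbT.
  case: BC; apply/esym/(@mulgAr_inj _ (1%g)).
  have BC1 : (B^-1 * C = 1)%g.
    apply: (ts w ws); first by apply: (HM) => //; exact: HV.
    apply: le_lt_trans (n2_cj_quot _ _ _) _.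
    have := Hcell _ _ nC nB (etrans cC (esym cB)).
    have := n2_ge0 (cj w C - cj w B); have := n2_ge0 (cj w B).
    move: nB; move: (n2 _) (n2 _) => b a a6 a0 b0 b1.
    apply: (@le_lt_trans _ _ (6 * b)).
      exact: ler_wpM2r.
    by move: b1; lra.
  by rewrite !mulg1 -[C](mulVKg B) BC1 mulg1.
Qed.

Lemma packing_area H s : sgp H -> packing H hr s ->
  (((size s)%:R * hr ^+ 2)%:E <= hintS (\big[setU/set0]_(w <- s) sq w hr) (fun=> 1))%E.
Proof.
move=> sH; have [H1 _ _] := sH.
elim: s => [|w s IH] [us ts ps].
  by rewrite mul0r big_nil /hintS integral_set0.
have /IH h : packing H hr s.
  split; first by case/andP: us.
    by move=> v vs; apply: ts; rewrite inE vs orbT.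
  by move=> v v' A z vs vs'; apply: ps; rewrite inE ?vs ?vs' orbT.
rewrite big_cons /hintS ge0_integral_setU //.
- rewrite /= -natr1 mulrDl mul1r addrC EFinD; apply: leeD => //.
  exact: hintS_sq_ge.
- exact: measurable_sq.
- exact: measurable_bigsq.
- by apply: measurable_funTS; apply: measurable_hint.
- by move=> p _; apply: hdens_ge0.
- apply/disj_setPS => p [wp /bigsqP[w' ws' wp']].
  have [z zp] : exists z, coordH z = p.
    apply: coordH_surj; have [+ _] := sq_im hr2 wp; apply: lt_le_trans.
    by rewrite divr_gt0 // imH_gt0.
  have ww : w = w'.
    apply: (ps w w' 1%g z) => //; rewrite ?mem_head ?inE ?ws' ?orbT ?mobius1 ?zp //.
  by move: us; rewrite /= ww ws'.
Qed.

(** By [unfolding] the total area of a packing is at most [T] times the area of [F], which bounds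
    the number of squares. The centers of a largest packing form the cover: a thick point not close
    to any of them modulo [H] could be added. *)
Theorem finite_area_thick_cover H (F : set (UHP R)) : sgp H -> dsc H ->
  measurable (@coordH R @` F) -> (forall z, exists2 A, H A & F (mobius A z)) ->
  (hintS (@coordH R @` F) (fun=> 1) < +oo)%E -> thick_cover H.
Proof.
move=> sH dH mF cov fin; have [H1 HM HV] := sH.
have [T mult] := packing_multiplicity.
set a := hintS _ _ in fin.
have a0 : (0 <= a)%E by apply: integral_ge0 => p _; exact: hdens_ge0.
have aE : a = (fine a)%:E by rewrite fineK // ge0_fin_numE.
have hh : 0 < hr ^+ 2 by rewrite exprn_gt0 // /hr; lra.
have bnd s : packing H hr s -> (size s <= Num.trunc (T%:R * fine a / hr ^+ 2))%N.
  move=> ps; have h1 := packing_area sH ps.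
  have h2 : (hintS (\big[setU/set0]_(w <- s) sq w hr) (fun=> 1) <= T%:R%:E * a)%E.
    by apply: (unfolding sH dH mF cov) => //; [exact: measurable_bigsq|exact: mult].
  have h3 := le_trans h1 h2; rewrite [X in (_ * X)%E]aE -EFinM lee_fin -ler_pdivlMr // in h3.
  by rewrite truncn_ge_nat // mulr_ge0 ?invr_ge0 ?sqr_ge0 // mulr_ge0 // fine_ge0.
have [n /asboolP[s ps sn] max] : exists2 n, `[< exists2 s, packing H hr s & size s = n >] &
    forall m, `[< exists2 s, packing H hr s & size s = m >] -> (m <= n)%N.
  have ex : exists n, `[< exists2 s, packing H hr s & size s = n >].
    by exists 0%N; apply/asboolP; exists [::].
  have bd n : `[< exists2 s, packing H hr s & size s = n >] ->
      (n <= Num.trunc (T%:R * fine a / hr ^+ 2))%N.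
    by move=> /asboolP[s /bnd h <-].
  by case: (ex_maxnP ex bd) => n h1 h2; exists n.
exists s => w tw; apply: contrapT => nex.
have far w' A z : w' \in s -> H A -> sq w hr (coordH z) -> ~ sq w' hr (coordH (mobius A z)).
  move=> ws' HA wz wz'; apply: nex; exists A, w'; split=> //.
  have u1 : ud (mobius A w) (mobius A z) <= 1 / 2500 by rewrite ud_mobius udC; exact: sq_hr_ud.
  have u2 := sq_hr_ud wz'.
  have := ud_triangle (le_trans u1 _) (le_trans u2 _).
  by move: u1 u2; move: (ud _ _) (ud _ _) (ud _ _) => x y z'; lra.
have : packing H hr (w :: s).
  have [us ts pps] := ps; split.
  - rewrite /= us andbT; apply/negP => ws; apply: (far w 1%g w ws H1); rewrite ?mobius1; exact: sq_center.
  - by move=> v; rewrite inE => /orP[/eqP ->|/ts].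
  move=> v v' A z; rewrite !inE => /orP[/eqP ->|vs] /orP[/eqP ->|vs'] HA h1 h2 //.
  - by have := far v' A z vs' HA h1.
  - by have := far v A^-1%g (mobius A z) vs (HV _ HA) h2; rewrite mobiusK.
  - exact: (pps v v' A z).
move=> pws; suff /max : `[< exists2 s, packing H hr s & size s = n.+1 >] by rewrite ltnn.
by apply/asboolP; exists (w :: s); rewrite /= ?sn.
Qed.

End ThickCover.

(** * Local bounds for cusp forms *)

Section MeasurableContinuous.
Variable R : realType.

Definition popen (O : set (R * R)) := forall p, O p -> exists2 r : R, 0 < r &
  forall q, `|q.1 - p.1| < r -> `|q.2 - p.2| < r -> O q.

(** The product structure on [R * R] is generated by rectangles, so an open set is exhibited as the
    countable union of the boxes with rational centers and half-sides [1 / (n + 1)] that it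
    contains. *)
Lemma popen_measurable O : popen O -> measurable O.
Proof.
move=> HO.
pose box (u : rat * rat * nat) : set (R * R) :=
  `]ratr u.1.1 - u.2.+1%:R^-1, ratr u.1.1 + u.2.+1%:R^-1[ `*`
  `]ratr u.1.2 - u.2.+1%:R^-1, ratr u.1.2 + u.2.+1%:R^-1[.
pose B (n : nat) : set (R * R) :=
  if (unpickle n : option (rat * rat * nat)) is Some u then
    if `[< box u `<=` O >] then box u else set0 else set0.
have -> : O = \bigcup_n B n.
  apply/seteqP; split=> [[x y] Op|p [n _]]; last first.
    rewrite /B; case: unpickle => [u|//]; case: ifPn => // /asboolP; exact.
  have [r r0 Hr] := HO _ Op.
  have [n nr] : exists n : nat, n.+1%:R^-1 < r / 2.
    exists (Num.trunc (2 / r)); rewrite invf_plt ?posrE ?divr_gt0 ?ltr0n // invf_div.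
    exact: truncnS_gt.
  have n0 : 0 < n.+1%:R^-1 :> R by rewrite invr_gt0 ltr0n.
  have near_rat (t : R) : exists q : rat, t - n.+1%:R^-1 < ratr q < t + n.+1%:R^-1.
    have [|q] := @rat_in_itvoo R (t - n.+1%:R^-1) (t + n.+1%:R^-1).
      by move: n0; move: (_^-1) => d; lra.
    by rewrite in_itv; exists q.
  have [p Hp] := near_rat x; have [q Hq] := near_rat y.
  pose u : rat * rat * nat := (p, q, n).
  exists (pickle u); first exact: I.
  rewrite /B (pickleK u).
  have bO : box u `<=` O.
    move=> [x' y']; rewrite /box /u /=; rewrite !in_itv /= => -[/andP[a1 a2] /andP[b1 b2]].
    by apply: Hr => /=; rewrite ltr_norml; apply/andP; move: Hp Hq nr a1 a2 b1 b2;
       move: (_^-1) => d /andP[? ?] /andP[? ?] *; split; lra.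
  rewrite (asboolT bO) /box /u /= !in_itv /=.
  by move: Hp Hq; move: (_^-1) => d /andP[? ?] /andP[? ?]; split; apply/andP; split; lra.
apply: bigcupT_measurable => n; rewrite /B.
case: unpickle => [u|]; last exact: measurable0.
case: ifP => _; last exact: measurable0.
by apply: measurableX; exact: measurable_itv.
Qed.

Lemma measurable_superlevel (g : R * R -> R) : (forall p, 0 <= g p) ->
  (forall a : R, 0 <= a -> popen [set p | a < g p]) -> measurable_fun [set: R * R] g.
Proof.
move=> g0 Hg; apply: (measurability _ (RGenOInfty.measurableE R)) => // _ [_ [x ->] <-].
have [x0|x0] := ltP x 0.
  have -> : g @^-1` `]x, +oo[ = setT.
    by apply/seteqP; split=> // p _ /=; rewrite in_itv /= andbT (lt_le_trans x0).
  by rewrite setTI; exact: measurableT.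
rewrite setTI; have -> : g @^-1` `]x, +oo[ = [set p | x < g p].
  by apply/seteqP; split=> p /=; rewrite in_itv /= andbT.
by apply: popen_measurable; exact: Hg.
Qed.

End MeasurableContinuous.

(** * The invariant mass of a form and the local mean value bound *)

Section HalfPlaneFunctions.
Variable R : realType.
Implicit Types (f : UHP R -> R[i]) (z w : UHP R) (k : nat) (p : R * R).

Definition ext f : R[i] -> R[i] := valL_ (0 : R[i]) f.

Lemma extE f z : ext f (val z) = f z.
Proof. exact: (congr1 (fun g : UHP R -> R[i] => g z) (valLK (0 : R[i]) f)). Qed.

Lemma ext_mk f (x y : R) (y0 : 0 < y) : ext f (x +i* y)%C = f (mkUHP x y0).
Proof. by rewrite -extE. Qed.

Lemma holomorphic_cdifferentiable f (x y : R) : holomorphicH f -> 0 < y ->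
  cdifferentiable (ext f) (x +i* y)%C.
Proof. by move=> hf y0; exact: (derivable_cdifferentiable (hf (mkUHP x y0))). Qed.

Lemma ccont_plane (F : R[i] -> R[i]) x y : ccont F (x +i* y)%C ->
  forall e : R, 0 < e -> exists2 r : R, 0 < r & forall x' y' : R, `|x' - x| < r -> `|y' - y| < r ->
    nc (F (x' +i* y')%C - F (x +i* y)%C) < e.
Proof.
move=> H e /H[r r0 Hr]; exists (r / 2); first by rewrite divr_gt0.
move=> x' y' hx hy; apply: Hr; apply: le_lt_trans (nc_le_ReIm _) _ => /=.
by rewrite [ltRHS](splitr r); apply: ltrD.
Qed.

Definition sqmod f p : R := if 0 < p.2 then nc (ext f (p.1 +i* p.2)%C) ^+ 2 else 0.

Lemma sqmod_ge0 f p : 0 <= sqmod f p.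
Proof. by rewrite /sqmod; case: ifP => // _; exact: sqr_ge0. Qed.

Lemma measurable_sqmod f : holomorphicH f -> measurable_fun [set: R * R] (sqmod f).
Proof.
move=> hf; apply: measurable_superlevel; first exact: sqmod_ge0.
move=> a a0 [x y] /=; rewrite {1}/sqmod /=; case: ifP => [y0 ay|_ /(le_lt_trans a0)]; last by rewrite ltxx.
have cf := cdiff_ccont (holomorphic_cdifferentiable x hf y0).
set c := nc _ in ay.
have c0 : 0 <= c by exact: nc_ge0.
have [e e0 ce] : exists2 e : R, 0 < e & forall t : R, c - e < t -> a < t ^+ 2.
  exists (c - Num.sqrt a).
    rewrite subr_gt0 -(ger0_norm c0) -sqrtr_sqr ltr_sqrt // (le_lt_trans a0) //.
  move=> t; rewrite opprB addrCA subrr addr0 => at_.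
  by rewrite -(sqr_sqrtr a0) ltrXn2r // (le_lt_trans _ at_) // sqrtr_ge0.
have [r r0 Hr] := ccont_plane cf e0.
exists (Num.min r y); first by rewrite lt_min r0.
move=> [x' y'] /=; rewrite !lt_min => /andP[xr _] /andP[yr yy]; rewrite /sqmod /=.
have y'0 : 0 < y' by move: yy; rewrite ltr_distl => /andP[]; rewrite subrr.
rewrite y'0; apply: ce; have := Hr x' y' xr yr.
have := nc_le_sub (ext f (x' +i* y')%C) (ext f (x' +i* y')%C - ext f (x +i* y)%C).
rewrite opprB addrC subrK -/c => h1 h2.
by move: h1 h2; move: (nc _) (nc _) => u v; lra.
Qed.

Definition mass f k p : R := sqmod f p * p.2 ^+ (2 * k).

Lemma mass_ge0 f k p : 0 <= mass f k p.
Proof.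
rewrite /mass /sqmod; case: ifP => p0; last by rewrite mul0r.
by rewrite mulr_ge0 ?sqr_ge0 // exprn_ge0 // ltW.
Qed.

Lemma measurable_mass f k : holomorphicH f -> measurable_fun [set: R * R] (mass f k).
Proof.
move=> hf; apply: measurable_funM; first exact: measurable_sqmod.
by apply: measurable_funX; exact: measurable_snd.
Qed.

Lemma mass_coordH f k z : mass f k (coordH z) = nc (f z) ^+ 2 * imH z ^+ (2 * k).
Proof. by rewrite /mass /sqmod /= imH_gt0 -val_UHP extE. Qed.

Lemma mass_invariant f k A p : (forall z, f (mobius A z) = automorphy A z ^+ (2 * k) * f z) ->
  0 < p.2 -> mass f k (mobR A p) = mass f k p.
Proof.
move=> Hf /coordH_surj[z <-]; rewrite -coordH_mobius !mass_coordH Hf mobius_im.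
have d0 := den_gt0 A z.
rewrite Normc.normcM ncX exprMn -exprM mulnC exprM nc_automorphy expr_div_n.
by move: (nc (f z)) => u; rewrite -!mulrA; field; rewrite expf_neq0 // gt_eqF.
Qed.

(** A form of Bernoulli's inequality that yields an upper bound for [(1 + x) ^+ n] when
    [n x < 1]. *)
Lemma expr_one_plus_le (x : R) n : 0 <= x -> (1 + x) ^+ n * (1 - n%:R * x) <= 1.
Proof.
move=> x0; elim: n => [|n IH]; first by rewrite mul0r subr0 expr0 mulr1.
apply: le_trans IH; rewrite exprSr -mulrA; apply: ler_wpM2l.
  by rewrite exprn_ge0 // addr_ge0.
have -> : (1 + x) * (1 - n.+1%:R * x) = 1 - n%:R * x - n.+1%:R * x ^+ 2.
  by rewrite -natr1; ring.
by rewrite gerBl mulr_ge0 // sqr_ge0.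
Qed.

(* Half the side of the squares, relative to the height of their center. *)
Definition rk k : R := (8 * Num.sqrt k%:R)^-1.

Lemma rk_bounds k : (0 < k)%N -> [/\ 0 < rk k, rk k <= 1 / 2 & rk k ^+ 2 = (64 * k%:R)^-1].
Proof.
move=> k0; have s1 : 1 <= Num.sqrt (k%:R : R) by rewrite -[leLHS]sqrtr1 ler_sqrt ?ler0n ?ltr0n ?ler1n.
have s0 : 0 < Num.sqrt (k%:R : R) by apply: lt_le_trans s1.
split; first by rewrite invr_gt0 mulr_gt0.
  apply: (@le_trans _ _ (8^-1 * 1)); last lra.
  by rewrite /rk invfM; apply: ler_wpM2l; [rewrite invr_ge0|rewrite invf_le1].
by rewrite /rk exprVn exprMn sqr_sqrtr // -natrX.
Qed.

(* The square mean value inequality for [f^2 (z - conj z0)^(4k)]: on the square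
   [|z - conj z0|^2 = 4 y y0 (1 + ud z z0)] is comparable to [4 y y0]. *)
Theorem local_bound f k z : (0 < k)%N -> holomorphicH f ->
  ((nc (f z) ^+ 2 * imH z ^+ (2 * k))%:E <=
    (48 * 48 * k%:R)%:E * hintS (sq z (rk k)) (fun p => (mass f k p)%:E))%E.
Proof.
move=> k0 hf; have [r0 r2 rE] := rk_bounds k0.
set x0 := reH z; set y0 := imH z; have yp : 0 < y0 := imH_gt0 z.
pose rho := rk k * y0; have rho0 : 0 < rho by rewrite mulr_gt0.
pose q p := ((p.1 - x0) ^+ 2 + (p.2 + y0) ^+ 2) ^+ (2 * k).
pose h p := sqmod f p * q p.
pose F (w : R[i]) := ext f w ^+ 2 * (w - (x0 +i* - y0)%C) ^+ (4 * k).
have cQ : csq x0 y0 rho = sq z (rk k) by [].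
have im_pos p : sq z (rk k) p -> 0 < p.2.
  by move=> /(sq_im r2)[+ _]; apply: lt_le_trans; rewrite divr_gt0.
have q0 p : 0 <= q p by rewrite exprn_ge0 // addr_ge0 ?sqr_ge0.
have HF x y : csq x0 y0 rho (x, y) -> cdifferentiable F (x +i* y)%C.
  rewrite cQ => /im_pos /= ypos.
  have [d1 D1] := cdifferentiableX 2 (holomorphic_cdifferentiable x hf ypos).
  have [|d2 D2] := @cdifferentiableX R (fun w : R[i] => w + - (x0 +i* - y0)%C) (x +i* y)%C (4 * k).
    by eexists; apply: cdiffD; [exact: cdiff_id|exact: cdiff_cst].
  by eexists; exact: cdiffM D1 D2.
have mh : measurable_fun [set: R * R] h.
  apply: measurable_funM; first exact: measurable_sqmod.
  apply: measurable_funX; apply: measurable_funD; apply: measurable_funX.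
    by apply: measurable_funB => //; exact: measurable_fst.
  by apply: measurable_funD => //; exact: measurable_snd.
have h0 p : 0 <= h p by rewrite mulr_ge0 // sqmod_ge0.
have hF x y : csq x0 y0 rho (x, y) -> h (x, y) = nc (F (x +i* y)%C).
  rewrite cQ => /im_pos /= ypos.
  rewrite /h /sqmod /= ypos /F Normc.normcM !ncX; congr (_ * _).
  have -> : (4 * k = 2 * (2 * k))%N by rewrite mulnA.
  by rewrite [in RHS]exprM nc_sqr /q ReD ImD /= opprK.
have := submean_square rho0 HF mh h0 hF; rewrite cQ => main.
have hc : h (x0, y0) = nc (f z) ^+ 2 * (4 * y0 ^+ 2) ^+ (2 * k).
  rewrite /h /sqmod /= yp -val_UHP extE /q /=; congr (_ * _ ^+ _); ring.
have hle p : sq z (rk k) p -> h p <= mass f k p * (2 * (4 * y0) ^+ (2 * k)).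
  move=> Qp; have pp := im_pos _ Qp.
  rewrite /h /mass -[leRHS]mulrA; apply: ler_wpM2l; first exact: sqmod_ge0.
  have [w wp] := coordH_surj pp.
  have ux : ud w z <= (64 * k%:R)^-1 by rewrite -rE; apply: (sq_ud (ltW r0) r2); rewrite wp.
  have B : (p.1 - x0) ^+ 2 + (p.2 + y0) ^+ 2 = 4 * p.2 * y0 * (1 + ud w z).
    rewrite udE -wp /= -/x0 -/y0; have w0 := imH_gt0 w.
    by field; rewrite !gt_eqF.
  rewrite /q B.
  have k1 : (0 : R) < k%:R by rewrite ltr0n.
  have -> : p.2 ^+ (2 * k) * (2 * (4 * y0) ^+ (2 * k)) = (4 * p.2 * y0) ^+ (2 * k) * 2.
    by rewrite !exprMn; ring.
  rewrite exprMn; apply: ler_wpM2l; first by rewrite exprn_ge0 // !mulr_ge0 // ltW.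
  (* Here [n x = 2 k / (64 k) = 1 / 32], so the power is at most [32 / 31], well below the factor
     [2] allowed for in [hle]. *)
  have := @expr_one_plus_le (64 * k%:R)^-1 (2 * k) _.
  rewrite natrM (_ : 1 - _ = 31 / 32); last by field; rewrite gt_eqF.
  rewrite invr_ge0 mulr_ge0 ?ler0n // => /(_ isT) h1.
  apply: le_trans (_ : (1 + (64 * k%:R)^-1) ^+ (2 * k) <= _).
    by apply: lerXn2r; rewrite ?nnegrE ?lerD2l // addr_ge0 ?ud_ge0 ?invr_ge0 ?mulr_ge0 ?ler0n.
  by move: h1; move: (_ ^+ _) => t; lra.
set c := 2 * (4 * y0) ^+ (2 * k) in hle.
have c0 : 0 < c by rewrite mulr_gt0 // exprn_gt0 // mulr_gt0.
have step : (\int[@lebesgue2 R]_(p in sq z (rk k)) (h p)%:E <=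
    (c * (3 / 2 * y0) ^+ 2)%:E * hintS (sq z (rk k)) (fun p => (mass f k p)%:E))%E.
  have mm : measurable_fun [set: R * R] (hdens (fun p => (mass f k p)%:E)).
    by apply: measurable_hint; apply/measurable_EFinP; exact: measurable_mass.
  have C0 : 0 <= c * (3 / 2 * y0) ^+ 2 by rewrite mulr_ge0 ?sqr_ge0 // ltW.
  rewrite /hintS -ge0_integralZl //; last 3 first.
  - exact: measurable_sq.
  - exact: measurable_funTS.
  - by move=> p _; apply: hdens_ge0 => q'; rewrite lee_fin mass_ge0.
  apply: ge0_le_integral => //.
  - exact: measurable_sq.
  - by move=> p _; rewrite lee_fin.
  - by apply: measurable_funTS; apply/measurable_EFinP.
  - by apply: measurable_funTS; apply: emeasurable_funM.
  move=> p Qp; have pp := im_pos _ Qp; rewrite /hdens pp -!EFinM lee_fin.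
  apply: le_trans (hle _ Qp) _.
  have -> : c * (3 / 2 * y0) ^+ 2 * (mass f k p / p.2 ^+ 2) =
    mass f k p * c * ((3 / 2 * y0) ^+ 2 / p.2 ^+ 2) by ring.
  rewrite -[leLHS]mulr1; apply: ler_wpM2l; first by rewrite mulr_ge0 ?mass_ge0 // ltW.
  rewrite ler_pdivlMr ?exprn_gt0 // mul1r; have [_ p2] := sq_im r2 Qp.
  by apply: lerXn2r => //; rewrite nnegrE ltW // mulr_gt0.
have p8 : (0 <= 8%:E :> \bar R)%E by rewrite lee_fin.
have {step}main := le_trans main (lee_wpmul2l p8 step).
move: main; set I := hintS _ _.
have I0 : (0 <= I)%E by apply: integral_ge0 => p _; apply: hdens_ge0 => q'; rewrite lee_fin mass_ge0.
have k1 : (0 : R) < k%:R by rewrite ltr0n.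
rewrite muleA -EFinM => {}main; move: main.
(* Comparing [e1] with [e2] produces [18 * (16 * 8) = 48 * 48]. *)
have e1 : rho ^+ 2 * h (x0, y0) = y0 ^+ 2 * c * ((nc (f z) ^+ 2 * y0 ^+ (2 * k)) / (16 * 8 * k%:R)).
  rewrite hc /rho exprMn rE /c.
  have -> : (4 * y0 ^+ 2) ^+ (2 * k) = (4 * y0) ^+ (2 * k) * y0 ^+ (2 * k) by rewrite -exprMn; congr (_ ^+ _); ring.
  by field; rewrite gt_eqF.
have e2 : 8 * (c * (3 / 2 * y0) ^+ 2) = y0 ^+ 2 * c * 18 by field.
have e0 : 0 < y0 ^+ 2 * c by rewrite mulr_gt0 ?exprn_gt0.
rewrite e1 e2; move: I I0 => [i| |] // I0; last by move=> _; rewrite gt0_muley ?leey ?lte_fin ?mulr_gt0.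
rewrite -!EFinM !lee_fin -[_ * 18 * i]mulrA ler_pM2l // ler_pdivrMr ?mulr_gt0 //.
by have -> : 18 * i * (16 * 8 * k%:R) = 48 * 48 * k%:R * i by ring.
Qed.

End HalfPlaneFunctions.

(** * Decay in the cusps *)

Section ComplexExponential.
Variable R : realType.
Notation pi := (@trigo.pi R).
Implicit Types (z w : R[i]) (x y : R).

(** This is [exp (2 pi i z)], split into real and imaginary parts. *)
Definition cexp z : R[i] :=
  ((expR (- (2 * pi * Im z)) * cos (2 * pi * Re z)) +i*
   (expR (- (2 * pi * Im z)) * sin (2 * pi * Re z)))%C.

Lemma cexp0 : cexp 0 = 1.
Proof.
rewrite /cexp /= !mulr0 oppr0 expR0 cos0 sin0 mulr0 mulr1.
by apply/eqP; rewrite eq_complex /= !eqxx.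
Qed.

Lemma cexpD z w : cexp (z + w) = cexp z * cexp w.
Proof.
rewrite /cexp ReD ImD !mulrDr opprD expRD cosD sinD.
move: (expR _) (expR _) (cos _) (cos _) (sin _) (sin _) => a b c d e f.
by apply/eqP; rewrite eq_complex ReM ImM /=; apply/andP; split; apply/eqP; ring.
Qed.

Lemma nc_cexp z : nc (cexp z) = expR (- (2 * pi * Im z)).
Proof.
apply/eqP; rewrite -(@eqrXn2 _ 2) ?nc_ge0 ?expR_ge0 // nc_sqr /cexp /=.
by rewrite !exprMn -mulrDr cos2Dsin2 mulr1.
Qed.

Lemma cexp_period z : cexp (z + 1) = cexp z.
Proof.
rewrite cexpD [X in _ * X](_ : _ = 1) ?mulr1 // /cexp /= mulr0 oppr0 expR0 !mul1r mulr1.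
have -> : 2 * pi = pi *+ 2 :> R by rewrite mulr_natl.
by rewrite cos2pi sin2pi.
Qed.

Lemma cexp_eq1 z : `|Re z| <= 1 / 2 -> cexp z = 1 -> z = 0.
Proof.
move=> hz E; have p0 := pi_gt0 R.
have := congr1 (fun u => nc u) E; rewrite nc_cexp Normc.normc1 => N.
have Iz : Im z = 0.
  have : - (2 * pi * Im z) = 0 by apply: expR_inj; rewrite expR0.
  by move/eqP; rewrite oppr_eq0 !mulf_eq0 (gt_eqF p0) pnatr_eq0 /= => /eqP.
have C : cos (2 * pi * Re z) = 1.
  by have := congr1 (fun u => Re u) E; rewrite /cexp /= -/(Im z) N mul1r.
have nn : `|2 * pi * Re z| = 2 * pi * `|Re z|.
  by rewrite normrM gtr0_norm // mulr_gt0.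
have : `|2 * pi * Re z| = 0.
  apply: cos_inj.
  - rewrite in_itv /= normr_ge0 nn /=.
    have h : 2 * pi * `|Re z| <= 2 * pi * (1 / 2) by apply: ler_wpM2l => //; rewrite ltW // mulr_gt0.
    by apply: le_trans h _; rewrite mulrA mulr1 mulrAC divff ?mul1r // pnatr_eq0.
  - by rewrite in_itv /= lexx ltW.
  by rewrite cos_norm C cos0.
move/normr0_eq0/eqP; rewrite !mulf_eq0 (gt_eqF p0) pnatr_eq0 /= => /eqP Rz.
by rewrite (complex_split z) Rz Iz.
Qed.

Lemma is_derive_eps (f : R -> R) (d : R) : is_derive (0 : R) 1 f d -> forall e, 0 < e ->
  exists2 r : R, 0 < r & forall h, `|h| < r -> `|f h - f 0 - d * h| <= e * `|h|.
Proof.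
move=> [df fd] e e0.
have : h^-1 *: (f (h *: 1 + 0) - f 0) @[h --> 0^'] --> d by rewrite -fd; exact: df.
move/cvgrPdist_le/(_ _ e0); rewrite /= /dnbhs /within /=; move=> [r /= r0 H].
exists r => // h hr; have [->|h0] := eqVneq h 0; first by rewrite subrr mulr0 subr0 normr0 mulr0.
have := H h; rewrite /= sub0r normrN => /(_ hr h0).
rewrite addr0 /GRing.scale /= mulr1 => h1.
have -> : f h - f 0 - d * h = - (d - h^-1 * (f h - f 0)) * h by field.
by rewrite normrM normrN ler_wpM2r.
Qed.

(** The derivative is computed at 0 only, from those of the real functions [expR], [cos] and [sin];
    [cdifferentiable_cexp_shift] moves it to other points by [cexpD]. *)
Lemma cdiff_cexp0 : cdiff cexp 0 (0 +i* (2 * pi))%C.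
Proof.
move=> e e0; have p0 := pi_gt0 R; pose t : R := 2 * pi.
have t0 : 0 < t by rewrite mulr_gt0.
pose u := Num.min 1 (e / (8 * t + 8 * t ^+ 2 + 1)).
have K0 : 0 < 8 * t + 8 * t ^+ 2 + 1 by rewrite !addr_gt0 ?mulr_gt0 ?exprn_gt0.
have u0 : 0 < u by rewrite lt_min ltr01 divr_gt0.
have u1 : u <= 1 by rewrite ge_min lexx.
have uK : u * (8 * t + 8 * t ^+ 2 + 1) <= e by rewrite -ler_pdivlMr // ge_min lexx orbT.
have dE : is_derive (0 : R) 1 (@expR R) 1 by have := is_derive_expR (0 : R); rewrite expR0.
have dC : is_derive (0 : R) 1 (@cos R) 0 by have := is_derive_cos (0 : R); rewrite sin0 oppr0.
have dS : is_derive (0 : R) 1 (@sin R) 1 by have := is_derive_sin (0 : R); rewrite cos0.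
have [r1 r10 H1] := is_derive_eps dE u0.
have [r2 r20 H2] := is_derive_eps dC u0.
have [r3 r30 H3] := is_derive_eps dS u0.
pose r := Num.min (Num.min r1 r2) (Num.min r3 (u / 2)).
have r0 : 0 < r by rewrite !lt_min r10 r20 r30 divr_gt0.
exists (r / t); first by rewrite divr_gt0.
move=> w; rewrite subr0 cexp0 => wr.
set a := Re w; set b := Im w; set m := nc w.
have m0 : 0 <= m by exact: nc_ge0.
have am : `|a| <= m by exact: Re_le_nc. 
have bm : `|b| <= m by exact: Im_le_nc.
have tm : t * m < r by rewrite mulrC -ltr_pdivlMr.
have Na : `|t * a| <= t * m by rewrite normrM gtr0_norm // ler_pM2l.
have Nb : `|- (t * b)| <= t * m by rewrite normrN normrM gtr0_norm // ler_pM2l.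
have tm1 : t * m < r1 /\ t * m < r2.
  by split; apply: lt_le_trans tm _; rewrite /r !ge_min lexx ?orbT.
have tm3 : t * m < r3 /\ t * m < u / 2.
  by split; apply: lt_le_trans tm _; rewrite /r !ge_min lexx ?orbT.
have {H1}H1 := H1 _ (le_lt_trans Nb tm1.1); have {H2}H2 := H2 _ (le_lt_trans Na tm1.2).
have {H3}H3 := H3 _ (le_lt_trans Na tm3.1); have tmu := tm3.2.
rewrite expR0 in H1; rewrite cos0 mul0r subr0 in H2; rewrite sin0 subr0 in H3.
pose E := expR (- (t * b)); pose C := cos (t * a); pose S := sin (t * a).
rewrite -/E -/C -/S in H1 H2 H3.
have {}H1 : `|E - 1 + t * b| <= u * (t * m).
  rewrite (_ : E - 1 + t * b = E - 1 - 1 * - (t * b)); last by ring.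
  by apply: le_trans H1 _; rewrite ler_pM2l.
have {}H2 : `|C - 1| <= u * (t * m) by apply: le_trans H2 _; rewrite ler_pM2l.
have {}H3 : `|S - t * a| <= u * (t * m).
  by rewrite mul1r in H3; apply: le_trans H3 _; rewrite ler_pM2l.
have tmge : 0 <= t * m by rewrite mulr_ge0 // ltW.
have E1 : `|E - 1| <= u.
  have -> : E - 1 = (E - 1 + t * b) + - (t * b) by ring.
  apply: le_trans (ler_normD _ _) _; apply: le_trans (lerD H1 Nb) _.
  have : u * (t * m) <= 1 * (t * m) by apply: ler_wpM2r.
  by move: tmu; move: (t * m) => q; lra.
have E2 : `|E| <= 2.
  have -> : E = (E - 1) + 1 by ring.
  by apply: le_trans (ler_normD _ _) _; rewrite normr1; move: E1 u1; lra.
have X1 : `|E * C - 1 + t * b| <= 3 * (u * (t * m)).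
  have -> : E * C - 1 + t * b = E * (C - 1) + (E - 1 + t * b) by ring.
  apply: le_trans (ler_normD _ _) _; rewrite normrM.
  have : `|E| * `|C - 1| <= 2 * (u * (t * m)) by apply: ler_pM.
  by move: H1; move: (u * _) => q; lra.
have X2 : `|E * S - t * a| <= 3 * (u * (t * m)).
  have -> : E * S - t * a = E * (S - t * a) + (E - 1) * (t * a) by ring.
  apply: le_trans (ler_normD _ _) _; rewrite (normrM E) (normrM (E - 1)).
  have : `|E| * `|S - t * a| <= 2 * (u * (t * m)) by apply: ler_pM.
  have : `|E - 1| * `|t * a| <= u * (t * m) by apply: ler_pM.
  by move: (u * _) => q; lra.
have Z : cexp w - 1 - (0 +i* (2 * pi))%C * w = ((E * C - 1 + t * b) +i* (E * S - t * a))%C.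
  apply/eqP; rewrite eq_complex !ReD !ImD !ReN !ImN ReM ImM /cexp /= -/a -/b -/t -/E -/C -/S.
  by apply/andP; split; apply/eqP; ring.
rewrite Z; apply: le_trans (nc_le_ReIm _) _ => /=.
apply: le_trans (lerD X1 X2) _.
have -> : 3 * (u * (t * m)) + 3 * (u * (t * m)) = (u * (6 * t)) * m by ring.
apply: ler_wpM2r => //; apply: le_trans uK; rewrite ler_pM2l //.
by have := sqr_ge0 t; move: t0; move: (t ^+ 2) => q; lra.
Qed.

Lemma cdifferentiable_cexp_shift z0 z : cdifferentiable (fun w => cexp (w - z0)) z.
Proof.
have -> : (fun w => cexp (w - z0)) = (fun w => cexp (z - z0) * (cexp \o (fun w => w + - z)) w).
  by apply/funext => w /=; rewrite -cexpD; congr cexp; ring.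
eexists; apply: cdiffM; first exact: cdiff_cst.
apply: cdiff_comp; first by apply: cdiffD; [exact: cdiff_id|exact: cdiff_cst].
by rewrite /= subrr; exact: cdiff_cexp0.
Qed.

(* [|2 pi i| >= 2], so [cexp w - 1] dominates [w] near [0]. *)
Lemma cexp_sub1_ge : exists2 r : R, 0 < r & forall w, nc w < r -> nc w <= nc (cexp w - 1).
Proof.
have [r r0 H] := cdiff_cexp0 ltr01; exists r => // w; have := H w; rewrite subr0 cexp0 mul1r => {}H /H.
have p2 := pi_ge2 R.
have := nc_le_sub (cexp w - 1) (cexp w - 1 - (0 +i* (2 * pi))%C * w).
rewrite opprB addrC subrK Normc.normcM.
have -> : nc (0 +i* (2 * pi))%C = 2 * pi.
  transitivity (Num.sqrt ((0 : R) ^+ 2 + (2 * pi) ^+ 2)); first by [].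
  rewrite expr0n add0r sqrtr_sqr gtr0_norm //.
  by rewrite mulr_gt0 // pi_gt0.
move=> h1 h2; have : 2 * nc w <= 2 * pi * nc w.
  by apply: ler_wpM2r; [exact: nc_ge0|lra].
by move: h1 h2; move: (2 * pi * nc w) (nc w) (nc _) (nc _) => *; lra.
Qed.

End ComplexExponential.

(** * Exponential decay of periodic functions *)

Section PeriodicDecay.
Variable R : realType.
Implicit Types (z w : R[i]) (x y : R) (g : R[i] -> R[i]).

Lemma expR4_ge16 : 16 <= expR 4 :> R.
Proof.
have h := @expR_ge1Dx R 1.
have -> : 4 = 4%:R * 1 :> R by rewrite mulr1.
rewrite expRM_natl; have -> : 16 = 2 ^+ 4 :> R by ring.
by apply: lerXn2r; rewrite ?nnegrE ?expR_ge0 //; move: h; lra.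
Qed.

Lemma bd_periodic (F : R[i] -> R[i]) a b c d : c <= d ->
  (forall y, c <= y <= d -> F (b +i* y)%C = F (a +i* y)%C) ->
  bd F a b c d = cint a b (fun x => F (x +i* c)%C - F (x +i* d)%C).
Proof.
move=> cd H; rewrite /bd [X in _ + _ * X](_ : _ = 0) ?mulr0 ?addr0 //.
have := @cint_cst R c d 0 cd; rewrite mul0r => <-.
by apply: eq_cint => y /H ->; rewrite subrr.
Qed.

(* Cauchy's formula with the kernel [1 / (exp (2 pi i (w - z0)) - 1)] on a strip
   of width one: the vertical sides cancel, and the kernel is of size
   [exp (- 2 pi (eta - Y))] on the bottom side. *)
Theorem periodic_decay g (Y M xi eta : R) : 0 < Y -> Y + 1 <= eta ->
  (forall x y, 0 < y -> cdifferentiable g (x +i* y)%C) ->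
  (forall x y, 0 < y -> g ((x + 1) +i* y)%C = g (x +i* y)%C) ->
  (forall e, 0 < e -> exists Y0 : R, forall x y, 0 < y -> Y0 < y -> nc (g (x +i* y)%C) < e) ->
  (forall x, nc (g (x +i* Y)%C) <= M) ->
  nc (g (xi +i* eta)%C) <= 8 * M * expR (- (4 * (eta - Y))).
Proof.
move=> Y0 Yeta dg pg lg bg; set z0 := (xi +i* eta)%C.
have M0 : 0 <= M by apply: le_trans (bg 0); exact: nc_ge0.
have p2 := pi_ge2 R.
pose P : R := expR (2 * @trigo.pi R * (eta - Y)).
have P4 : expR (4 * (eta - Y)) <= P.
  rewrite ler_expR; apply: ler_wpM2r; first lra.
  by move: p2; move: (@trigo.pi R) => q; lra.
have P16 : 16 <= P.
  by apply: le_trans P4; apply: le_trans expR4_ge16 _; rewrite ler_expR; lra.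
have PV : P^-1 <= expR (- (4 * (eta - Y))).
  by rewrite expRN lef_pV2 ?posrE ?expR_gt0 //; lra.
apply/ler_addgt0Pr => e0 e00; pose e := e0 / 8; have e8 : 0 < e by rewrite divr_gt0.
have e0E : e0 = 8 * e by rewrite /e; field.
clearbody e.
have [T HT] := lg e e8.
(* The top side is placed where [g] is already below [e], and far enough above [eta] for the kernel
   to be close to [-1]. *)
pose Y2 := Num.max (T + 1) (eta + 2).
have Y2e : eta + 2 <= Y2 by rewrite le_max lexx orbT.
have Y2T : T < Y2.
  have : T + 1 <= Y2 by rewrite le_max lexx.
  by move: Y2 {Y2e} => q; lra.
clearbody Y2.
pose a := xi - 1 / 2; pose b := xi + 1 / 2.
have ab : a <= b by rewrite /a /b; lra.
have ba1 : b - a = 1 by rewrite /a /b; field.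
have axb : a < xi < b by rewrite /a /b; apply/andP; split; lra.
have YY : Y < eta < Y2 by apply/andP; split; lra.
have cd : Y <= Y2 by lra.
pose k w := (cexp (w - z0) - 1)^-1.
have knz x y : a <= x <= b -> (x +i* y)%C != z0 -> cexp ((x +i* y)%C - z0) - 1 != 0.
  move=> hx; apply: contra_neq => /eqP; rewrite subr_eq0 => /eqP E.
  apply/eqP; rewrite -subr_eq0; apply/eqP; apply: cexp_eq1 E.
  rewrite ReD ReN /= ler_norml; move: hx; rewrite /a /b => /andP[? ?].
  by apply/andP; split; lra.
have dk x y : a <= x <= b -> Y <= y <= Y2 -> (x +i* y)%C != z0 -> cdifferentiable k (x +i* y)%C.
  move=> hx hy hz; have [d D] := cdifferentiable_cexp_shift z0 (x +i* y)%C.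
  eexists; apply: cdiffV; first exact: (knz x y hx hz).
  apply: cdiffD D _; exact: cdiff_cst.
have [r r0 Hr] := cexp_sub1_ge R.
have kM w : w != z0 -> nc (w - z0) < r -> nc (k w) * nc (w - z0) <= 1.
  move=> wz /Hr h; have w0 : 0 < nc (w - z0) by rewrite nc_gt0 subr_eq0.
  rewrite /k Normc.normcV mulrC ler_pdivrMr ?mul1r //.
  exact: lt_le_trans h.
have dg' x y : a <= x <= b -> Y <= y <= Y2 -> cdifferentiable g (x +i* y)%C.
  by move=> _ /andP[h _]; apply: dg; apply: lt_le_trans h.
have K := @cauchy_kernel R g k a b Y Y2 xi eta 1 r axb YY dg' dk r0 kM.
have kper y : k (b +i* y)%C = k (a +i* y)%C.
  rewrite /k; congr ((_ - 1)^-1); rewrite -[RHS]cexp_period; congr cexp.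
  by apply/eqP; rewrite eq_complex /= /a /b; apply/andP; split; apply/eqP; field.
have gper y : Y <= y <= Y2 -> g (b +i* y)%C = g (a +i* y)%C.
  move=> /andP[h _]; rewrite -[RHS]pg ?(lt_le_trans Y0) //; congr (g (_ +i* _)%C).
  by rewrite /a /b; field.
rewrite (bd_periodic (F := fun w => g w * k w)) // in K; last by move=> y hy; rewrite gper // kper.
rewrite (bd_periodic (F := k)) // in K.
have kL : off_lines k a b Y Y2 by apply: off_center_lines axb YY _ => x y hx hy hz; exact/cdiff_ccont/dk.
have gkL : off_lines (fun w => g w * k w) a b Y Y2.
  apply: off_center_lines axb YY _ => x y hx hy hz.
  by apply: ccontM; apply/cdiff_ccont; [exact: dg'|exact: dk].
have [k1 k2 _ _] := off_lines_cintegrable kL.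
have [gk1 gk2 _ _] := off_lines_cintegrable gkL.
have ncu x y : nc (cexp ((x +i* y)%C - z0)) = expR (2 * @trigo.pi R * (eta - y)).
  by rewrite nc_cexp ImD ImN /=; congr expR; ring.
have bot x : nc (k (x +i* Y)%C) <= (P - 1)^-1.
  have u1 : P - 1 <= nc (cexp ((x +i* Y)%C - z0) - 1).
    have := nc_le_sub (cexp ((x +i* Y)%C - z0) - 1) (- 1).
    by rewrite opprK subrK ncN Normc.normc1 ncu -/P; lra.
  have P1 : 0 < P - 1 by move: P16; lra.
  by rewrite /k Normc.normcV lef_pV2 ?posrE // (lt_le_trans P1).
have p16 x : nc (cexp ((x +i* Y2)%C - z0)) <= 1 / 16.
  rewrite ncu (_ : 2 * _ * _ = - (2 * @trigo.pi R * (Y2 - eta))); last by ring.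
  rewrite expRN div1r lef_pV2 ?posrE ?expR_gt0 //; apply: le_trans expR4_ge16 _.
  rewrite ler_expR; apply: (@le_trans _ _ (4 * 1)); first lra.
  by apply: ler_pM; lra.
have u15 x : 15 / 16 <= nc (cexp ((x +i* Y2)%C - z0) - 1).
  have := nc_le_sub (cexp ((x +i* Y2)%C - z0)) (cexp ((x +i* Y2)%C - z0) - 1).
  rewrite opprB addrC subrK Normc.normc1; have := p16 x.
  by move: (nc _) (nc _) => s t; lra.
have top x : nc (k (x +i* Y2)%C) <= 2.
  rewrite /k Normc.normcV; have := u15 x; move: (nc _) => t h.
  by rewrite -[leRHS]invrK lef_pV2 ?posrE; lra.
have top1 x : nc (k (x +i* Y2)%C + 1) <= 1 / 15.
  have := u15 x; have := p16 x; rewrite /k; set u := cexp _ => h1 h2.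
  have un0 : u - 1 != 0 by rewrite -nc_gt0; move: h2; lra.
  have -> : (u - 1)^-1 + 1 = u / (u - 1) by field.
  rewrite Normc.normcM Normc.normcV ler_pdivrMr; last by move: h2; lra.
  by move: h1 h2; move: (nc u) (nc _) => s t; lra.
have PV1 : (P - 1)^-1 <= 1 / 15 by rewrite div1r lef_pV2 ?posrE; move: P16; lra.
set D := cint a b (fun x => k _ - k _) in K.
(* The kernel is within [1 / 15] of 0 on the bottom side and of [-1] on the top side, so [D] is
   close to 1, which is its exact value by residues. *)
have D1 : 1 / 2 <= nc D.
  have iD : cintegrable a b (fun x => k (x +i* Y)%C - k (x +i* Y2)%C) by exact: cintegrableB.
  have : nc (cint a b (fun x => (k (x +i* Y)%C - k (x +i* Y2)%C) - 1)) <= 2 * (2 / 15 * (b - a)).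
    apply: cint_norm_leM => //; first by apply: cintegrableB => //; exact: cintegrable_cst.
    move=> x _; have -> : k (x +i* Y)%C - k (x +i* Y2)%C - 1 = k (x +i* Y)%C - (k (x +i* Y2)%C + 1) by ring.
    apply: le_trans (nc_le_sub _ _) _; have := top1 x; have := bot x.
    by move: PV1; move: (nc _) (nc _) => s t; lra.
  rewrite cintB //; last exact: cintegrable_cst.
  rewrite cint_cst // ba1 mul1r (_ : (1%:C)%C = 1) // !mulr1 -/D; have := nc_le_sub D (D - 1).
  rewrite opprB addrC subrK Normc.normc1.
  by move: (nc _) (nc _) => s t; lra.
have N : nc (cint a b (fun x => g (x +i* Y)%C * k (x +i* Y)%C - g (x +i* Y2)%C * k (x +i* Y2)%C))
    <= 2 * ((M * (P - 1)^-1 + e * 2) * (b - a)).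
  apply: cint_norm_leM => //; first exact: cintegrableB.
  move=> x _; apply: le_trans (nc_le_sub _ _) _; rewrite !Normc.normcM; apply: lerD.
    by apply: ler_pM => //; exact: nc_ge0.
  apply: ler_pM => //; try exact: nc_ge0.
  by apply/ltW/HT => //; lra.
rewrite K Normc.normcM ba1 mulr1 in N.
have G0 := nc_ge0 (g z0).
have h1 : nc (g z0) * (1 / 2) <= nc (g z0) * nc D by apply: ler_wpM2l.
have P1 : M * (P - 1)^-1 <= M * (2 * P^-1).
  apply: ler_wpM2l => //; rewrite -[2]invrK -invfM lef_pV2 ?posrE; last 2 first.
  - by move: P16; lra.
  - by rewrite mulr_gt0 ?invr_gt0 //; move: P16; lra.
  by move: P16; lra.
have P2 : M * P^-1 <= M * expR (- (4 * (eta - Y))) by apply: ler_wpM2l.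
rewrite e0E.
move: N h1 P1 P2; rewrite -!mulrA [M * (2 * _)]mulrCA.
move: (M * (P - 1)^-1) (M * P^-1) (M * expR _) (nc (g z0) * nc D) (nc (g z0)) => t1 t2 t3 t4 t5.
by clear; lra.
Qed.

End PeriodicDecay.

(** * Parabolic elements and horocycles *)

Section Horocycles.
Variable R : realType.
Implicit Types (A B X s : SL2 R) (z w : UHP R) (k : nat).

Definition trl (t : R) : SL2 R := @mkSL2 R 1 t 0 1 ltac:(by rewrite mulr0 subr0 mulr1).

Lemma val_trl t : val (trl t) = mk2 1 t 0 1. Proof. by []. Qed.

Lemma automorphy_trl t z : automorphy (trl t) z = 1.
Proof. by rewrite automorphyE val_trl !mk2E !mul0r add0r. Qed.

Lemma den_trl t z : den (trl t) z = 1.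
Proof. by rewrite -nc_automorphy automorphy_trl Normc.normc1 expr1n. Qed.

Lemma mobius_trl_re t z : reH (mobius (trl t) z) = reH z + t.
Proof. by rewrite mobius_re den_trl val_trl !mk2E !(mul0r, mulr0, mulr1, mul1r, addr0, add0r, divr1). Qed.

Lemma mobius_trl_im t z : imH (mobius (trl t) z) = imH z.
Proof. by rewrite mobius_im den_trl divr1. Qed.

(** The matrix [s] sends infinity to the fixed point of [X] and rescales the translation length to
    1. Conjugation in [SL2] multiplies that length by squares only, so the sign [e] remains. *)
Lemma parabolic_conj X : tr2 X = 2 -> X <> 1%g ->
  exists s (e : R), (e = 1 \/ e = -1) /\ (X * s = s * trl e)%g.
Proof.
move=> tX X1; have D := SL2_det2 X.
have ext0 (P : val X 1 0 = 0) : val X 0 0 = 1 /\ val X 1 1 = 1.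
  move: D tX; rewrite P /tr2; move: (val X 0 0) (val X 1 1) (val X 0 1) => a d b D tX.
  have dE : d = 2 - a by move: tX; lra.
  have : (a - 1) ^+ 2 = 0.
    rewrite dE mulr0 subr0 in D; transitivity (1 - a * (2 - a)); first by ring.
    by rewrite D subrr.
  by move/eqP; rewrite sqrf_eq0 subr_eq0 => /eqP aE; split=> //; move: dE; rewrite aE; lra.
have sgs (r : R) : r != 0 -> exists e m : R, [/\ (e = 1 \/ e = -1), m != 0 & r = e * m ^+ 2].
  move=> r0; have [rp|rn] := ltP 0 r.
    exists 1, (Num.sqrt r); split; [by left|by rewrite gt_eqF // sqrtr_gt0|by rewrite mul1r sqr_sqrtr // ltW].
  have rn' : 0 < - r by rewrite oppr_gt0 lt_neqAle r0.
  exists (-1), (Num.sqrt (- r)); split; [by right|by rewrite gt_eqF // sqrtr_gt0|].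
  by rewrite sqr_sqrtr ?ltW // mulrN mulN1r opprK.
have [r0|r0] := eqVneq (val X 1 0) 0.
  have [a1 d1] := ext0 r0.
  have q0 : val X 0 1 != 0.
    by apply/eqP => q0; apply: X1; apply: SL2_ext; rewrite ?a1 ?d1 ?q0 ?r0 val_SL21 !mxE.
  have [e [m [He m0 qE]]] := sgs _ q0.
  have Ds : m * m^-1 - 0 * 0 = 1 by rewrite mulr0 subr0 mulfV.
  exists (mkSL2 Ds), e; split=> //.
  apply: SL2_ext; rewrite !val_SL2ME /= !mk2E ?a1 ?d1 ?r0 ?qE; move: m0; clear; move=> m0; by field.
have [e [m [He m0 rE]]] := sgs _ r0.
have e0 : e != 0 by case: He => ->; rewrite ?oppr_eq0 oner_eq0.
have e2 : e * e = 1 by case: He => ->; rewrite ?mulrNN mulr1.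
pose p := val X 0 0 - 1.
have Ds : (p / m) * 0 - (- (e / m)) * (e * m) = 1.
  rewrite mulr0 sub0r mulNr opprK mulrACA e2 mulVf ?mulr1 //.
exists (mkSL2 Ds), (- e); split; first by case: He => ->; [right|left; rewrite opprK].
have qE : val X 0 1 * (e * m ^+ 2) = - p ^+ 2.
  move: D tX; rewrite /tr2 rE /p; move: (val X 0 0) (val X 1 1) (val X 0 1) => a d b D tX.
  have dE : d = 2 - a by move: tX; lra.
  by apply/eqP; rewrite -subr_eq0; apply/eqP; move: D; rewrite dE; lra.
have q2 : val X 0 1 = - (p ^+ 2 * e / m ^+ 2).
  move: qE; move: (val X 0 1) => x qE.
  rewrite -[LHS]mulr1 -e2; apply: (mulIf (expf_neq0 2 m0)).
  rewrite (_ : _ * m ^+ 2 = (x * (e * m ^+ 2)) * e); last by ring.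
  by rewrite qE; field.
have aE : val X 0 0 = 1 + p by rewrite /p; ring.
have dE : val X 1 1 = 1 - p by move: tX; rewrite /tr2 aE; lra.
apply: SL2_ext; rewrite !val_SL2ME /= !mk2E ?aE ?dE ?rE ?q2.
- have -> : - (p ^+ 2 * e / m ^+ 2) * (e * m) = - (p ^+ 2 * (e * e) / m) by field.
  by rewrite e2; field.
- by field.
- have -> : e * m ^+ 2 * (p / m) = e * m * p by field.
  by ring.
- have -> : e * m ^+ 2 * - (e / m) = - ((e * e) * m) by field.
  have -> : e * m * - e = - ((e * e) * m) by ring.
  by ring.
Qed.

(** In the coordinate [mobius s^-1 w] the element is a translation by [1] or [-1], whose
    displacement depends on the height alone. *)
Lemma parabolic_height X s (e : R) w : tr2 X = 2 -> (e = 1 \/ e = -1) -> (X * s = s * trl e)%g ->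
  n2 (cj w X - 1%:M) = (imH (mobius s^-1%g w)) ^- 2.
Proof.
move=> tX He E; rewrite parabolic_ud // -(mobiusVK s w) -mobiusM E mobiusM ud_mobius mobiusK.
set v := mobius s^-1%g w; have v0 := imH_gt0 v.
rewrite udE mobius_trl_re mobius_trl_im.
have -> : reH v + e - reH v = e by ring.
have -> : e ^+ 2 = 1 by case: He => ->; rewrite ?sqrrN expr1n.
by field; rewrite gt_eqF.
Qed.

Section Multiplicity.
Variable H : set (SL2 R).
Hypotheses (sH : sgp H) (dH : dsc H).

(* [w] lies below height [c] in the cusps of [H], in the coordinate in which
   the parabolic element is [z |-> z +- 1]. *)
Definition low (c : R) w := forall X, H X -> X <> 1%g -> tr2 X = 2 -> c ^- 2 <= n2 (cj w X - 1%:M).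

Lemma low_move (c : R) z w : 0 < c -> ud w z <= 1 -> low c z -> low (6 * c) w.
Proof.
move=> c0 u Lz X HX X1 tX; have [s [e [He E]]] := parabolic_conj tX X1.
have := Lz X HX X1 tX; rewrite !(parabolic_height _ tX He E).
have zp := imH_gt0 (mobius s^-1%g z); have wp := imH_gt0 (mobius s^-1%g w).
have : imH (mobius s^-1%g w) <= 6 * imH (mobius s^-1%g z) by apply: ud_im_ratio; rewrite ud_mobius.
move: (imH _) (imH _) zp wp => a b a0 b0 ab.
rewrite lef_pV2 ?posrE ?exprn_gt0 // => h; rewrite lef_pV2 ?posrE ?exprn_gt0 ?mulr_gt0 //.
have h' : b <= c by rewrite -(@ler_pXn2r _ 2) // nnegrE ltW.
apply: lerXn2r; [by rewrite nnegrE ltW|by rewrite nnegrE mulr_ge0 // ltW|].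
by apply: le_trans ab _; rewrite ler_pM2l.
Qed.

(** For unipotent elements with the fixed point of [X], distances to 1 are [b ^+ 2] times that of
    [X] at every base point. Minimality at [z] gives [1 <= b ^+ 2], and this carries over to [w]. *)
Lemma span_low X B w z : near H w X -> X <> 1%g -> tr2 X = 2 ->
  (forall B, H B -> B <> 1%g -> n2 (cj z X - 1%:M) <= n2 (cj z B - 1%:M)) ->
  near H w B -> B <> 1%g -> n2 (cj w X - 1%:M) <= n2 (cj w B - 1%:M).
Proof.
move=> nX X1 tX mX nB B1.
have [b E] := near_parabolic_span sH dH nX X1 tX nB.
have [_ Ew] := parabolic_trace w tX E; have [_ Ez] := parabolic_trace z tX E.
have := mX B nB.1 B1; rewrite Ew Ez.
have p : 0 < n2 (cj z X - 1%:M) by rewrite n2_gt0 // subr_eq0 cj_neq1.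
rewrite -{1}[n2 (cj z X - _)]mul1r ler_pM2r // => b1.
by rewrite -{1}[n2 (cj w X - _)]mul1r; apply: ler_wpM2r => //; exact: n2_ge0.
Qed.

End Multiplicity.

Lemma dscS (H H0 : set (SL2 R)) : H `<=` H0 -> dsc H0 -> dsc H.
Proof. by move=> HH [e e0 He]; exists e => // A /HH; exact: He. Qed.

(** Both points are within [1 / (64 k)] of the center, and the weak triangle inequality costs [12]:
    [12 * 2 / 64 = 3 / 8]. *)
Lemma sq_rk_ud k z w w' : (0 < k)%N -> sq z (rk R k) (coordH w) -> sq z (rk R k) (coordH w') ->
  ud w w' <= 3 / (8 * k%:R) /\ 3 / (8 * k%:R) <= (1 : R).
Proof.
move=> k0 h1 h2; have [r0 r2 rE] := rk_bounds R k0.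
have u1 := sq_ud (ltW r0) r2 h1; have u2 := sq_ud (ltW r0) r2 h2.
have kp : 1 <= k%:R :> R by rewrite ler1n.
have iv : (64 * k%:R)^-1 = 1 / 64 * (k%:R)^-1 :> R by rewrite invfM div1r.
have i1 : (k%:R)^-1 <= 1 :> R by rewrite invf_le1 // (lt_le_trans _ kp).
have i0 : 0 < (k%:R)^-1 :> R by rewrite invr_gt0 (lt_le_trans _ kp).
rewrite udC in u2; rewrite rE iv in u1 u2; rewrite invfM.
move: u1 u2 i0 i1; move: (k%:R)^-1 => t u1 u2 i0 i1.
have v1 : ud w z <= 1 by move: u1; move: (ud _ _) => q; lra.
have v2 : ud z w' <= 1 by move: u2; move: (ud _ _) => q; lra.
have := ud_triangle v1 v2; move: u1 u2; move: (ud w z) (ud z w') (ud w w') => a b c.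
by split; lra.
Qed.

(** If the minimal near element of [H] is nonparabolic, the count is taken in [H0]. If it is
    parabolic, [low] bounds it from below by a multiple of [k^-2], while the displacements in
    question are [O(1 / k)], so the parameters range over an interval of length [O(sqrt k)]. Either
    way the constant depends on [H0] only. *)
Theorem low_multiplicity (H0 : set (SL2 R)) : sgp H0 -> dsc H0 -> thick_cover H0 ->
  exists2 D : R, 0 < D & forall H k z, H `<=` H0 -> sgp H -> (0 < k)%N -> low H (151 * k%:R) z ->
    exists2 N, multiplicity_le H (fun w => sq z (rk R k) (coordH w)) N & N%:R <= D * Num.sqrt k%:R.
Proof.
move=> sH0 dH0 tc; have [K HK] := nonparabolic_near_count sH0 dH0 tc.
have [T HT] := near_multiplicity R.
exists (T%:R * (K%:R + 49 * 50) + 1).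
  by rewrite ltr_wpDl // mulr_ge0 // addr_ge0 // mulr_ge0.
move=> H k z HH sH k0 Lz; have dH := dscS HH dH0.
have kp : 1 <= k%:R :> R by rewrite ler1n.
have s1 : 1 <= Num.sqrt k%:R :> R by rewrite -[leLHS]sqrtr1 ler_sqrt // (lt_le_trans _ kp).
set q := Num.sqrt _ in s1 *.
have qk : q ^+ 2 = k%:R by rewrite sqr_sqrtr // ler0n.
(* Since [low_move] replaces [151] by [6 * 151 = 906], [near_parabolic_count] requires
   [(1200 / 906)^2 >= 3 / 2]. *)
pose b : R := 30 * 40 * q; have b0 : 0 <= b by rewrite /b; move: s1; lra.
pose n := maxn K.+1 (Num.trunc (2 * b)).+1.
exists (T * n)%N; last first.
  have nn : n%:R <= (K%:R + 49 * 50) * q.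
    have nD : (n <= K.+1 + (Num.trunc (2 * b)).+1)%N by rewrite /n geq_max leq_addr leq_addl.
    apply: (@le_trans _ _ (K.+1 + (Num.trunc (2 * b)).+1)%:R); first by rewrite ler_nat.
    have tb : (Num.trunc (2 * b))%:R <= 2 * b by rewrite truncn_le mulr_ge0.
    have Kq : K%:R * 1 <= K%:R * q by apply: ler_wpM2l.
    rewrite natrD -[K.+1%:R]natr1 -[(Num.trunc _).+1%:R]natr1 (mulrDl K%:R); move: tb Kq; rewrite /b mulr1.
    by move: (Num.trunc _)%:R (K%:R * q) s1 => t u; lra.
  rewrite natrM (mulrDl (T%:R * _)) mul1r; apply: (@le_trans _ _ (T%:R * ((K%:R + 49 * 50) * q))).
    by apply: ler_wpM2l.
  by rewrite mulrA; move: s1; move: (_ * q) => u; lra.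
have u w w' : sq z (rk R k) (coordH w) -> sq z (rk R k) (coordH w') -> ud w w' <= 3 / (8 * k%:R).
  by move=> h1 h2; have [] := sq_rk_ud k0 h1 h2.
have [_ r1] := sq_rk_ud k0 (sq_center z (ltW (let: And3 h _ _ := rk_bounds R k0 in h)))
  (sq_center z (ltW (let: And3 h _ _ := rk_bounds R k0 in h))).
apply: (HT H _ (3 / (8 * k%:R))) => // w sw.
have [r0 r2 rE] := rk_bounds R k0.
have Lw : low H (6 * (151 * k%:R)) w.
  apply: low_move Lz; first by rewrite mulr_gt0 // (lt_le_trans _ kp).
  apply: le_trans (sq_ud (ltW r0) r2 sw) _; apply: exprn_ile1; first exact: ltW.
  by apply: le_trans r2 _; lra.
have [[B nB B1]|none] := pselect (exists2 B, near H w B & B <> 1%g); last first.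
  apply: (@atmost_le _ _ 1); first by rewrite /n leq_max.
  apply: (@atmostS _ _ (near H w)) => [B []//|].
  by apply: near_trivial => B nB; apply: contrapT => B1; apply: none; exists B.
have [X [HX X1 nX mX]] := near_minimal sH dH nB.1 B1 nB.2.
have [tX|tX] := pselect (tr2 X = 2); last first.
  apply: (@atmost_le _ _ K); first by rewrite /n leq_max leqnSn.
  apply: (@atmostS _ _ (near H0 w)) => [C [[/HH HC nC] _]|]; first by split.
  by apply: (HK w X) => //; split=> //; exact: HH.
apply: (@atmost_le _ _ (Num.trunc (2 * b)).+1); first by rewrite /n leq_max leqnn orbT.
apply: (near_parabolic_count sH dH (X := X)) => //.
have := Lw X HX X1 tX; move: (n2 _) => m h.
have kn : k%:R != 0 :> R by rewrite gt_eqF // (lt_le_trans _ kp).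
have : b ^+ 2 * (6 * (151 * k%:R)) ^- 2 <= b ^+ 2 * m by apply: ler_wpM2l => //; exact: sqr_ge0.
apply: le_trans; rewrite /b exprMn qk.
have -> : ((30 : R) * 40) ^+ 2 * k%:R * (6 * (151 * k%:R)) ^- 2 = (30 * 40 / (6 * 151)) ^+ 2 * (k%:R)^-1.
  by field.
have -> : 4 * (3 / (8 * k%:R)) = 3 / 2 * (k%:R)^-1 :> R by field.
have i0 : 0 < (k%:R)^-1 :> R by rewrite invr_gt0 (lt_le_trans _ kp).
rewrite ler_pM2r //; lra.
Qed.

End Horocycles.

(** * Pointwise bound for cusp forms *)

Section CuspFormBound.
Variable R : realType.
Implicit Types (A X s : SL2 R) (z w : UHP R) (k : nat) (f : UHP R -> R[i]).

Lemma inv_sqr_lt (x : R) : 21 <= x -> x ^- 2 < 1 / 400.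
Proof.
move=> x21; have -> : 1 / 400 = 20 ^- 2 :> R by field.
have x0 : 0 < x by lra.
rewrite ltf_pV2 ?posrE ?exprn_gt0 //; apply: ltrXn2r; rewrite ?nnegrE ?(ltW x0) //.
by move: x21; lra.
Qed.

Lemma slash_mass f k s z :
  nc (slash (2 * k) f s z) ^+ 2 * imH z ^+ (2 * k) = mass f k (coordH (mobius s z)).
Proof.
rewrite mass_coordH mobius_im /slash Normc.normcM Normc.normcV ncX.
have j0 : 0 < nc (automorphy s z) by rewrite nc_gt0 automorphy_neq0.
rewrite -nc_automorphy; move: (nc (f _)) (nc (automorphy s z)) j0 (imH z) => a j j0 y.
rewrite exprMn exprVn expr_div_n -!exprM [(2 * k * 2)%N]mulnC.
by rewrite -!mulrA [_ ^-1 * _]mulrC.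
Qed.

Lemma slash_cdifferentiable f k s (x y : R) : holomorphicH f -> 0 < y ->
  cdifferentiable (ext (slash (2 * k) f s)) (x +i* y)%C.
Proof.
move=> hf y0; pose z := mkUHP x y0.
pose a := ((val s 0 0)%:C)%C; pose b := ((val s 0 1)%:C)%C.
pose c := ((val s 1 0)%:C)%C; pose d := ((val s 1 1)%:C)%C.
have jz : c * val z + d != 0 := automorphy_neq0 s z.
have [d1 D1] : cdifferentiable (fun w : R[i] => (c * w + d)^-1) (x +i* y)%C.
  eexists; apply: cdiffV; first exact: jz.
  by apply: cdiffD; [apply: cdiffM; [exact: cdiff_cst|exact: cdiff_id]|exact: cdiff_cst].
have D0 : cdiff (fun w : R[i] => a * w + b) (x +i* y)%C (0 * (x +i* y)%C + a * 1 + 0).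
  by apply: cdiffD; [apply: cdiffM; [exact: cdiff_cst|exact: cdiff_id]|exact: cdiff_cst].
have [d2 D2] : cdifferentiable (ext f) ((a * (x +i* y)%C + b) * (c * (x +i* y)%C + d)^-1).
  exact: (derivable_cdifferentiable (hf (mobius s z))).
have D3 := cdiff_comp (cdiffM D0 D1) D2.
have [d4 D4] := cdifferentiableX (2 * k) (ex_intro _ d1 D1).
eexists; apply: cdiff_near (cdiffM D3 D4); first exact: y0.
move=> [u v] /=; rewrite -/(nc _) => h.
have v0 : 0 < v.
  have := Im_le_nc ((u +i* v)%C - (x +i* y)%C); rewrite ImD ImN /= => h'.
  have := le_lt_trans h' h; rewrite ltr_distl => /andP[]; rewrite subrr //.
rewrite ext_mk /slash -extE -exprVn.
by [].
Qed.

Lemma slash_periodic f k s X (e : R) z :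
  (forall w, f (mobius X w) = automorphy X w ^+ (2 * k) * f w) -> (X * s = s * trl e)%g ->
  slash (2 * k) f s (mobius (trl e) z) = slash (2 * k) f s z.
Proof.
move=> fX E; rewrite /slash -mobiusM -E mobiusM fX.
have := automorphyM s (trl e) z; rewrite automorphy_trl mulr1 -E automorphyM => <-.
have n1 := automorphy_neq0 X (mobius s z); have n2 := automorphy_neq0 s z.
rewrite exprMn invfM mulrACA divff ?mul1r //.
by rewrite expf_neq0.
Qed.

Variable H0 : set (SL2 R).
Hypotheses (sH0 : sgp H0) (dH0 : dsc H0).

Section Form.
Variables (G : set (PSL2 R)) (k : nat) (f : UHP R -> R[i]) (F : set (UHP R)) (J : R).
Hypotheses (k0 : (0 < k)%N) (sH : sgp (hat G)) (HH : hat G `<=` H0) (cf : cusp_form G k f).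
Hypotheses (mF : measurable (@coordH R @` F)) (cov : forall z, exists2 A, hat G A & F (mobius A z)).
Hypothesis HJ : (hintS (@coordH R @` F) (fun p => (mass f k p)%:E) <= J%:E)%E.

Lemma mass_integral_ge0 : 0 <= J.
Proof.
rewrite -lee_fin; apply: le_trans HJ; apply: integral_ge0 => p _.
by apply: hdens_ge0 => q; rewrite lee_fin mass_ge0.
Qed.

(** [J] is any bound for the Petersson norm [<f, f>]; [48 * 48 * k] is the constant of [local_bound]
    and [N] the loss in [unfolding]. *)
Lemma multiplicity_bound z N : multiplicity_le (hat G) (fun w => sq z (rk R k) (coordH w)) N ->
  mass f k (coordH z) <= 48 * 48 * k%:R * (N%:R * J).
Proof.
move=> mult; have [hf fG _] := cf; have dH := dscS HH dH0.
rewrite mass_coordH -lee_fin; apply: le_trans (local_bound z k0 hf) _.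
rewrite [leRHS]EFinM; apply: lee_wpmul2l; first by rewrite lee_fin !mulr_ge0.
apply: le_trans (unfolding sH dH mF cov (measurable_sq z _) mult _ _ _) _.
- by apply/measurable_EFinP; exact: measurable_mass.
- by move=> p; rewrite lee_fin mass_ge0.
- by move=> A p HA p0; congr (_%:E); apply: mass_invariant => // w; exact: fG.
by rewrite EFinM; apply: lee_wpmul2l => //; rewrite lee_fin ler0n.
Qed.

(* High in a cusp, [f|s] decays exponentially from the height [150 k], where the
   multiplicities are still controlled. *)
Lemma cusp_decay (B : R) z : (forall w, low (hat G) (151 * k%:R) w -> mass f k (coordH w) <= B) ->
  mass f k (coordH z) <= 64 * B.
Proof.
move=> HB; have [hf fG fc] := cf; have dH := dscS HH dH0.
have kp : 1 <= k%:R :> R by rewrite ler1n.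
have kp0 : 0 < k%:R :> R by rewrite ltr0n.
have [Lz|] := pselect (low (hat G) (151 * k%:R) z).
  have := HB z Lz; have := mass_ge0 f k (coordH z); move: (mass _ _ _) => m; lra.
move=> /existsNP[X /not_implyP[HX /not_implyP[X1 /not_implyP[tX /negP nX]]]].
rewrite -ltNge in nX.
have c1 : (151 * k%:R) ^- 2 < 1 / 400 :> R by apply: inv_sqr_lt; move: kp; lra.
have nrX : near (hat G) z X by split=> //; apply: lt_trans nX c1.
have [X0 [HX0 X01 nX0 mX0]] := near_minimal sH dH HX X1 nX.
have [b E] := near_parabolic_span sH dH nrX X1 tX (conj HX0 (lt_trans nX0 c1)).
have [tX0 _] := parabolic_trace z tX E.
have [s [e [He Es]]] := parabolic_conj tX0 X01.
(* The height [150 k] is below the [151 k] of [low], so that [HB] applies on this horocycle, and it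
   is at least 1 below [eta], as [periodic_decay] requires. *)
pose zeta := mobius s^-1%g z; pose eta := imH zeta; pose Y : R := 150 * k%:R.
have sz : mobius s zeta = z by rewrite /zeta mobiusVK.
have eta0 : 0 < eta by exact: imH_gt0.
have etaY : 151 * k%:R < eta.
  have := nX0; rewrite (parabolic_height z tX0 He Es) -/zeta -/eta.
  rewrite ltf_pV2 ?posrE ?exprn_gt0 ?mulr_gt0 //.
  by rewrite ltr_pXn2r // nnegrE ?(ltW eta0) //; move: kp; lra.
have Y0 : 0 < Y by rewrite /Y; move: kp; lra.
(* [X0] is minimal at [z], and by [span_low] it remains minimal among the near elements on the
   horocycle, where its distance to 1 is exactly [Y ^- 2]. *)
have lowY (x : R) : low (hat G) (151 * k%:R) (mobius s (mkUHP x Y0)).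
  move=> X' HX' X'1 tX'; rewrite leNgt; apply/negP => h.
  set w := mobius s _ in h.
  have hX0 : n2 (cj w X0 - 1%:M) = Y ^- 2.
    by rewrite (parabolic_height w tX0 He Es) /w mobiusK.
  have Y2 : Y ^- 2 < 1 / 400 by apply: inv_sqr_lt; rewrite /Y; move: kp; lra.
  have nw0 : near (hat G) w X0 by split; rewrite ?hX0.
  have := span_low sH dH nw0 X01 tX0 mX0 (conj HX' (lt_trans h c1)) X'1.
  rewrite hX0 leNgt => /negP; apply; apply: lt_trans h _.
  rewrite ltf_pV2 ?posrE ?exprn_gt0 ?mulr_gt0 //.
  by apply: ltrXn2r; rewrite ?nnegrE // /Y; move: kp; lra.
have B0 : 0 <= B by apply: le_trans (HB _ (lowY 0)); exact: mass_ge0.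
pose g := ext (slash (2 * k) f s).
have gE (x y : R) (y0 : 0 < y) : g (x +i* y)%C = slash (2 * k) f s (mkUHP x y0) by exact: ext_mk.
have YK : 0 < Y ^+ (2 * k) by rewrite exprn_gt0.
pose M := Num.sqrt (B / Y ^+ (2 * k)).
have M2 : M ^+ 2 = B / Y ^+ (2 * k) by rewrite sqr_sqrtr // divr_ge0 // ltW.
have bg x : nc (g (x +i* Y)%C) <= M.
  rewrite -(@ler_pXn2r _ 2) // ?nnegrE ?nc_ge0 ?sqrtr_ge0 // M2 ler_pdivlMr // gE.
  have := slash_mass f k s (mkUHP x Y0); rewrite [imH _]/= => ->.
  exact/HB/lowY.
have pg x y : 0 < y -> g ((x + 1) +i* y)%C = g (x +i* y)%C.
  move=> y0; rewrite !gE.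
  case: He Es => -> Es.
    rewrite -(@slash_periodic f k s X0 1 (mkUHP x y0) (fG X0 HX0) Es).
    by congr (slash _ _ _ _); apply: UHP_ext; rewrite ?mobius_trl_re ?mobius_trl_im.
  rewrite -[LHS](@slash_periodic f k s X0 (-1) _ (fG X0 HX0) Es).
  congr (slash _ _ _ _); apply: UHP_ext; rewrite ?mobius_trl_re ?mobius_trl_im //.
  by rewrite /reH /=; ring.
have lg (e' : R) : 0 < e' -> exists Y0 : R, forall x y, 0 < y -> Y0 < y -> nc (g (x +i* y)%C) < e'.
  have cs : cusp_at G s.
    exists X0; split; first exact: HX0.
      split; last first.
        have -> : \tr (val X0) = tr2 X0.
          rewrite /mxtrace /tr2 !big_ord_recl big_ord0 addr0.
          by congr (val X0 _ _ + val X0 _ _); apply: val_inj.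
        by rewrite tX0 normr_nat.
      rewrite -pi_PSL21 => /PSL2_piP /orP[/eqP h|/eqP h].
        by apply: X01; apply: val_inj.
      by move: tX0; rewrite /tr2 h val_SL21 !mxE /= !mulr1n; lra.
    by rewrite -mulgA Es mulKg val_trl mk2E.
  move=> e0; have [T HT] := fc s cs e' e0; exists T => x y y0 Ty.
  by rewrite gE; apply: HT.
have Yeta : Y + 1 <= eta by rewrite /Y; move: etaY kp; lra.
have dec := @periodic_decay R g Y M (reH zeta) eta Y0 Yeta
  (fun x y y0 => slash_cdifferentiable k s x hf y0) pg lg bg.
have zE : mkUHP (reH zeta) eta0 = zeta by apply: UHP_ext.
rewrite gE zE in dec.
rewrite -sz -slash_mass -/eta.
have M0 : 0 <= M by exact: sqrtr_ge0.
set E4 := expR _ in dec.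
have E40 : 0 < E4 by exact: expR_gt0.
have d2 : nc (slash (2 * k) f s zeta) ^+ 2 <= 64 * (B / Y ^+ (2 * k)) * E4 ^+ 2.
  have -> : 64 * (B / Y ^+ (2 * k)) * E4 ^+ 2 = (8 * M * E4) ^+ 2 by rewrite -M2; ring.
  by apply: lerXn2r => //; rewrite nnegrE ?nc_ge0 // !mulr_ge0 // ltW.
have r1 : eta / Y <= expR ((eta - Y) / Y).
  have -> : eta / Y = 1 + (eta - Y) / Y by field; rewrite gt_eqF.
  exact: expR_ge1Dx.
(* As [2 k / Y = 1 / 75], the weight grows at most like [exp ((eta - Y) / 75)], while the decay
   contributes [exp (- 8 (eta - Y))]. *)
have r2 : (eta / Y) ^+ (2 * k) * E4 ^+ 2 <= 1.
  have n0 : 0 <= eta / Y by rewrite divr_ge0 // ltW.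
  apply: (@le_trans _ _ (expR ((eta - Y) / Y) ^+ (2 * k) * E4 ^+ 2)).
    by apply: ler_wpM2r; [rewrite exprn_ge0 // ltW|apply: lerXn2r; rewrite ?nnegrE ?expR_ge0].
  rewrite /E4 -!expRM_natl -expRD; apply: (@le_trans _ _ (expR 0)); last by rewrite expR0.
  rewrite ler_expR natrM.
  have -> : 2 * k%:R * ((eta - Y) / Y) = (eta - Y) / 75.
    by rewrite /Y; field; rewrite gt_eqF // (lt_le_trans _ kp).
  by move: Yeta; move: (eta) (Y) => u v; lra.
apply: le_trans (ler_wpM2r _ d2) _; first by rewrite exprn_ge0 // ltW.
have -> : 64 * (B / Y ^+ (2 * k)) * E4 ^+ 2 * eta ^+ (2 * k) = 64 * B * ((eta / Y) ^+ (2 * k) * E4 ^+ 2).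
  by rewrite expr_div_n; ring.
rewrite -[leRHS]mulr1; apply: ler_wpM2l r2; by rewrite mulr_ge0.
Qed.

End Form.

Theorem cusp_form_bound : thick_cover H0 -> exists2 C : R, 0 < C &
  forall G k f F J, (0 < k)%N -> sgp (hat G) -> hat G `<=` H0 -> cusp_form G k f ->
    measurable (@coordH R @` F) -> (forall z, exists2 A, hat G A & F (mobius A z)) ->
    (hintS (@coordH R @` F) (fun p => (mass f k p)%:E) <= J%:E)%E ->
    forall z, mass f k (coordH z) <= C * (k%:R * Num.sqrt k%:R) * J.
Proof.
move=> tc; have [D D0 HD] := low_multiplicity sH0 dH0 tc.
exists (64 * (48 * 48 * D)); first by rewrite !mulr_gt0.
move=> G k f F J k0 sH HH cf mF cov HJ z.
have J0 := mass_integral_ge0 HJ.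
rewrite (_ : _ * J = 64 * (48 * 48 * k%:R * (D * Num.sqrt k%:R * J))); last by ring.
apply: (cusp_decay k0 sH HH cf) => w Lw.
have [N mult ND] := HD _ k w HH sH k0 Lw.
apply: le_trans (multiplicity_bound k0 sH HH cf mF cov HJ mult) _.
by apply: ler_wpM2l; [rewrite !mulr_ge0|apply: ler_wpM2r].
Qed.

End CuspFormBound.

(** * Cocompact groups *)

Section Cocompact.
Variable R : realType.
Implicit Types (A B C : SL2 R) (z w p q : UHP R).
Local Open Scope quotient_scope.

(** The disc [ud u q < c] with the denominator cleared: for [c > 0] the inequality itself forces
    [Im u > 0], so it defines an open set of complex numbers. *)
Definition udisc (c : R) q : set (R[i])^o := [set u : R[i] | nc (u - val q) ^+ 2 < 4 * c * imH q * Im u].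

Lemma udiscP c q w : 0 < c -> udisc c q (val w) <-> ud w q < c.
Proof.
move=> c0; rewrite /ud ltr_pdivrMr ?mulr_gt0 ?imH_gt0 //.
by rewrite /udisc /= -/(imH w) (_ : c * _ = 4 * c * imH q * imH w) //; ring.
Qed.

Lemma udisc_open c q : 0 < c -> open (udisc c q).
Proof.
move=> c0; rewrite openE => u Hu.
set m := nc ((u : R[i]) - val q); pose K := 4 * c * imH q.
have K0 : 0 < K by rewrite !mulr_gt0 // imH_gt0.
have m0 : 0 <= m by exact: nc_ge0.
have {}Hu : m ^+ 2 < K * Im u by exact: Hu.
pose d := K + 2 * m + 1; have d0 : 0 < d by rewrite /d; lra.
pose r := Num.min 1 ((K * Im u - m ^+ 2) / d).
have r0 : 0 < r by rewrite lt_min ltr01 divr_gt0 // subr_gt0.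
have r1 : r <= 1 by rewrite ge_min lexx.
have rd : r * d <= K * Im u - m ^+ 2 by rewrite -ler_pdivlMr // ge_min lexx orbT.
clearbody r; apply/nbhs_ballP; exists (r%:C)%C; first by rewrite /= ltcR.
move=> v; rewrite -ball_normE /= => h.
have {}h : nc ((v : R[i]) - u) < r.
  by rewrite nc_subC; move: h; rewrite normc_def ltcR; case: (u - v : R[i]) => a b /=.
have := Im_le_nc ((v : R[i]) - u); rewrite ImD ImN => h2.
have {h2}h2 := le_lt_trans h2 h.
have {h2} Iv : Im u - r < Im v by move: h2; rewrite ltr_distl => /andP[].
have h3 : nc ((v : R[i]) - val q) <= r + m.
  by apply: le_trans (nc_dist_triangle u _ _) _; rewrite lerD2r ltW.
have h4 : nc ((v : R[i]) - val q) ^+ 2 <= (r + m) ^+ 2.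
  by apply: lerXn2r; rewrite ?nnegrE ?nc_ge0 // addr_ge0 // ltW.
rewrite /udisc /= -/K; apply: le_lt_trans h4 _.
have h5 : K * (Im u - r) < K * Im v by rewrite ltr_pM2l.
apply: le_lt_trans h5.
have h6 : r * r <= r * 1 by rewrite ler_pM2l.
by move: rd h6; rewrite /d; move: (Im u) => t; lra.
Qed.

Lemma near_ud (H : set (SL2 R)) w C : near H w C -> ud (mobius C w) w <= 1 / 24.
Proof.
move=> [_ nC]; have := tr_near nC; move: nC; rewrite n2_sub1 tr_cj n2_cj.
move: (tr2 C) (ud _ _) => t u h1 h2.
have h3 : t - 2 < 2 / 25.
  rewrite ltNge; apply/negP => h; have : (2 / 25) ^+ 2 <= (t - 2) ^+ 2.
    by apply: lerXn2r; rewrite ?nnegrE //; lra.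
  by move: h2; move: (_ ^+ 2) => s; lra.
by move: h1 h3; lra.
Qed.

Variable G0 : set (PSL2 R).
Hypotheses (sG : sgp (hat G0)) (dG : dsc (hat G0)).

(** Conjugation by [A] turns the near elements at [w] into elements that displace [p] by a bounded
    amount, of which there are finitely many. *)
Lemma near_count_local p : exists N, forall w A, hat G0 A -> ud (mobius A w) p < 1 / 100 ->
  atmost (near (hat G0) w) N.
Proof.
have [N HN] := bounded_atmost sG dG p 40; exists N => w A HA wp.
have [_ HM HV] := sG.
apply: (@atmost_inj _ _ (fun C => A * C * A^-1)%g _ _ _ _ _ HN).
  by move=> C C' /mulgAr_inj /mulgA_inj.
move=> C nC; split; first by apply: (HM); [apply: (HM) => //; exact: nC.1|exact: HV].
rewrite n2_cj; set B := (A * C * A^-1)%g.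
have u1 := near_ud nC.
have u2 : ud (mobius B (mobius A w)) (mobius A w) = ud (mobius C w) w.
  by rewrite -mobiusM /B mulgVK mobiusM ud_mobius.
have u3 : ud (mobius B p) (mobius B (mobius A w)) < 1 / 100 by rewrite ud_mobius udC.
rewrite -u2 in u1; move: u1 u3 wp.
set x := mobius B p; set y := mobius B _; set v := mobius A w => u1 u3 wp.
have t1 : ud x v <= 12 * (ud x y + ud y v).
  by apply: ud_triangle; [move: u3|move: u1]; move: (ud _ _) => t; lra.
have t2 : ud x p <= 12 * (ud x v + ud v p).
  by apply: ud_triangle; move: t1 u1 u3 wp; move: (ud x y) (ud y v) (ud x v) (ud v p) => a b c d; lra.
by move: t1 t2 u1 u3 wp; move: (ud x y) (ud y v) (ud x v) (ud v p) (ud x p) => a b c d e; lra.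
Qed.

(** Otherwise, for each [N] some orbit has more than [N] near elements. These sets of orbits form a
    filter base, and at a cluster point the neighbourhood [V] on which [near_count_local] gives a
    uniform bound yields a contradiction. *)
Theorem cocompact_near_count : cocompact G0 -> exists N, forall w, atmost (near (hat G0) w) N.
Proof.
move=> cpt; apply: contrapT => nex.
have [G1 HM HV] := sG.
pose S (N : nat) : set (quotientH G0) :=
  [set x | exists w, x = \pi_(quotientH G0) w /\ ~ atmost (near (hat G0) w) N].
have S0 N : S N !=set0.
  apply: contrapT => h; apply: nex; exists N => w; apply: contrapT => hw; apply: h.
  by exists (\pi_(quotientH G0) w), w.
have FF : ProperFilter (filter_from setT S).
  apply: filter_from_proper; last by move=> N _; exact: S0.
  apply: filter_fromT_filter; first by exists 0%N.
  move=> N M; exists (maxn N M) => x [w [-> hw]]; split; exists w; split=> // h; apply: hw.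
    by apply: atmost_le h; rewrite leq_maxl.
  by apply: atmost_le h; rewrite leq_maxr.
have [x [_ clx]] := cpt _ FF filterT.
pose p : UHP R := repr x.
have [N HN] := near_count_local p.
pose V : set (quotientH G0) := [set y | exists w A, [/\ y = \pi_(quotientH G0) w, hat G0 A & ud (mobius A w) p < 1 / 100]].
have pV (w : UHP R) : V (\pi_(quotientH G0) w) <-> exists2 A, hat G0 A & ud (mobius A w) p < 1 / 100.
  split=> [[w' [A [E HA h]]]|[A HA h]]; last by exists w, A.
  have /eqP oE : same_orbit G0 w w' by apply/(@eqquotP _ (same_orbit_equiv G0) {eq_quot same_orbit_equiv G0}).
  have : orbitH G0 w' w' by exists 1%g; rewrite ?mobius1.
  rewrite -oE => -[B HB Bw]; exists (A * B)%g; first exact: HM.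
  by rewrite mobiusM Bw.
have c0 : 0 < 1 / 100 :> R by lra.
have oV : open V.
  suff : open (\pi_(quotientH G0) @^-1` V : set (UHP R)) by [].
  exists (\bigcup_(A in hat G0) udisc (1 / 100) (mobius A^-1%g p)).
    by apply: bigcup_open => A _; exact: udisc_open.
  apply/seteqP; split=> w /=.
    move=> [A HA /(udiscP _ _ c0) h]; apply/pV; exists A => //.
    by rewrite -(mobiusVK A p) ud_mobius.
  move=> /pV[A HA h]; exists A => //; apply/(udiscP _ _ c0).
  by rewrite -(ud_mobius A) mobiusVK.
have Vx : V x.
  rewrite -[x]reprK; apply/pV; exists 1%g => //.
  by rewrite mobius1 udE !subrr !expr0n addr0 mul0r.
have SN : filter_from setT S (S N) by exists N.
have [y [[w [-> hw]] /pV[A HA h]]] := clx _ _ SN (open_nbhs_nbhs (conj oV Vx)).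
exact: hw (HN w A HA h).
Qed.

(** [N] is independent of [k] because all near elements are counted, whatever the size of the
    square. *)
Theorem cocompact_multiplicity : cocompact G0 -> exists N, forall H k z, sgp H -> H `<=` hat G0 ->
  (0 < k)%N -> multiplicity_le H (fun w => sq z (rk R k) (coordH w)) N.
Proof.
move=> /cocompact_near_count[N HN]; have [T HT] := near_multiplicity R.
exists (T * N)%N => H k z sH HH k0.
have [r0 _ _] := rk_bounds R k0; have sz := sq_center z (ltW r0).
have [_ r1] := sq_rk_ud k0 sz sz.
apply: (HT H _ (3 / (8 * k%:R))) => // [w w' h1 h2|w _].
  by have [] := sq_rk_ud k0 h1 h2.
by apply: (atmostS _ (HN w)) => B [[/HH HB nB] _]; split.
Qed.

End Cocompact.

(** * The Bergman kernel *)

Section LinearCombinations.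
Variables (R : realType) (G : set (PSL2 R)) (k : nat).
Implicit Types (f g : UHP R -> R[i]) (a b : R[i]).

Lemma ext_comb2 a b f g w : ext (fun z => a * f z + b * g z) w = a * ext f w + b * ext g w.
Proof. by rewrite /ext /=; case: ('oinv_set_val w) => [z|] /=; rewrite ?mulr0 ?addr0. Qed.

Lemma holomorphic_comb2 a b f g : holomorphicH f -> holomorphicH g ->
  holomorphicH (fun z => a * f z + b * g z).
Proof.
move=> hf hg z; rewrite -[valL_ _ _]/(ext (fun z => a * f z + b * g z)).
have -> : ext (fun z => a * f z + b * g z) =
   (a \*: (ext f : (R[i])^o -> (R[i])^o) + b \*: (ext g : (R[i])^o -> (R[i])^o))%R.
  by apply/funext => w; rewrite ext_comb2.
by apply: derivableD; apply: derivableZ; [exact: hf|exact: hg].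
Qed.

Lemma cusp_form_comb2 a b f g : cusp_form G k f -> cusp_form G k g ->
  cusp_form G k (fun z => a * f z + b * g z).
Proof.
move=> [hf fG fc] [hg gG gc]; split.
- exact: holomorphic_comb2.
- by move=> A HA z; rewrite fG // gG //; ring.
move=> s cs e e0.
have an := nc_ge0 a; have bn := nc_ge0 b.
have K0 : 0 < nc a + nc b + 1 by lra.
have e1 : 0 < e / (nc a + nc b + 1) by rewrite divr_gt0.
have [Y1 H1] := fc s cs _ e1; have [Y2 H2] := gc s cs _ e1.
exists (Num.max Y1 Y2) => z; rewrite gt_max => /andP[/H1 h1 /H2 h2].
have -> : slash (2 * k) (fun z => a * f z + b * g z) s z =
    a * slash (2 * k) f s z + b * slash (2 * k) g s z by rewrite /slash; ring.
apply: le_lt_trans (nc_le_add _ _) _; rewrite (Normc.normcM a) (Normc.normcM b).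
set t := e / _ in e1 h1 h2.
have eE : e = t * (nc a + nc b + 1) by rewrite /t mulfVK // gt_eqF.
have p1 := ler_wpM2l an (ltW h1); have p2 := ler_wpM2l bn (ltW h2).
apply: le_lt_trans (lerD p1 p2) _; rewrite eE.
by move: e1; clear; move: (nc a) (nc b) => v w; lra.
Qed.

Lemma cusp_form0 : cusp_form G k (fun=> 0).
Proof.
split.
- move=> z; rewrite -[valL_ _ _]/(ext (fun=> 0)).
  have -> : ext (fun=> 0 : R[i]) = cst 0.
    by apply/funext => w; rewrite /ext /=; case: ('oinv_set_val w).
  exact: derivable_cst.
- by move=> A _ z; rewrite mulr0.
- by move=> s _ e e0; exists 0 => z _; rewrite /slash mul0r Normc.normc0.
Qed.

Lemma cusp_form_sum d (c : 'I_d -> R[i]) (f : 'I_d -> UHP R -> R[i]) :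
  (forall j, cusp_form G k (f j)) -> cusp_form G k (fun z => \sum_j c j * f j z).
Proof.
elim: d c f => [|d IH] c f Hf.
  by under eq_fun do rewrite big_ord0; exact: cusp_form0.
under eq_fun do rewrite big_ord_recl -[X in _ + X]mul1r.
by apply: cusp_form_comb2; [exact: Hf|apply: IH => j; exact: Hf].
Qed.

End LinearCombinations.

(** * Integrals of quadratic forms in orthonormal functions *)

Section GramIntegral.
Local Open Scope ereal_scope.
Context (R : realType) d (T : measurableType d) (mu : {measure set T -> \bar R}).
Variables (D : set T).
Hypothesis mD : measurable D.

(** A real integral takes the value 0 when the extended one is infinite, so a nonzero value
    certifies finiteness. *)
Lemma integrable_of_Rintegral_neq0 (m : T -> R) : measurable_fun D m -> (forall x, D x -> (0 <= m x)%R) ->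
  (\int[mu]_(x in D) m x)%R <> 0%R -> mu.-integrable D (EFin \o m).
Proof.
move=> mm m0 I; apply/integrableP; split; first exact/measurable_EFinP.
have E : \int[mu]_(x in D) `|(EFin \o m) x| = \int[mu]_(x in D) (m x)%:E.
  by apply: eq_integral => x /set_mem /m0 h; rewrite gee0_abs // lee_fin.
rewrite E; have I0 : 0 <= \int[mu]_(x in D) (m x)%:E.
  by apply: integral_ge0 => x /m0 h; rewrite lee_fin.
move: I I0; rewrite /Rintegral; case: (integral _ _ _) => [r|//|//] _ _.
  by rewrite ltry.
Qed.

Lemma integrable_dominated2 (u m1 m2 : T -> R) : measurable_fun D u ->
  mu.-integrable D (EFin \o m1) -> mu.-integrable D (EFin \o m2) ->
  (forall x, D x -> (`|u x| <= m1 x + m2 x)%R) -> mu.-integrable D (EFin \o u).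
Proof.
move=> mm i1 i2 h.
apply: (@le_integrable _ _ _ mu D mD _ ((EFin \o m1) \+ (EFin \o m2))).
- exact/measurable_EFinP.
- move=> x Dx /=; rewrite lee_fin; apply: le_trans (h x Dx) _; exact: ler_norm.
- exact: integrableD.
Qed.

Lemma integral_comb2 (u v : T -> R) (r s : R) :
  mu.-integrable D (EFin \o u) -> mu.-integrable D (EFin \o v) ->
  mu.-integrable D (EFin \o (fun x => r * u x - s * v x)%R) /\
  \int[mu]_(x in D) (r * u x - s * v x)%:E =
    (r * (\int[mu]_(x in D) u x)%R - s * (\int[mu]_(x in D) v x)%R)%:E.
Proof.
move=> iu iv.
have ru : mu.-integrable D (EFin \o (fun x => r * u x)%R) by exact: (integrableZl mD r iu).
have sv : mu.-integrable D (EFin \o (fun x => s * v x)%R) by exact: (integrableZl mD s iv).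
have i : mu.-integrable D (EFin \o (fun x => r * u x - s * v x)%R) by exact: (integrableB mD ru sv).
split=> //; rewrite -(RintegralZl _ mD iu) -(RintegralZl _ mD iv) -(RintegralB mD ru sv).
by rewrite /Rintegral fineK // integrable_fin_num.
Qed.

(** [U] and [V] stand for the real and imaginary parts of the pairwise products of the functions;
    orthonormality leaves the diagonal terms only. *)
Lemma gram_integral n (U V : 'I_n -> 'I_n -> T -> R) (al be : 'I_n -> 'I_n -> R) (m : T -> R) :
  (forall i j, mu.-integrable D (EFin \o U i j)) -> (forall i j, mu.-integrable D (EFin \o V i j)) ->
  (forall i j, (\int[mu]_(x in D) U i j x)%R = (i == j)%:R%R) ->
  (forall i j, (\int[mu]_(x in D) V i j x)%R = 0%R) ->
  (forall x, D x -> m x = (\sum_i \sum_j (al i j * U i j x - be i j * V i j x))%R) ->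
  \int[mu]_(x in D) (m x)%:E = (\sum_i al i i)%R%:E.
Proof.
move=> iU iV EU EV mE.
have c i j := integral_comb2 (al i j) (be i j) (iU i j) (iV i j).
transitivity (\int[mu]_(x in D) (\sum_(p : 'I_n * 'I_n)
     (EFin \o (fun x => al p.1 p.2 * U p.1 p.2 x - be p.1 p.2 * V p.1 p.2 x)%R) x)).
  by apply: eq_integral => x /set_mem /mE ->; rewrite pair_big /= sumEFin.
rewrite integral_sum //; last by move=> p; exact: (c p.1 p.2).1.
rewrite (eq_bigr (fun p : 'I_n * 'I_n => (al p.1 p.2 * (p.1 == p.2)%:R)%R%:E)); last first.
  by move=> p _; rewrite (c p.1 p.2).2 EU EV mulr0 subr0.
rewrite sumEFin; congr (_%:E).
rewrite -(pair_big xpredT xpredT (fun i j => al i j * (i == j)%:R)%R) /=.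
apply: eq_bigr => i _; rewrite (bigD1 i) //= eqxx mulr1 big1 ?addr0 // => j ji.
by rewrite eq_sym (negbTE ji) mulr0.
Qed.

End GramIntegral.

(** * Petersson norms of linear combinations *)

Section Orthonormal.
Variables (R : realType) (G : set (PSL2 R)) (k : nat) (F : set (UHP R)).
Hypothesis mF : measurable (@coordH R @` F).
Implicit Types (f g : UHP R -> R[i]) (p : R * R).
Local Notation cF := (@coordH R @` F).
Local Notation mu := (@lebesgue2 R).

Definition wmass f p : R := mass f k p / p.2 ^+ 2.

Lemma measurable_wmass f : holomorphicH f -> measurable_fun [set: R * R] (wmass f).
Proof.
move=> hf; apply: measurable_funM; first exact: measurable_mass.
by apply: (measurableT_comp (@measurable_inv_sqr R)); exact: measurable_snd.
Qed.

Lemma wmass_ge0 f p : 0 <= wmass f p.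
Proof. by rewrite /wmass divr_ge0 ?mass_ge0 ?sqr_ge0. Qed.

Lemma hintS_wmass f : hintS cF (fun p => (mass f k p)%:E) = (\int[mu]_(p in cF) (wmass f p)%:E)%E.
Proof.
apply: eq_integral => p /set_mem[z _ <-].
by rewrite /hdens /= imH_gt0 -EFinM.
Qed.

Definition wprod f g p : R[i] :=
  ext f (p.1 +i* p.2)%C * (ext g (p.1 +i* p.2)%C)^*%C * ((p.2 ^+ (2 * k) / p.2 ^+ 2)%:C)%C.

Lemma wmass_wprod f p : 0 < p.2 -> wmass f p = Re (wprod f f p).
Proof.
move=> p0; rewrite /wmass /mass /sqmod p0 nc_sqr /wprod.
by case: (ext f _) => x y /=; ring.
Qed.

Lemma wmass_comb2 a b f g p : 0 < p.2 ->
  wmass (fun z => a * f z + b * g z) p = nc a ^+ 2 * wmass f p + nc b ^+ 2 * wmass g p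
    + 2 * Re (a * b^*%C * wprod f g p).
Proof.
move=> p0; rewrite /wmass /mass /sqmod p0 !nc_sqr ext_comb2 /wprod.
case: (ext f _) => x y; case: (ext g _) => u v; case: a => a1 a2; case: b => b1 b2 /=.
by ring.
Qed.

Lemma cF_gt0 p : cF p -> 0 < p.2.
Proof. by move=> [z _ <-]; exact: imH_gt0. Qed.

(** Polarization: the mixed term is a combination of the functions [wmass], whose measurability is
    known. The factor [c = -i] gives the imaginary part. *)
Lemma measurable_Re_wprod c f g : holomorphicH f -> holomorphicH g ->
  measurable_fun cF (fun p => Re (c * wprod f g p)).
Proof.
move=> hf hg.
apply: (@eq_measurable_fun _ _ _ _ _ (fun p => (wmass (fun z => c * f z + 1 * g z) p -
   nc c ^+ 2 * wmass f p - wmass g p) / 2)).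
  move=> p /set_mem /cF_gt0 p0; rewrite wmass_comb2 // Normc.normc1 expr1n mul1r.
  have -> : (1^*%C : R[i]) = 1 by rewrite rmorph1.
  by rewrite mulr1; field.
have m1 := measurable_wmass (@holomorphic_comb2 R c 1 f g hf hg).
have m2 := measurable_wmass hf; have m3 := measurable_wmass hg.
apply: measurable_funTS; apply: measurable_funM; last exact: measurable_cst.
apply: measurable_funB; last exact: m3.
apply: measurable_funB; first exact: m1.
by apply: measurable_funM; [exact: measurable_cst|exact: m2].
Qed.

Lemma wprod_bound f g p : 0 < p.2 ->
  `|Re (wprod f g p)| <= wmass f p + wmass g p /\ `|Im (wprod f g p)| <= wmass f p + wmass g p.
Proof.
move=> p0; have N : nc (wprod f g p) <= wmass f p + wmass g p.
  rewrite /wprod /wmass /mass /sqmod p0 !Normc.normcM nc_real.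
  have -> : nc ((ext g (p.1 +i* p.2)%C)^*)%C = nc (ext g (p.1 +i* p.2)%C).
    by case: (ext g _) => u v /=; rewrite sqrrN.
  have q0 : 0 <= p.2 ^+ (2 * k) / p.2 ^+ 2 by rewrite divr_ge0 ?exprn_ge0 ?ltW.
  rewrite (ger0_norm q0).
  move: q0 (nc_ge0 (ext f (p.1 +i* p.2)%C)) (nc_ge0 (ext g (p.1 +i* p.2)%C)).
  move: (nc _) (nc _) => u v q0 u0 v0.
  rewrite (_ : _ + _ = (u ^+ 2 + v ^+ 2) * (p.2 ^+ (2 * k) / p.2 ^+ 2)); last by ring.
  apply: ler_wpM2r => //.
  have h : 0 <= (u - v) ^+ 2 by exact: sqr_ge0.
  have h' : 0 <= (u + v) ^+ 2 by exact: sqr_ge0.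
  by move: h h'; lra.
by split; apply: le_trans N; [exact: Re_le_nc|exact: Im_le_nc].
Qed.

Lemma petersson_wprod f g : petersson F k f g =
  ((\int[mu]_(p in cF) Re (wprod f g p))%R +i* (\int[mu]_(p in cF) Im (wprod f g p))%R)%C.
Proof.
have valLE (h : UHP R -> R) z : valL_ 0 h ((coordH z).1 +i* (coordH z).2)%C = h z.
  rewrite -[((coordH z).1 +i* (coordH z).2)%C]/(reH z +i* imH z)%C -val_UHP; exact: (congr1 (fun u : UHP R -> R => u z) (valLK 0 h)).
rewrite /petersson /hyp_Rintegral; congr (_ +i* _)%C; apply: eq_Rintegral => p /set_mem[z _ <-].
  rewrite valLE /wprod /= -val_UHP !extE.
  by case: (f z) => x y; case: (g z) => u v /=; ring.
rewrite valLE /wprod /= -val_UHP !extE.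
by case: (f z) => x y; case: (g z) => u v /=; ring.
Qed.

Lemma Re_sum n (E : 'I_n -> R[i]) : Re (\sum_i E i) = \sum_i Re (E i).
Proof. by elim/big_rec2: _ => [|i x y _ <-] //; rewrite ReD. Qed.

Lemma hintS_combination d (f : 'I_d -> UHP R -> R[i]) (c : 'I_d -> R[i]) :
  (forall j, holomorphicH (f j)) -> (forall i j, petersson F k (f i) (f j) = (i == j)%:R) ->
  hintS cF (fun p => (mass (fun z => \sum_j c j * f j z) k p)%:E) = (\sum_j nc (c j) ^+ 2)%:E.
Proof.
move=> hf P.
have PU i j : (\int[mu]_(p in cF) Re (wprod (f i) (f j) p))%R = (i == j)%:R.
  by have := P i j; rewrite petersson_wprod; case: (i == j) => -[].
have PV i j : (\int[mu]_(p in cF) Im (wprod (f i) (f j) p))%R = 0.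
  by have := P i j; rewrite petersson_wprod; case: (i == j) => -[].
(* The basis functions have norm 1, not 0, so their masses are integrable; [wprod_bound] then makes
   all the products integrable. *)
have im i : mu.-integrable cF (EFin \o wmass (f i)).
  apply: integrable_of_Rintegral_neq0 => //.
  - by apply: measurable_funTS; exact: measurable_wmass.
  - by move=> p _; exact: wmass_ge0.
  have E : (\int[mu]_(p in cF) wmass (f i) p)%R = 1.
    rewrite -[RHS]/((true : nat)%:R) -(eqxx i) -(PU i i); apply: eq_Rintegral => p /set_mem /cF_gt0; exact: wmass_wprod.
  by rewrite E; apply/eqP; rewrite oner_eq0.
have iU i j : mu.-integrable cF (EFin \o (fun p => Re (wprod (f i) (f j) p))).
  apply: (@integrable_dominated2 _ _ _ mu cF mF (fun p => Re (wprod (f i) (f j) p)) (wmass (f i)) (wmass (f j)) _ (im i) (im j)).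
    by have := measurable_Re_wprod 1 (hf i) (hf j); under eq_fun do rewrite mul1r.
  by move=> p /cF_gt0 p0; have [] := wprod_bound (f i) (f j) p0.
have iV i j : mu.-integrable cF (EFin \o (fun p => Im (wprod (f i) (f j) p))).
  apply: (@integrable_dominated2 _ _ _ mu cF mF (fun p => Im (wprod (f i) (f j) p)) (wmass (f i)) (wmass (f j)) _ (im i) (im j)).
    have := measurable_Re_wprod (0 -i* 1)%C (hf i) (hf j); congr (measurable_fun _ _).
    by apply/funext => p; rewrite ReM /= mul0r sub0r mulN1r opprK.
  by move=> p /cF_gt0 p0; have [] := wprod_bound (f i) (f j) p0.
rewrite hintS_wmass.
apply: (etrans (@gram_integral _ _ _ mu cF mF d (fun i j p => Re (wprod (f i) (f j) p))
  (fun i j p => Im (wprod (f i) (f j) p)) (fun i j => Re (c i * (c j)^*%C))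
  (fun i j => Im (c i * (c j)^*%C)) _ iU iV PU PV _)); last first.
  by congr (_%:E); apply: eq_bigr => i _; rewrite nc_sqr; case: (c i) => x y /=; ring.
move=> p /cF_gt0 p0; rewrite wmass_wprod //.
have extS : ext (fun z => \sum_j c j * f j z) (p.1 +i* p.2)%C = \sum_j c j * ext (f j) (p.1 +i* p.2)%C.
  by rewrite ext_mk; apply: eq_bigr => j _; rewrite ext_mk.
rewrite /wprod extS rmorph_sum /= mulr_suml mulr_suml Re_sum.
apply: eq_bigr => i _; rewrite mulr_sumr mulr_suml Re_sum.
apply: eq_bigr => j _; rewrite rmorphM -ReM; congr Re.
by ring.
Qed.

Theorem bergman_le d (f : 'I_d -> UHP R -> R[i]) (B : R) z : 0 <= B ->
  (forall j, cusp_form G k (f j)) -> (forall i j, petersson F k (f i) (f j) = (i == j)%:R) ->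
  (forall g J, cusp_form G k g -> (hintS cF (fun p => (mass g k p)%:E) <= J%:E)%E ->
    mass g k (coordH z) <= B * J) ->
  bergman k f z <= B.
Proof.
move=> B0 cf P bound.
pose c j := (f j z)^*%C; pose g w := \sum_j c j * f j w.
have cg : cusp_form G k g by exact: cusp_form_sum.
have hf j : holomorphicH (f j) by have [] := cf j.
pose N := \sum_j nc (f j z) ^+ 2.
have nc_conj (u : R[i]) : nc u^*%C = nc u by case: u => x y /=; rewrite sqrrN.
have IN : (hintS cF (fun p => (mass g k p)%:E) <= N%:E)%E.
  by rewrite hintS_combination // le_eqVlt; apply/orP; left; apply/eqP; congr (_%:E); apply: eq_bigr => j _; rewrite nc_conj.
have := bound g N cg IN; rewrite mass_coordH.
have gz : g z = (N%:C)%C.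
  rewrite /g /N (big_morph (real_complex R) (rmorphD _) (rmorph0 _)); apply: eq_bigr => j _.
  by rewrite nc_sqr /c; case: (f j z) => x y; apply/eqP; rewrite eq_complex /=; apply/andP; split; apply/eqP; ring.
have N0 : 0 <= N by apply: sumr_ge0 => j _; exact: sqr_ge0.
rewrite gz nc_real ger0_norm // /bergman -mulr_suml -/N.
(* One factor [N] is cancelled from [N ^+ 2 * imH z ^+ (2 * k) <= B * N]; for [N = 0] the kernel
   vanishes at [z]. *)
have [->|Nn] := eqVneq N 0; first by rewrite mul0r.
have Np : 0 < N by rewrite lt_neqAle eq_sym Nn.
by rewrite expr2 -mulrA mulrC ler_pM2r.
Qed.

End Orthonormal.

Theorem mainTheorem1 (R : realType) (G0 : set (PSL2 R))
    (hG0 : fuchsian_first_kind G0) :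
  (exists C : R, 0 < C /\
     forall G : set (PSL2 R), is_subgroup G -> G `<=` G0 -> finite_index G G0 ->
     forall k : nat, (1 <= k)%N ->
     forall F : set (UHP R), fundamental_domain G F ->
     forall (d : nat) (f : 'I_d -> UHP R -> R[i]), orthonormal_basis G F k f ->
     (ereal_sup [set (bergman k f z)%:E | z in [set: UHP R]]
        <= (C * k%:R `^ (3 / 2))%:E)%E)
  /\
  (cocompact G0 ->
   exists C' : R, 0 < C' /\
     forall G : set (PSL2 R), is_subgroup G -> G `<=` G0 -> finite_index G G0 ->
     forall k : nat, (1 <= k)%N ->
     forall F : set (UHP R), fundamental_domain G F ->
     forall (d : nat) (f : 'I_d -> UHP R -> R[i]), orthonormal_basis G F k f ->
     (ereal_sup [set (bergman k f z)%:E | z in [set: UHP R]]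
        <= (C' * k%:R)%:E)%E).
Proof.
have [sG0 dG0 [F0 [mF0 cov0 _] area0]] := hG0.
have sH0 := hat_sgp sG0; have dH0 := hat_dsc sG0 dG0.
have covP (G : set (PSL2 R)) F : (forall z, orbitH G z `&` F !=set0) ->
    forall z, exists2 A, hat G A & F (mobius A z).
  by move=> cov z; have [_ [[A GA <-] FA]] := cov z; exists A.
have area : (hintS (@coordH R @` F0) (fun=> 1) < +oo)%E.
  apply: le_lt_trans area0; rewrite le_eqVlt; apply/orP; left; apply/eqP.
  by apply: eq_integral => p /set_mem[z _ <-]; rewrite /hdens /= imH_gt0 mul1e.
have tc := finite_area_thick_cover sH0 dH0 mF0 (covP _ _ cov0) area.
split.
  have [C C0 HC] := cusp_form_bound sH0 dH0 tc.
  exists C; split=> // G sG GG0 _ k k0 F [mF cov _] d f [[cf _] P].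
  apply: ge_ereal_sup => _ [z _ <-]; rewrite lee_fin.
  have kp : 0 < k%:R :> R by rewrite ltr0n.
  have -> : k%:R `^ (3 / 2) = k%:R * Num.sqrt k%:R :> R.
    have -> : 3 / 2 = 1 + 2^-1 :> R by field.
    by rewrite powRD ?gt_eqF ?implybT // powRr1 ?ltW // powR12_sqrt // ltW.
  apply: (bergman_le mF _ cf P); first by rewrite !mulr_ge0 ?sqrtr_ge0 // ltW.
  move=> g J cg HJ; apply: (HC G k g F J k0 (hat_sgp sG) _ cg mF (covP _ _ cov) HJ).
  by move=> A; exact: GG0.
move=> cpt; have [N HN] := cocompact_multiplicity sH0 dH0 cpt.
(* The summand [1] makes the constant positive even if [N = 0]. *)
exists (48 * 48 * N%:R + 1); split; first by rewrite ltr_wpDl // !mulr_ge0.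
move=> G sG GG0 _ k k0 F [mF cov _] d f [[cf _] P].
apply: ge_ereal_sup => _ [z _ <-]; rewrite lee_fin.
have HH : hat G `<=` hat G0 by move=> A; exact: GG0.
have N0 : 0 <= 48 * 48 * N%:R :> R by rewrite !mulr_ge0.
apply: (bergman_le mF _ cf P); first by rewrite mulr_ge0 // addr_ge0.
move=> g J cg HJ.
apply: le_trans (multiplicity_bound dH0 k0 (hat_sgp sG) HH cg mF (covP _ _ cov) HJ (HN _ k z (hat_sgp sG) HH k0)) _.
have J0 := mass_integral_ge0 HJ.
rewrite (_ : _ * (N%:R * J) = 48 * 48 * N%:R * (k%:R * J)); last by ring.
by rewrite -[leRHS]mulrA; apply: ler_wpM2r; [rewrite mulr_ge0|rewrite lerDl].
Qed.
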